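(* Let the data follow, for each $n$, the uncontaminated model $Y_i=X_i^\top\beta^*+\xi_i$, $i=1,\dots,n$, under Assumptions 2 and 3 of the context. Let $\tau_n:=\frac{u_n}{n}$, where $u_n$ is a sequence that slowly goes to infinity as $n$ increases, and suppose that $n\ge C(o'+p)$, where $C$ is a sufficiently large absolute constant and $o'$ is the number of indices $i\in\{1,\dots,n\}$ with $(Y_i-X_i^\top\beta^* )^2\ge \frac{1}{2\tau_n}$. Let $\hat\beta$ be the output, on the first $n$ observations, of the two-stage Welsch algorithm described in the context run with $\tau=\tau_n$. Then $$\sqrt n\,(\hat\beta-\beta^* )\xrightarrow{d}\mathcal{N}(0,I_p)\qquad\text{as } n\to\infty.$$
   Context: Model: for $i=1,2,\dots$, $Y_i=X_i^\top\beta^*+\xi_i$ with $X_i\in\mathbb{R}^p$, $Y_i,\xi_i\in\mathbb{R}$, $p$ fixed and $\beta^*\in\mathbb{R}^p$ fixed and unknown (no outliers). The $\xi_i$ are independent of the $X_i$. Assumption 2: the $X_i$ are i.i.d., centered, isotropic ($\mathbf{E}(X_1X_1^\top)=I_p$) and $1$-sub-Gaussian, i.e. $\mathbf{E}\exp(\langle u,X_1\rangle)\le\exp(\|u\|^2/2)$ for all $u\in\mathbb{R}^p$. Assumption 3: the $\xi_i$ are i.i.d., centered, with unit variance, and for some $\ell\ge2$ and $a>0$, $\mathbf{E}(|\xi_1|^\ell)\le a^\ell$; when $\ell=\infty$ this is replaced by $\mathbf{P}(|\xi_1|\ge t)\le 2\exp(-t^2/(2a^2))$. The number $\ell$, or a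 lower bound for it, is known, and $a$ is bounded by a sufficiently large constant. Algorithm. Let $f(\beta)=\frac{1}{\tau n}\sum_{i=1}^n(1-\exp(-\frac\tau2(Y_i-X_i^\top\beta)^2))$ be the empirical Welsch loss and, for a sufficiently small constant $c>0$, $\mathscr{J}_c=\{\beta\in\mathbb{R}^p:\|\beta-\beta^*\|\le c\}$ (the basin of attraction). Stage 1: starting from some $\beta_0$, take steps of an optimization procedure for the least absolute deviation problem $\min_\beta\sum_{i=1}^n|Y_i-X_i^\top\beta|$ until the median of the absolute residuals $|Y_i-X_i^\top\beta|$ falls below a threshold; call the result $\beta_{\rm LAD}$; it is taken to be a valid initialization, i.e. to lie in $\mathscr{J}_c$. Stage 2: solve $\min_{\beta}f(\beta)$ by an optimization procedure initialized at $\beta_{\rm LAD}$. The output $\hat\beta$ is the solution found in the basin, i.e. a minimizer of $f$ over $\mathscr{J}_c$. $\|\cdot\|$ is the Euclidean norm and $\xrightarrow{d}$ is convergence in distribution. *)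

(* Defs.v *)
From HB Require Import structures.
From mathcomp Require Import all_boot all_order all_algebra.
From mathcomp Require Import all_classical all_reals all_analysis.

Set Implicit Arguments.
Unset Strict Implicit.
Unset Printing Implicit Defensive.

Import Order.TTheory GRing.Theory Num.Theory.
Import numFieldNormedType.Exports.

Local Open Scope classical_set_scope.
Local Open Scope ring_scope.

Definition measure_matrix_display : measure_display -> measure_display.
Proof. exact. Qed.

(* Matrices carry the product sigma-algebra, generated by the entries. For
   real entries it is the Borel sigma-algebra. *)
Section measurable_matrix.
Context {d : measure_display} {T : measurableType d} {m n : nat}.

Definition entry_preimages : set (set 'M[T]_(m, n)) :=
  \bigcup_(ij in [set: 'I_m * 'I_n])
    preimage_set_system setT (fun A : 'M[T]_(m, n) => A ij.1 ij.2) measurable.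

Let matrix_set0 : <<s entry_preimages >> set0.
Proof. exact: sigma_algebra0. Qed.

Let matrix_setC A : <<s entry_preimages >> A -> <<s entry_preimages >> (~` A).
Proof. exact: sigma_algebraC. Qed.

Let matrix_bigcup (F : _^nat) : (forall i, <<s entry_preimages >> (F i)) ->
  <<s entry_preimages >> (\bigcup_i (F i)).
Proof. exact: sigma_algebra_bigcup. Qed.

HB.instance Definition _ := @isMeasurable.Build (measure_matrix_display d)
  'M[T]_(m, n) <<s entry_preimages >> matrix_set0 matrix_setC matrix_bigcup.

End measurable_matrix.

Lemma measurable_entry d (T : measurableType d) (m n : nat) (i : 'I_m)
    (j : 'I_n) :
  measurable_fun [set: 'M[T]_(m, n)] (fun A : 'M[T]_(m, n) => A i j).
Proof.
move=> _ B mB; apply: sub_sigma_algebra.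
by exists (i, j) => //; exists B.
Qed.

Lemma measurable_fun_matrix d d' (S : measurableType d)
    (T : measurableType d') (m n : nat) (f : S -> 'M[T]_(m, n)) :
  (forall i j, measurable_fun setT (fun x => f x i j)) ->
  measurable_fun setT f.
Proof.
move=> mf _ B mB.
suff : <<s entry_preimages >> `<=` image_set_system setT f measurable by apply.
apply: smallest_sub.
  exact/sigma_algebra_image/sigma_algebra_measurable.
move=> _ [ij _ [C mC <-]].
by rewrite /image_set_system /= setTI; exact: mf.
Qed.

Section standard_normal.
Context {R : realType}.

Definition cons_cV (n : nat) (xv : measurableTypeR R * 'cV[R]_n) : 'cV[R]_n.+1 :=
  col_mx (const_mx xv.1 : 'cV[R]_1) xv.2.

Let measurable_cons_cV n : measurable_fun setT (@cons_cV n).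
Proof.
apply: measurable_fun_matrix => i j.
have [k ->|k ->] := fintype.split_ordP (i : 'I_(1 + n)).
- rewrite (_ : (fun _ => _) = fst); first exact: measurable_fst.
  apply/funext => xv; apply: etrans (mxE _ _ k j).
  exact: (@col_mxEu R 1 n 1 (const_mx xv.1) xv.2 k j).
- rewrite (_ : (fun _ => _) = (fun v : 'cV[R]_n => v k j) \o snd).
    exact: measurableT_comp (measurable_entry k j) measurable_snd.
  apply/funext => xv; exact: (@col_mxEd R 1 n 1 (const_mx xv.1) xv.2 k j).
Qed.

HB.instance Definition _ (n : nat) :=
  isMeasurableFun.Build _ _ _ _ (@cons_cV n) (@measurable_cons_cV n).

(* N(0, I_n), the law of n independent N(0, 1) coordinates. *)
Fixpoint std_normal (n : nat) : probability 'cV[R]_n R :=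
  if n is n'.+1 then
    distribution (normal_prob (0 : R) 1 \x std_normal n')%E (@cons_cV n')
  else \d_(0 : 'cV[R]_0).

End standard_normal.
Arguments std_normal : clear implicits.

Section probability.
Context {d : measure_display} {T : measurableType d} {R : realType}.
Variable P : probability T R.

Section sequences.
Context {d' : measure_display} {T' : measurableType d'}.

Definition mutually_independent (X : nat -> {RV P >-> T'}) : Prop :=
  forall (J : seq nat) (B : nat -> set T'), uniq J ->
    (forall i, measurable (B i)) ->
    P (\bigcap_(i in [set` J]) (X i @^-1` B i)) =
    (\prod_(i <- J) P (X i @^-1` B i))%E.

Definition identically_distributed (X : nat -> {RV P >-> T'}) : Prop :=
  forall (i : nat) (B : set T'), measurable B ->
    distribution P (X i) B = distribution P (X 0%N) B.

Definition iid (X : nat -> {RV P >-> T'}) : Prop :=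
  mutually_independent X /\ identically_distributed X.

Definition sigma_generated (X : nat -> {RV P >-> T'}) : set (set T) :=
  <<s \bigcup_i preimage_set_system setT (X i) measurable >>.

End sequences.

Definition independent_sequences d1 d2 (T1 : measurableType d1)
    (T2 : measurableType d2) (X : nat -> {RV P >-> T1})
    (Z : nat -> {RV P >-> T2}) : Prop :=
  forall A B : set T, sigma_generated X A -> sigma_generated Z B ->
    P (A `&` B) = (P A * P B)%E.

(* The events E n need not be measurable. *)
Definition with_high_probability (E : nat -> set T) : Prop :=
  exists G : nat -> set T, [/\ forall n, measurable (G n),
    forall n, G n `<=` E n & P (G n) @[n --> \oo] --> 1%E].

Definition cvg_in_distribution (p : nat) (Z : nat -> T -> 'cV[R]_p)
    (mu : probability 'cV[R]_p R) : Prop :=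
  forall g : 'cV[R]_p -> R, continuous g ->
    (exists M : R, forall v, `|g v| <= M) ->
    ('E_P[g \o Z n])%E @[n --> \oo] --> (\int[mu]_v (g v)%:E)%E.

End probability.

Section welsch_regression.
Context {R : realType} {p : nat}.
Implicit Types (b u v : 'cV[R]_p) (n : nat).

Definition dotv u v : R := \sum_(j < p) u j 0 * v j 0.

(* The library norm on matrices is the sup norm. *)
Definition norm2 u : R := Num.sqrt (dotv u u).

Definition design_assumption d (T : measurableType d) (P : probability T R)
    (X : nat -> {RV P >-> 'cV[R]_p}) : Prop :=
  [/\ iid X,
      forall j, ('E_P[fun w => X 0%N w j 0%R] = 0)%E,
      forall j k, ('E_P[fun w => (X 0%N w *m (X 0%N w)^T)%R j k] =
                   ((1%:M : 'M[R]_p) j k)%:E)%E &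
      forall u, ('E_P[fun w => expR (dotv u (X 0%N w))] <=
                 (expR (norm2 u ^+ 2 / 2))%:E)%E].

Definition noise_moment_bound d (T : measurableType d) (P : probability T R)
    (z : {RV P >-> R}) (l : \bar R) (a : R) : Prop :=
  match l with
  | r%:E => ('E_P[fun w => (`|z w| `^ r)%R] <= (a `^ r)%:E)%E
  | +oo%E => forall t, 0 <= t ->
      (P [set w | (t <= `|z w|)%R] <=
       (2 * expR (- (t ^+ 2 / (2 * a ^+ 2))))%:E)%E
  | -oo%E => False
  end.

Definition noise_assumption d (T : measurableType d) (P : probability T R)
    (xi : nat -> {RV P >-> R}) (l : \bar R) (a : R) : Prop :=
  [/\ iid xi, ('E_P[xi 0%N] = 0)%E, ('V_P[xi 0%N] = 1)%E &
      noise_moment_bound (xi 0%N) l a].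

Section data.
Variables (n : nat) (x : nat -> 'cV[R]_p) (y : nat -> R).

Definition residual b (i : nat) : R := y i - dotv (x i) b.

Definition welsch_loss (tau : R) b : R :=
  (tau * n%:R)^-1 *
  \sum_(i < n) (1 - expR (- (tau / 2) * residual b i ^+ 2)).

Definition lad_loss b : R := \sum_(i < n) `|residual b i|.

Definition abs_residuals b : seq R := [seq `|residual b i| | i <- iota 0 n].

Definition num_large_residuals (tau : R) b : nat :=
  #|[pred i : 'I_n | (2 * tau)^-1 <= residual b i ^+ 2]|.

End data.

(* The mean of the two middle order statistics, which coincide when the length
   is odd. *)
Definition median (s : seq R) : R :=
  let t := sort <=%R s in
  (t`_((size s).-1)./2 + t`_((size s)./2)) / 2.

(* An iterative optimization procedure, given by its iterates as a function of
   the objective and of the initial point. *)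
Record opt_procedure := OptProcedure {
  iterate :> ('cV[R]_p -> R) -> 'cV[R]_p -> nat -> 'cV[R]_p;
  iterate_init : forall F b, iterate F b 0%N = b }.

Definition basin (bstar : 'cV[R]_p) (c : R) : set 'cV[R]_p :=
  [set b | norm2 (b - bstar) <= c].

Definition minimizes_over (D : set 'cV[R]_p) (F : 'cV[R]_p -> R) b : Prop :=
  D b /\ forall b', D b' -> F b <= F b'.

(* [blad] is the first iterate whose median absolute residual is below [thr]. *)
Definition lad_stage (lad : opt_procedure) (thr : R) (n : nat)
    (x : nat -> 'cV[R]_p) (y : nat -> R) (b0 blad : 'cV[R]_p) : Prop :=
  exists k : nat, let b := lad (lad_loss n x y) b0 in
    [/\ blad = b k, median (abs_residuals n x y (b k)) < thr &
        forall j, (j < k)%N -> thr <= median (abs_residuals n x y (b j))].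

Definition two_stage_welsch (lad welsch : opt_procedure) (b0 : 'cV[R]_p)
    (thr tau c : R) (bstar : 'cV[R]_p) (n : nat) (x : nat -> 'cV[R]_p)
    (y : nat -> R) (bhat : 'cV[R]_p) : Prop :=
  exists blad : 'cV[R]_p,
    [/\ lad_stage lad thr n x y b0 blad,
        basin bstar c blad,
        welsch (welsch_loss n x y tau) blad k @[k --> \oo] --> bhat &
        minimizes_over (basin bstar c) (welsch_loss n x y tau) bhat].

End welsch_regression.
Arguments opt_procedure : clear implicits.

(* Main.v *)
(* Write v = sqrt n (bhat - bstar). As tau_n -> 0 the Welsch function flattens
   into half the square, so n (f(bstar + v / sqrt n) - f(bstar)) equals
   |v|^2 / 2 - <g, v> up to a relative error k |v|^2, uniformly over the whole
   basin, where g = n^(-1/2) sum_i psi(xi_i) X_i and k -> 0 in probability (law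
   of large numbers for the Gram matrix and dominated convergence for the
   curvature of the Welsch function).  A minimizer is thus compared with g
   itself, giving |v - g|^2 <= 12 k |g|^2, and g is close in L^2 to the score
   n^(-1/2) sum_i xi_i X_i.

   The score satisfies the central limit theorem, proved for the test functions
   cos (<t, x> + theta): independence turns the mean into a linear recursion.
   Their span is an algebra, and Bernstein polynomials in the bounded variables
   (1 + sin (x_j / M)) / 2 approximate every bounded continuous function on a
   large cube by elements of it, uniformly bounded outside of the cube. *)
Require Import Defs.
From mathcomp Require Import all_boot all_order all_algebra.
From mathcomp Require Import all_classical all_reals all_analysis.
From mathcomp Require Import measurable_realfun ring lra.
Set Implicit Arguments.
Unset Strict Implicit.
Unset Printing Implicit Defensive.
Import Order.TTheory GRing.Theory Num.Theory.
Import numFieldNormedType.Exports.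
Local Open Scope classical_set_scope.
Local Open Scope ring_scope.

(** * Elementary inequalities *)

(** A minimizer over the basin may lie on its boundary, so no score equation is available. Since the
    error of the expansion is relative to |v|^2 on a ball of fixed radius, comparing the values of
    the loss at [bhat] and at bstar + g / sqrt n is enough: no prior consistency or rate enters,
    only that the second point lies in the basin.

    The noise is only sure to have two moments, and its law need not be symmetric. Hence the limits
    that involve it come from dominated convergence with a quadratic majorant, next to a bound of
    higher order for the pointwise limit. The mean of psi(xi) may differ from zero, which is
    harmless because X is centered and independent of the noise.

    The phase theta does the work of complex numbers: it lets one coordinate be integrated out at a
    time and puts sines among the cosines. *)

Section elementary.
Context {R : realType}.
Implicit Types (x y a b : R) (f df : R -> R).

Lemma norm_le_sqr x y : 0 <= y -> x ^+ 2 <= y ^+ 2 -> `|x| <= y.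
Proof. by move=> y0; rewrite -(real_normK (num_real x)) ler_sqr ?nnegrE. Qed.

Lemma MVT_norm f df a b : (forall x, is_derive x 1 f (df x)) ->
  exists2 c, `|c - a| <= `|b - a| & f b - f a = df c * (b - a).
Proof.
move=> fdf.
have cf A : {within A, continuous f}.
  apply/continuous_subspaceT => x.
  apply/differentiable_continuous/derivable1_diffP.
  by have [] := fdf x.
have [ab|ba] := leP a b.
  have [c /[!in_itv]/= /andP[ac cb] ->] := MVT_segment ab
    (fun x _ => fdf x) (cf _).
  by exists c => //; rewrite !ger0_norm ?subr_ge0// lerB.
have [c /[!in_itv]/= /andP[bc ca] E] := MVT_segment (ltW ba)
    (fun x _ => fdf x) (cf _).
exists c; last by rewrite -opprB E -mulrN opprB.
by rewrite !ler0_norm ?subr_le0// ?(ltW ba)// lerN2 lerB.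
Qed.

(** One rung of a ladder: the bound on sin gives that on cos y - 1, then on sin y - y, then on cos y
    - 1 + y^2 / 2, each being up to sign the derivative of the next. The factorials of Taylor's
    formula are lost; only the powers matter. *)
Lemma norm_le_deriv f df y M : (forall x, is_derive x 1 f (df x)) -> f 0 = 0 ->
  (forall x, `|x| <= `|y| -> `|df x| <= M) -> `|f y| <= M * `|y|.
Proof.
move=> fdf f0 dfM; have [c] := MVT_norm 0 y fdf.
rewrite f0 !subr0 => cy ->; rewrite normrM ler_wpM2r//; exact: dfM.
Qed.

Lemma norm_sin_le y : `|sin y| <= `|y|.
Proof.
rewrite -[leRHS]mul1r; apply: (norm_le_deriv (df := cos)) => [|x _].
  exact: sin0.
exact: cos_max.
Qed.

Lemma norm_cosB1_le y : `|cos y - 1| <= y ^+ 2.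
Proof.
rewrite -real_normK ?num_real// expr2.
apply: (norm_le_deriv (f := fun x => cos x - 1) (df := fun x => - sin x)).
- move=> x; rewrite -[- sin x]subr0; exact: is_deriveB.
- by rewrite cos0 subrr.
- by move=> x xy; rewrite normrN (le_trans (norm_sin_le x)).
Qed.

Lemma norm_sinB_le y : `|sin y - y| <= `|y| ^+ 3.
Proof.
rewrite exprSr.
apply: (norm_le_deriv (f := fun x => sin x - x) (df := fun x => cos x - 1)).
- by rewrite sin0 subrr.
- move=> x xy; rewrite (le_trans (norm_cosB1_le x))//.
  by rewrite -real_normK ?num_real// lerXn2r ?nnegrE.
Qed.

Lemma norm_cos_taylor2_le y : `|cos y - 1 + y ^+ 2 / 2| <= `|y| ^+ 4.
Proof.
rewrite [leRHS]exprSr.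
apply: (norm_le_deriv (f := fun x => cos x - 1 + x ^+ 2 / 2)
  (df := fun x => - (sin x - x))).
- move=> x; apply: is_derive_eq.
  rewrite !scaler0 /GRing.scale/=.
  by field.
- by rewrite cos0 subrr expr0n/= mul0r addr0.
- move=> x xy; rewrite normrN (le_trans (norm_sinB_le x))//.
  by rewrite lerXn2r ?nnegrE.
Qed.

(** Weaker near 0 than [norm_cos_taylor2_le], but quadratic everywhere: it gives an integrable
    majorant under a finite second moment, while the quartic bound gives the pointwise limit.
    [norm_sinB_quadratic] and [norm_sinB_le] share the work likewise. *)
Lemma norm_cos_taylor2_quadratic y : `|cos y - 1 + y ^+ 2 / 2| <= 2 * y ^+ 2.
Proof.
rewrite (le_trans (ler_normD _ _))//
  [leRHS]mulr_natl [leRHS]mulr2n lerD ?norm_cosB1_le//.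
rewrite ger0_norm ?divr_ge0 ?sqr_ge0//.
by have := sqr_ge0 y; lra.
Qed.

Lemma norm_sinB_quadratic y : `|sin y - y| <= 2 * y ^+ 2.
Proof.
rewrite -(real_normK (num_real y)).
have y0 := normr_ge0 y.
have [y1|y1] := leP `|y| 1.
  apply: (le_trans (norm_sinB_le y)); rewrite exprSr.
  by apply: (@le_trans _ _ (`|y| ^+ 2)); [rewrite ler_piMr ?sqr_ge0|
    rewrite mulr_natl mulr2n lerDl sqr_ge0].
rewrite (le_trans (ler_normB _ _))//.
apply: (@le_trans _ _ (2 * `|y|)).
  by rewrite mulr_natl mulr2n lerD// norm_sin_le.
by rewrite ler_pM2l// expr2 ler_peMl// ltW.
Qed.

Lemma expRN_taylor1 x : 0 <= x -> `|expR (- x) - 1 + x| <= x ^+ 2.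
Proof.
move=> x0; have h := expR_ge1Dx (- x).
rewrite ger0_norm; last by lra.
have : expR (- x) * (1 + x) <= 1.
  by rewrite expRN mulrC ler_pdivrMr ?expR_gt0// mul1r expR_ge1Dx.
have : expR (- x) <= 1 by rewrite expR_le1 oppr_le0.
(* With e for expR (- x): e - 1 + x <= x (1 - e) from e (1 + x) <= 1, and 1 - e <= x from [h]. *)
by nra.
Qed.

End elementary.

(** * Integrable functions and their means *)

Local Notation mean mu f := (Rintegral mu setT f).

Section integrable.
Context {d : measure_display} {T : measurableType d} {R : realType}.
Variable mu : {measure set T -> \bar R}.
Implicit Types f g : T -> R.

Definition intble f : Prop := mu.-integrable setT (EFin \o f).

Lemma intble_measurable f : intble f -> measurable_fun setT f.
Proof. by move=> /measurable_int /measurable_EFinP. Qed.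

Lemma intble_le f g : measurable_fun setT f -> intble g ->
  (forall x, `|f x| <= g x) -> intble f.
Proof.
move=> mf ig fg; apply: le_integrable ig => //; first exact/measurable_EFinP.
by move=> x _ /=; rewrite lee_fin (le_trans (fg x))// ler_norm.
Qed.

Lemma intble_norm f : intble f -> intble (fun x => `|f x|).
Proof. exact: integrable_norm. Qed.

Lemma intbleD f g : intble f -> intble g -> intble (fun x => f x + g x).
Proof. by move=> fi gi; exact: (integrableD measurableT fi gi). Qed.

Lemma intbleB f g : intble f -> intble g -> intble (fun x => f x - g x).
Proof. by move=> fi gi; exact: (integrableB measurableT fi gi). Qed.

Lemma intbleZ c f : intble f -> intble (fun x => c * f x).
Proof. by move=> fi; exact: (integrableZl measurableT c fi). Qed.

(* AM-GM: [2 |f g| <= f^2 + g^2] *)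
Lemma intbleM f g : measurable_fun setT f -> measurable_fun setT g ->
  intble (fun x => f x ^+ 2) -> intble (fun x => g x ^+ 2) ->
  intble (fun x => f x * g x).
Proof.
move=> mf mg f2 g2; apply: (intble_le _ (intbleD f2 g2)).
  exact: measurable_funM.
move=> x; rewrite normrM -(real_normK (num_real (f x))).
rewrite -(real_normK (num_real (g x))).
have := sqr_ge0 (`|f x| - `|g x|); rewrite sqrrB.
have : 0 <= `|f x| * `|g x| by rewrite mulr_ge0.
move: (_ * _) (_ ^+ 2) (_ ^+ 2) => a b c; rewrite mulr2n.
move=> a0; rewrite addrAC subr_ge0 => /(le_trans _); apply.
by rewrite lerDl.
Qed.

Lemma meanD f g : intble f -> intble g ->
  mean mu (fun x => f x + g x) = mean mu f + mean mu g.
Proof. by move=> ? ?; rewrite RintegralD. Qed.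

Lemma meanB f g : intble f -> intble g ->
  mean mu (fun x => f x - g x) = mean mu f - mean mu g.
Proof. by move=> ? ?; rewrite RintegralB. Qed.

Lemma meanZ c f : intble f -> mean mu (fun x => c * f x) = c * mean mu f.
Proof. by move=> ?; rewrite RintegralZl. Qed.

Lemma mean_le f g : intble f -> intble g -> (forall x, f x <= g x) ->
  mean mu f <= mean mu g.
Proof. by move=> ? ? fg; apply: le_Rintegral. Qed.

Lemma mean_ge0 f : (forall x, 0 <= f x) -> 0 <= mean mu f.
Proof. by move=> f0; apply: Rintegral_ge0. Qed.

Lemma le_norm_mean f g : intble f -> intble g -> (forall x, `|f x| <= g x) ->
  `|mean mu f| <= mean mu g.
Proof.
move=> f1 g1 fg; apply: le_trans (le_normr_Rintegral _ f1) _ => //.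
by apply: mean_le => //; exact: intble_norm.
Qed.

Lemma mean_intE f : intble f -> (\int[mu]_x (f x)%:E)%E = (mean mu f)%:E.
Proof. by move=> ?; rewrite /Rintegral fineK//; apply: integrable_fin_num. Qed.

Lemma mean_dominated_cvg (F : nat -> T -> R) f g :
  (forall n, measurable_fun setT (F n)) -> measurable_fun setT f ->
  (forall x, F n x @[n --> \oo] --> f x) -> intble g ->
  (forall n x, `|F n x| <= g x) ->
  mean mu (F n) @[n --> \oo] --> mean mu f.
Proof.
move=> mF mf Ff ig Fg.
(* The domination passes to the limit, which makes [f] integrable. *)
have fg x : `|f x| <= g x.
  have cf : `|F n x| @[n --> \oo] --> `|f x| by exact: cvg_norm.
  rewrite -(cvg_lim _ cf)//; apply: limr_le.
    by apply/cvg_ex; exists `|f x|.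
  by near=> n.
have [] := @dominated_convergence _ T R mu setT measurableT
  (fun n => EFin \o F n) (EFin \o f) (EFin \o g).
- by move=> n; apply/measurable_EFinP.
- exact/measurable_EFinP.
- by apply: aeW => x _; apply: cvg_EFin; [near=> n|exact: Ff].
- exact: ig.
- by apply: aeW => x n _ /=; rewrite lee_fin.
move=> _ _ cv; apply: fine_cvg.
rewrite fineK//; apply: integrable_fin_num => //.
exact: (intble_le mf ig).
Unshelve. all: by end_near. Qed.

End integrable.

Section mean.
Context {d : measure_display} {T : measurableType d} {R : realType}.
Variable mu : probability T R.
Implicit Types f g : T -> R.
Local Notation intble := (intble mu).

Lemma intble_cst c : intble (fun=> c).
Proof. exact: finite_measure_integrable_cst. Qed.

Lemma intble_bounded f M : measurable_fun setT f -> (forall x, `|f x| <= M) ->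
  intble f.
Proof. by move=> mf fM; apply: (intble_le mf (intble_cst M)). Qed.

Lemma intble_sum I (s : seq I) (F : I -> T -> R) :
  (forall i, intble (F i)) -> intble (fun x => \sum_(i <- s) F i x).
Proof.
move=> iF; elim: s => [|i s IH].
  by under eq_fun do rewrite big_nil; exact: intble_cst.
by under eq_fun do rewrite big_cons; exact: intbleD.
Qed.

Lemma intble_sqr f : measurable_fun setT f -> intble (fun x => f x ^+ 2) ->
  intble f.
Proof.
move=> mf f2; rewrite (_ : f = fun x => f x * 1).
  by apply: (intbleM (g := fun=> 1)) => //; exact: intble_cst.
by apply/funext => x; rewrite mulr1.
Qed.

Lemma mean_cst c : mean mu (fun=> c) = c.
Proof. 
rewrite Rintegral_cst// -[RHS]mulr1; congr (_ * _).
by rewrite -[1]/(fine 1%E); congr fine; exact: probability_setT.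
Qed.

Lemma mean_sum I (s : seq I) (F : I -> T -> R) : (forall i, intble (F i)) ->
  mean mu (fun x => \sum_(i <- s) F i x) = \sum_(i <- s) mean mu (F i).
Proof.
move=> iF; elim: s => [|i s IH].
  by under eq_Rintegral do rewrite big_nil; rewrite mean_cst big_nil.
under eq_Rintegral do rewrite big_cons.
by rewrite big_cons meanD ?IH//; exact: intble_sum.
Qed.

Lemma expectationE f : intble f -> ('E_mu[f])%E = (mean mu f)%:E.
Proof. by move=> ?; rewrite unlock mean_intE. Qed.

(** The model prescribes values of expectations, not integrability; for a nonnegative variable a
    finite value certifies it. *)
Lemma expectation_lty_intble f : measurable_fun setT f ->
  (forall x, 0 <= f x) ->
  ('E_mu[f] < +oo)%E -> intble f.
Proof.
move=> mf f0; rewrite unlock => foo; apply/integrableP; split.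
  exact/measurable_EFinP.
by under eq_integral do rewrite /= ger0_norm//.
Qed.

Lemma markov_mean f (e : R) : intble f -> (forall x, 0 <= f x) -> 0 < e ->
  (mu [set x | (e <= f x)%R] <= (mean mu f / e)%:E)%E.
Proof.
move=> fi f0 e0; have mf := intble_measurable fi.
have mE : measurable [set x | e <= f x].
  rewrite -[X in measurable X]setTI.
  rewrite (_ : [set x | _] = f @^-1` `[e, +oo[%classic).
    exact: mf.
  by apply/seteqP; split=> x /=; rewrite in_itv/= andbT.
rewrite EFinM lee_pdivlMr// -mean_intE//.
set E := [set x | _].
have -> : (mu E * e%:E = \int[mu]_x (e * \1_E x)%:E)%E.
  under eq_integral do rewrite EFinM.
  rewrite ge0_integralZl//; last 2 first.
  - exact/measurable_EFinP.
  - by rewrite lee_fin ltW.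
  by rewrite integral_indic// setIT muleC.
apply: ge0_le_integral => //.
- by move=> x _; rewrite lee_fin mulr_ge0// ltW.
- by apply/measurable_EFinP/measurable_funM.
- exact/measurable_EFinP.
move=> x _; rewrite lee_fin indicE.
have [|_] := boolP (x \in _); last by rewrite mulr0.
by rewrite inE /= mulr1.
Qed.

End mean.

(** * Independence *)

Lemma eq_measure_integrable d (T : measurableType d) (R : realType)
    (m1 m2 : {measure set T -> \bar R}) (f : T -> \bar R) :
  (forall A, measurable A -> m1 A = m2 A) ->
  m1.-integrable setT f -> m2.-integrable setT f.
Proof.
move=> m12 /integrableP[mf foo]; apply/integrableP; split => //.
apply: le_lt_trans foo; rewrite le_eqVlt; apply/orP; left; apply/eqP.
by apply: eq_measure_integral => A mA _; rewrite m12.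
Qed.

Section independence.
Context {d : measure_display} {T : measurableType d} {R : realType}.
Variable P : probability T R.

Definition indep_systems (G H : set (set T)) : Prop :=
  forall A B, G A -> H B -> P (A `&` B) = (P A * P B)%E.

Lemma indep_systems_sym G H : indep_systems G H -> indep_systems H G.
Proof. by move=> GH A B HA GB; rewrite setIC GH// muleC. Qed.

(** For fixed B in [H], the finite measures sending A to P (A and B) and to P A * P B agree on the
    pi-system [G], hence on the sigma-algebra it generates. Used on each side in turn, this gives
    [indep_systems_sigma]. *)
Lemma indep_systems_sigmal G H : G `<=` measurable -> H `<=` measurable ->
  setI_closed G -> G setT -> indep_systems G H -> indep_systems <<s G >> H.
Proof.
move=> Gm Hm GI GT GH A B sA HB.
have mB : measurable B := Hm _ HB.
have PBfin : P B \is a fin_num by exact: fin_num_measure.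
have PB0 : 0 <= fine (P B) by rewrite fine_ge0.
pose m1 : {measure set T -> \bar R} := mrestr P mB.
pose m2 : {measure set T -> \bar R} := mscale (NngNum PB0) P.
suff : m1 A = m2 A.
  by rewrite /m1 /m2 /= /mrestr /mscale /= fineK// muleC.
apply: (@g_sigma_algebra_measure_unique _ R T G Gm (fun=> setT)) => //.
- by apply/seteqP; split=> // x _; exists 0%N.
- move=> C GC; rewrite /m1 /m2 /= /mrestr /mscale /= fineK//.
  by rewrite GH// muleC.
- move=> k; rewrite /m1 /= /mrestr setTI.
  by rewrite ltey_eq PBfin.
Qed.

Lemma indep_systems_sigma G H : G `<=` measurable -> H `<=` measurable ->
  setI_closed G -> setI_closed H -> G setT -> H setT ->
  indep_systems G H -> indep_systems <<s G >> <<s H >>.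
Proof.
move=> Gm Hm GI HI GT HT GH.
apply: indep_systems_sigmal => //.
  apply: smallest_sub => //; exact: sigma_algebra_measurable.
by apply: indep_systems_sym; apply: indep_systems_sigmal => //;
  exact: indep_systems_sym.
Qed.

Definition indep_funs (U V : T -> R) : Prop :=
  forall A B, measurable A -> measurable B ->
    P (U @^-1` A `&` V @^-1` B) = (P (U @^-1` A) * P (V @^-1` B))%E.

Lemma indep_funs_comp U V f g : indep_funs U V ->
  measurable_fun setT f -> measurable_fun setT g ->
  indep_funs (f \o U) (g \o V).
Proof.
move=> UV mf mg A B mA mB; apply: (UV (f @^-1` A) (g @^-1` B)).
- by rewrite -[X in measurable X]setTI; exact: mf.
- by rewrite -[X in measurable X]setTI; exact: mg.
Qed.

(** The law of (U, V) is the product of the two laws, since they agree on rectangles; Fubini and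
    Tonelli then give the mean and the integrability of the product. *)
Let mean_indep_rv (U V : {RV P >-> R}) : indep_funs U V ->
  intble P U -> intble P V ->
  intble P (fun w => U w * V w) /\
  mean P (fun w => U w * V w) = mean P U * mean P V.
Proof.
move=> UV iU iV.
pose W w := (U w, V w).
have mW : measurable_fun setT W by exact/measurable_fun_pair.
pose m1 := distribution P U; pose m2 := distribution P V.
pose WR : {RV P >-> _} := mfun_Sub (mem_set mW).
have lawW : forall X, measurable X -> (m1 \x m2)%E X = distribution P WR X.
  apply: product_measure_unique => A B mA mB.
  rewrite -[RHS]UV//.
pose f (z : R * R) := (z.1 * z.2)%:E.
have mf : measurable_fun setT f.
  by apply/measurable_EFinP/measurable_funM.
have m2V : m2.-integrable setT EFin.
  by apply: integrable_pushforward.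
have m1U : m1.-integrable setT EFin.
  by apply: integrable_pushforward.
have intf : (m1 \x m2)%E.-integrable setT f.
  apply/integrable12ltyP => //.
  under eq_integral => x _.
    under eq_integral => y _ do rewrite /f /= normrM EFinM.
    rewrite ge0_integralZl//; last exact/measurable_EFinP.
    over.
  rewrite /= ge0_integralZr//; last 2 first.
  - exact/measurable_EFinP.
  - exact: integral_ge0.
  apply: lte_mul_pinfty.
  - exact: integral_ge0.
  - have /integrableP[_ h] := m1U.
    by rewrite ge0_fin_numE// integral_ge0.
  - by have /integrableP[_ h] := m2V.
have intW : (distribution P WR).-integrable setT f.
  exact: eq_measure_integrable intf.
have intUV : intble P (fun w => U w * V w).
  apply/integrableP; split.
    by apply/measurable_EFinP; exact: measurable_funM.
  have /integrableP[_] := intW.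
  by rewrite ge0_integral_distribution//; exact/measurableT_comp.
split => //.
apply: EFin_inj; rewrite -mean_intE//.
transitivity (\int[distribution P WR]_z f z)%E.
  by rewrite integral_distribution.
transitivity (\int[m1 \x m2]_z f z)%E.
  by apply: eq_measure_integral => A mA _; exact/esym/lawW.
rewrite -integral12_prod_meas1//.
rewrite /fubini_F.
transitivity (\int[m1]_x (x%:E * (mean P V)%:E))%E.
  apply: eq_integral => x _.
  under eq_integral do rewrite /f /= EFinM.
  rewrite integralZl//; congr (_ * _)%E.
  by rewrite -mean_intE// integral_distribution.
rewrite integralZr// EFinM; congr (_ * _)%E.
by rewrite -mean_intE// integral_distribution.
Qed.

Lemma mean_indep U V : indep_funs U V -> intble P U -> intble P V ->
  intble P (fun w => U w * V w) /\
  mean P (fun w => U w * V w) = mean P U * mean P V.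
Proof.
move=> UV iU iV.
pose U' : {RV P >-> R} := mfun_Sub (mem_set (intble_measurable iU)).
pose V' : {RV P >-> R} := mfun_Sub (mem_set (intble_measurable iV)).
exact: (@mean_indep_rv U' V').
Qed.

(* A sequence of identically distributed variables each of which is independent
   of the sum of its predecessors: all that the limit theorems below need of an
   i.i.d. sequence. *)
Definition iid_sums (Z : nat -> T -> R) : Prop :=
  [/\ forall i, measurable_fun setT (Z i),
      forall i B, measurable B -> P (Z i @^-1` B) = P (Z 0%N @^-1` B) &
      forall k, indep_funs (fun w => \sum_(i < k) Z i w) (Z k)].

Lemma iid_sums_mean Z (f : R -> R) i : iid_sums Z -> measurable_fun setT f ->
  intble P (f \o Z 0%N) ->
  intble P (f \o Z i) /\ mean P (f \o Z i) = mean P (f \o Z 0%N).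
Proof.
move=> [mZ eqZ _] mf if0.
pose Z0 : {RV P >-> R} := mfun_Sub (mem_set (mZ 0%N)).
pose Zi : {RV P >-> R} := mfun_Sub (mem_set (mZ i)).
have law A : measurable A -> distribution P Zi A = distribution P Z0 A.
  by move=> mA; exact: eqZ.
have int0 : (distribution P Z0).-integrable setT (EFin \o f).
  by apply: integrable_pushforward => //; exact/measurable_EFinP.
have inti : (distribution P Zi).-integrable setT (EFin \o f).
  by apply: eq_measure_integrable int0 => A mA; exact/esym/law.
have iffi : intble P (f \o Z i).
  apply/integrableP; split.
    by apply/measurable_EFinP; exact: measurableT_comp.
  have /integrableP[_] := inti.
  rewrite ge0_integral_distribution//; apply/measurableT_comp => //.
  exact/measurable_EFinP.
split => //; apply: EFin_inj; rewrite -!mean_intE//.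
transitivity (\int[distribution P Zi]_z (EFin \o f) z)%E.
  by rewrite integral_distribution//; exact/measurable_EFinP.
transitivity (\int[distribution P Z0]_z (EFin \o f) z)%E.
  by apply: eq_measure_integral => A mA _; exact: law.
by rewrite integral_distribution//; exact/measurable_EFinP.
Qed.

End independence.

(** * Independence of each pair (X_k, xi_k) from the earlier pairs *)

Section cylinders.
Context {d : measure_display} {T : measurableType d} {R : realType}.
Variable P : probability T R.
Context {d' : measure_display} {T' : measurableType d'}.
Variable Z : nat -> {RV P >-> T'}.

Definition cylinder (k : nat) (B : nat -> set T') : set T :=
  \bigcap_(i in [set` iota 0 k]) (Z i @^-1` B i).

Lemma cylinderP k B w : cylinder k B w <-> forall i, (i < k)%N -> B i (Z i w).
Proof.
split=> h i; first by move=> ik; apply: h; rewrite /= mem_iota.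
by rewrite /= mem_iota => /andP[_]; rewrite add0n => /h.
Qed.

Lemma sigma_generated_preimage i B : measurable B ->
  sigma_generated Z (Z i @^-1` B).
Proof.
move=> mB; apply: sub_sigma_algebra; exists i => //.
by exists B => //; rewrite setTI.
Qed.

Lemma sigma_generated_cylinder k B : (forall i, measurable (B i)) ->
  sigma_generated Z (cylinder k B).
Proof.
move=> mB.
set G := \bigcup_i preimage_set_system setT (Z i) measurable.
suff : @measurable _ (g_sigma_algebraType G) (cylinder k B) by [].
apply: fin_bigcap_measurable; first exact: finite_seq.
by move=> i _; exact: sigma_generated_preimage.
Qed.

Lemma sigma_generatedI A B : sigma_generated Z A -> sigma_generated Z B ->
  sigma_generated Z (A `&` B).
Proof.
set G := \bigcup_i preimage_set_system setT (Z i) measurable.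
exact: (@measurableI _ (g_sigma_algebraType G)).
Qed.

Lemma sigma_generated_measurable A : sigma_generated Z A -> measurable A.
Proof.
apply: smallest_sub; first exact: sigma_algebra_measurable.
move=> _ [i _ [B mB <-]]; rewrite setTI -[X in measurable X]setTI.
exact: measurable_funPT.
Qed.

Lemma mutually_independent_cylinder k B C : mutually_independent Z ->
  (forall i, measurable (B i)) -> measurable C ->
  P (cylinder k B `&` Z k @^-1` C) =
  (P (cylinder k B) * P (Z k @^-1` C))%E.
Proof.
move=> iZ mB mC; rewrite [in RHS]iZ ?iota_uniq//.
(* [mutually_independent] speaks of one family of events, so [C] is spliced in at index [k]. *)
pose B2 i := if i == k then C else B i.
have mB2 i : measurable (B2 i) by rewrite /B2; case: ifP.
have -> : cylinder k B `&` Z k @^-1` C =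
    \bigcap_(i in [set` iota 0 k.+1]) (Z i @^-1` B2 i).
  apply/seteqP; split => w.
    move=> [/cylinderP h1 h2] i; rewrite -[_ i]/(is_true (i \in iota 0 k.+1)).
    rewrite mem_iota add0n ltnS /B2 => ik.
    by case: eqP => [->//|/eqP ik']; apply: h1; rewrite ltn_neqAle ik'.
  move=> h; split.
    apply/cylinderP => i ik.
    have ik1 : i \in iota 0 k.+1 by rewrite mem_iota add0n/= ltnS ltnW.
    by have := h i ik1; rewrite /B2 (ltn_eqF ik).
  have kk1 : k \in iota 0 k.+1 by rewrite mem_iota add0n/= ltnSn.
  by have := h k kk1; rewrite /B2 eqxx.
rewrite iZ ?iota_uniq// -addn1 iotaD add0n big_cat big_seq1 /B2 eqxx;
  congr (_ * _)%E.
rewrite big_seq [RHS]big_seq; apply: eq_bigr => i.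
by rewrite mem_iota add0n => /andP[_ ik]; rewrite (ltn_eqF ik).
Qed.

End cylinders.

Section pairs.
Context {d : measure_display} {T : measurableType d} {R : realType}.
Variable P : probability T R.
Context {d1 : measure_display} {T1 : measurableType d1}.
Context {d2 : measure_display} {T2 : measurableType d2}.
Variables (X : nat -> {RV P >-> T1}) (xi : nat -> {RV P >-> T2}).
Hypotheses (iidX : iid X) (iidxi : iid xi) (indXxi : independent_sequences X
  xi).

(** A pi-system of rectangles generating the sigma-algebra of the first [k] pairs; [present] does
    the same for the pair of index [k]. *)
Let past (k : nat) : set (set T) :=
  [set A | exists B C, [/\ forall i, measurable (B i),
    forall i, measurable (C i) & A = cylinder X k B `&` cylinder xi k C]].

Let present (k : nat) : set (set T) :=
  [set A | exists B C, [/\ measurable B, measurable C &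
    A = X k @^-1` B `&` xi k @^-1` C]].

Let cylinderI d' (T' : measurableType d') (Z : nat -> {RV P >-> T'}) k B C :
  cylinder Z k B `&` cylinder Z k C = cylinder Z k (fun i => B i `&` C i).
Proof.
apply/seteqP; split => w.
  move=> [/cylinderP h1 /cylinderP h2]; apply/cylinderP => i ik.
  by split; [exact: h1|exact: h2].
by move=> /cylinderP h; split; apply/cylinderP => i /h[].
Qed.

Let cylinderT d' (T' : measurableType d') (Z : nat -> {RV P >-> T'}) k :
  cylinder Z k (fun=> setT) = setT.
Proof. by apply/seteqP; split => w // _; apply/cylinderP. Qed.

(** It suffices to treat rectangles. There, independence of the two sequences splits off an X factor
    and a xi factor, mutual independence splits each at index [k], and independence of the
    sequences, read backwards, regroups the four factors. *)
Let past_present k : indep_systems P <<s past k >> <<s present k >>.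
Proof.
have [[iX _] [ixi _]] := (iidX, iidxi).
apply: indep_systems_sigma.
- move=> _ [B [C [mB mC ->]]]; apply: measurableI.
    exact: (sigma_generated_measurable (sigma_generated_cylinder (Z :=
      X) k mB)).
  exact: (sigma_generated_measurable (sigma_generated_cylinder (Z := xi) k mC)).
- move=> _ [B [C [mB mC ->]]]; apply: measurableI.
    exact: (sigma_generated_measurable (sigma_generated_preimage (Z :=
      X) k mB)).
  exact: (sigma_generated_measurable (sigma_generated_preimage (Z := xi) k mC)).
- move=> _ _ [B [C [mB mC ->]]] [B' [C' [mB' mC' ->]]].
  rewrite setIACA !cylinderI; do 2 eexists; split; last reflexivity.
    by move=> i; exact: measurableI.
  by move=> i; exact: measurableI.
- move=> _ _ [B [C [mB mC ->]]] [B' [C' [mB' mC' ->]]].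
  rewrite setIACA; exists (B `&` B'), (C `&` C').
  by split => //; exact: measurableI.
- by exists (fun=> setT), (fun=> setT); rewrite !cylinderT setTI.
- by exists setT, setT; split => //; rewrite !preimage_setT setTI.
move=> _ _ [B [C [mB mC ->]]] [B' [C' [mB' mC' ->]]].
have sX := sigma_generated_cylinder (Z := X) k mB.
have sxi := sigma_generated_cylinder (Z := xi) k mC.
have sX' := sigma_generated_preimage (Z := X) k mB'.
have sxi' := sigma_generated_preimage (Z := xi) k mC'.
rewrite setIACA indXxi; last 2 first.
- exact: sigma_generatedI.
- exact: sigma_generatedI.
by rewrite !mutually_independent_cylinder// !indXxi// muleACA.
Qed.

Lemma indep_funs_cross i (f : T1 -> R) (g : T2 -> R) :
  measurable_fun setT f -> measurable_fun setT g ->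
  indep_funs P (f \o X i) (g \o xi i).
Proof.
move=> mf mg A B mA mB; apply: indXxi.
  apply: (sigma_generated_preimage (Z := X) i (B := f @^-1` A)).
  by rewrite -[Y in measurable Y]setTI; exact: mf.
apply: (sigma_generated_preimage (Z := xi) i (B := g @^-1` B)).
by rewrite -[Y in measurable Y]setTI; exact: mg.
Qed.

Let pair_measurable i : measurable_fun setT (fun w => (X i w, xi i w)).
Proof. exact/measurable_fun_pair. Qed.

Let pair_law i A : measurable A ->
  P ((fun w => (X i w, xi i w)) @^-1` A) =
  P ((fun w => (X 0%N w, xi 0%N w)) @^-1` A).
Proof.
have [[_ eX] [_ exi]] := (iidX, iidxi).
pose m1 := distribution P (X 0%N); pose m2 := distribution P (xi 0%N).
pose WR j : {RV P >-> (T1 * T2)%type} := mfun_Sub (mem_set (pair_measurable j)).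
have law j : forall X, measurable X -> (m1 \x m2)%E X = distribution P (WR j) X.
  apply: product_measure_unique => B C mB mC.
  transitivity (distribution P (X j) B * distribution P (xi j) C)%E.
    by rewrite /distribution /pushforward/= -indXxi//;
      exact: sigma_generated_preimage.
  by congr (_ * _)%E; [exact: eX|exact: exi].
by move=> mA; have := law i _ mA; rewrite (law 0%N _ mA) => /esym.
Qed.

(** The sum of the terms before [k] is measurable for [past k] and the term [k] for [present k].
    Scores, Gram entries and curvature terms are all sums of this form. *)
Lemma iid_sums_pairs (h : T1 -> T2 -> R) :
  measurable_fun setT (fun z : T1 * T2 => h z.1 z.2) ->
  iid_sums P (fun i w => h (X i w) (xi i w)).
Proof.
move=> mh; split.
- by move=> i; exact: (measurableT_comp mh (pair_measurable i)).
- move=> i B mB; apply: (@pair_law i ((fun z => h z.1 z.2) @^-1` B)).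
  by rewrite -[X in measurable X]setTI; exact: mh.
move=> k A B mA mB; apply: (@past_present k).
- have mX i : (i < k)%N ->
      @measurable_fun _ _ (g_sigma_algebraType (past k)) _ setT (X i).
    move=> ik _ C mC; rewrite setTI; apply: sub_sigma_algebra.
    exists (fun j => if j == i then C else setT), (fun=> setT); split => //.
      by move=> j; case: ifP.
    rewrite cylinderT setIT; apply/seteqP; split => w.
      by move=> XC; apply/cylinderP => j _; case: eqP => // ->.
    by move=> /cylinderP /(_ i ik); rewrite eqxx.
  have mxi i : (i < k)%N ->
      @measurable_fun _ _ (g_sigma_algebraType (past k)) _ setT (xi i).
    move=> ik _ C mC; rewrite setTI; apply: sub_sigma_algebra.
    exists (fun=> setT), (fun j => if j == i then C else setT); split => //.
      by move=> j; case: ifP.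
    rewrite cylinderT setTI; apply/seteqP; split => w.
      by move=> XC; apply/cylinderP => j _; case: eqP => // ->.
    by move=> /cylinderP /(_ i ik); rewrite eqxx.
  have mS : @measurable_fun _ _ (g_sigma_algebraType (past k)) _ setT
      (fun w => \sum_(i < k) h (X i w) (xi i w)).
    apply: measurable_sum => i.
    have mXxi := measurable_fun_pair (mX i (ltn_ord i)) (mxi i (ltn_ord i)).
    exact: (measurableT_comp mh mXxi).
  by have := mS measurableT A mA; rewrite setTI.
- have mX : @measurable_fun _ _ (g_sigma_algebraType (present k)) _ setT (X k).
    move=> _ C mC; rewrite setTI; apply: sub_sigma_algebra.
    by exists C, setT; split => //; rewrite preimage_setT setIT.
  have mxi : @measurable_fun _ _ (g_sigma_algebraType (present k)) _ setT (xi
    k).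
    move=> _ C mC; rewrite setTI; apply: sub_sigma_algebra.
    by exists setT, C; split => //; rewrite preimage_setT setTI.
  have mS : @measurable_fun _ _ (g_sigma_algebraType (present k)) _ setT
      (fun w => h (X k w) (xi k w)).
    exact: (measurableT_comp mh (measurable_fun_pair mX mxi)).
  by have := mS measurableT B mB; rewrite setTI.
Qed.

End pairs.

(** * Sums of independent variables *)

Section iid_limit_theorems.
Context {d : measure_display} {T : measurableType d} {R : realType}.
Variable P : probability T R.
Variable Z : nat -> T -> R.
Hypothesis iidZ : iid_sums P Z.
Hypothesis Z2 : intble P (fun w => Z 0%N w ^+ 2).
Hypothesis EZ : mean P (Z 0%N) = 0.

Let S n w := \sum_(i < n) Z i w.
Let sigma2 := mean P (fun w => Z 0%N w ^+ 2).

Let mZ i : measurable_fun setT (Z i).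
Proof. by have [] := iidZ. Qed.

Let mS n : measurable_fun setT (S n).
Proof. exact: measurable_sum. Qed.

Let Sr n w : S n.+1 w = S n w + Z n w.
Proof. exact: big_ord_recr. Qed.

Let Zi2 i : intble P (fun w => Z i w ^+ 2) /\
  mean P (fun w => Z i w ^+ 2) = sigma2.
Proof.
by apply: (iid_sums_mean (f := fun x => x ^+ 2) i iidZ).
Qed.

Let Zi i : intble P (Z i) /\ mean P (Z i) = 0.
Proof.
have iZ0 : intble P (Z 0%N) by exact: intble_sqr.
have [h1 h2] := iid_sums_mean (f := id) i iidZ (@measurable_id _ _ _) iZ0.
by split => //; rewrite -EZ.
Qed.

Let second_moment_S n : intble P (fun w => S n w ^+ 2) /\
  mean P (fun w => S n w ^+ 2) = n%:R * sigma2.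
Proof.
elim: n => [|n [IH1 IH2]].
  have -> : (fun w => S 0%N w ^+ 2) = fun=> 0.
    by apply/funext => w; rewrite /S big_ord0 expr0n.
  by rewrite mean_cst mul0r; split => //; exact: intble_cst.
have [Zn2 EZn2] := Zi2 n; have [Zn EZn] := Zi n.
have Sn : intble P (S n) by exact: intble_sqr.
have indn : indep_funs P (S n) (Z n) by have [_ _] := iidZ; exact.
have [iSZ ESZ] := mean_indep indn Sn Zn.
have -> : (fun w => S n.+1 w ^+ 2) =
    fun w => S n w ^+ 2 + (2 * (S n w * Z n w) + Z n w ^+ 2).
  by apply/funext => w; rewrite Sr; ring.
have i2 := intbleD (intbleZ 2 iSZ) Zn2.
split; first exact: intbleD.
rewrite meanD// meanD//; last exact: intbleZ.
by rewrite meanZ// ESZ EZn IH2 EZn2; rewrite -natr1; ring.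
Qed.

Lemma second_moment_sum n : intble P (fun w => (\sum_(i < n) Z i w) ^+ 2) /\
  mean P (fun w => (\sum_(i < n) Z i w) ^+ 2) =
  n%:R * mean P (fun w => Z 0%N w ^+ 2).
Proof. exact: second_moment_S. Qed.

Let intble_cos (f : T -> R) : measurable_fun setT f ->
  intble P (fun w => cos (f w)).
Proof.
move=> mf; apply: (@intble_bounded _ _ _ P _ 1) => [|w]; last exact: cos_max.
exact: (measurableT_comp (continuous_measurable_fun (@continuous_cos R)) mf).
Qed.

Let intble_sin (f : T -> R) : measurable_fun setT f ->
  intble P (fun w => sin (f w)).
Proof.
move=> mf; apply: (@intble_bounded _ _ _ P _ 1) => [|w]; last exact: sin_max.
exact: (measurableT_comp (continuous_measurable_fun (@continuous_sin R)) mf).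
Qed.

Let mean_norm_le1 (f : T -> R) : intble P f -> (forall w, `|f w| <= 1) ->
  `|mean P f| <= 1.
Proof.
by move=> intf f1; rewrite -[leRHS](mean_cst P 1) le_norm_mean//;
  exact: intble_cst.
Qed.

(** The addition formula replaces the factorization of a characteristic function. The means of sin
    (c S_k + th) need no estimate beyond |.| <= 1, because their coefficient, the mean of sin (c
    Z_0), will be small. *)
Let cos_step (c th : R) k :
  mean P (fun w => cos (c * S k.+1 w + th)) =
  mean P (fun w => cos (c * S k w + th)) * mean P (fun w => cos (c * Z 0%N w)) -
  mean P (fun w => sin (c * S k w + th)) * mean P (fun w => sin (c * Z 0%N w)).
Proof.
have mc : measurable_fun setT (fun x : R => cos (c * x)).
  apply: (measurableT_comp (continuous_measurable_fun (@continuous_cos R))).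
  exact: measurable_funM.
have ms : measurable_fun setT (fun x : R => sin (c * x)).
  apply: (measurableT_comp (continuous_measurable_fun (@continuous_sin R))).
  exact: measurable_funM.
have mcS : measurable_fun setT (fun x : R => cos (c * x + th)).
  apply: (measurableT_comp (continuous_measurable_fun (@continuous_cos R))).
  by apply: measurable_funD => //; exact: measurable_funM.
have msS : measurable_fun setT (fun x : R => sin (c * x + th)).
  apply: (measurableT_comp (continuous_measurable_fun (@continuous_sin R))).
  by apply: measurable_funD => //; exact: measurable_funM.
have mSk : measurable_fun setT (fun w => c * S k w + th).
  by apply: measurable_funD => //; exact: measurable_funM.
have mZk i : measurable_fun setT (fun w => c * Z i w) by exact: measurable_funM.
have indk : indep_funs P (S k) (Z k) by have [_ _] := iidZ; exact.
have [_ Ec] := iid_sums_mean k iidZ mc (intble_cos (mZk 0%N)).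
have [_ Es] := iid_sums_mean k iidZ ms (intble_sin (mZk 0%N)).
have [ic Ecc] := mean_indep (indep_funs_comp indk mcS mc)
  (intble_cos mSk) (intble_cos (mZk k)).
have [is_ Ess] := mean_indep (indep_funs_comp indk msS ms)
  (intble_sin mSk) (intble_sin (mZk k)).
rewrite -Ec -Es -Ecc -Ess -meanB//; apply: eq_Rintegral => w _ /=.
by rewrite -cosD Sr; congr cos; ring.
Qed.

(** Each step replaces the factor [a] by [rho] and drops the sine term, at a cost of at most |a -
    rho| + |b|. As 0 <= rho <= 1, earlier errors are not amplified and simply add up. *)
Let cos_sum_approx (c th rho : R) n : 0 <= rho <= 1 ->
  `|mean P (fun w => cos (c * S n w + th)) - rho ^+ n * cos th| <=
  n%:R * (`|mean P (fun w => cos (c * Z 0%N w)) - rho| +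
          `|mean P (fun w => sin (c * Z 0%N w))|).
Proof.
move=> /andP[rho0 rho1].
set a := mean P (fun w => cos (c * Z 0%N w)).
set b := mean P (fun w => sin (c * Z 0%N w)).
have mSk k : measurable_fun setT (fun w => c * S k w + th).
  by apply: measurable_funD => //; exact: measurable_funM.
elim: n => [|n IH].
  have -> : (fun w => cos (c * S 0%N w + th)) = fun=> cos th.
    by apply/funext => w; rewrite /S big_ord0 mulr0 add0r.
  by rewrite mean_cst expr0 mul1r subrr normr0 mul0r.
rewrite cos_step -/a -/b.
set A := mean P _ in IH *; set B := mean P _.
have A1 : `|A| <= 1 by apply: mean_norm_le1 => [|w];
  [exact: intble_cos|exact: cos_max].
have B1 : `|B| <= 1 by apply: mean_norm_le1 => [|w];
  [exact: intble_sin|exact: sin_max].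
have -> : A * a - B * b - rho ^+ n.+1 * cos th =
  rho * (A - rho ^+ n * cos th) + (A * (a - rho) + B * - b) by rewrite exprS;
    ring.
rewrite -natr1 mulrDl mul1r (le_trans (ler_normD _ _))// lerD//.
  rewrite normrM ger0_norm// (le_trans _ IH)//.
  by rewrite -[leRHS]mul1r ler_wpM2r.
rewrite (le_trans (ler_normD _ _))// !normrM normrN lerD//.
  by rewrite -[leRHS]mul1r ler_wpM2r.
by rewrite -[leRHS]mul1r ler_wpM2r.
Qed.

Let c n : R := (Num.sqrt n%:R)^-1.

Let c2 n : (0 < n)%N -> n%:R * c n ^+ 2 = 1.
Proof.
by move=> n0; rewrite /c exprVn sqr_sqrtr// divff// pnatr_eq0 -lt0n.
Qed.

Let c_cvg0 : c n @[n --> \oo] --> (0 : R).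
Proof.
apply/cvgrPdist_lt => e e0; near=> n.
have n0 : (0 < n)%N by near: n; exact: nbhs_infty_gt.
have c0 : 0 < c n by rewrite invr_gt0 sqrtr_gt0 ltr0n.
rewrite sub0r normrN gtr0_norm//.
rewrite /c -[ltRHS]invrK ltf_pV2 ?posrE ?invr_gt0 ?sqrtr_gt0 ?ltr0n//.
have ei0 : 0 <= e^-1 by rewrite invr_ge0 ltW.
rewrite -(ger0_norm ei0) -sqrtr_sqr ltr_sqrt ?ltr0n//.
by near: n; exact: nbhs_infty_gtr.
Unshelve. all: by end_near. Qed.

(** Subtracting c_n Z_0, which has mean zero, leaves n (sin (c_n Z_0) - c_n Z_0). As n c_n^2 = 1,
    this is at most |Z_0|^3 c_n pointwise and is dominated by 2 Z_0^2. *)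
Let cvg_sin_part : n%:R * mean P (fun w => sin (c n * Z 0%N w)) @[n --> \oo]
  --> (0:R).
Proof.
have iZ0 : intble P (Z 0%N) by have [] := Zi 0.
pose F n w := n%:R * (sin (c n * Z 0%N w) - c n * Z 0%N w).
have mF n : measurable_fun setT (F n).
  apply: measurable_funM => //; apply: measurable_funB;
    last exact: measurable_funM.
  apply: (measurableT_comp (continuous_measurable_fun (@continuous_sin R))).
  exact: measurable_funM.
have -> : (fun n => n%:R * mean P (fun w => sin (c n * Z 0%N w))) =
    fun n => mean P (F n).
  apply/funext => n; rewrite /F meanZ; last first.
    by apply: intbleB; [apply/intble_sin/measurable_funM|exact: intbleZ].
  rewrite meanB; last 2 first.
  - exact/intble_sin/measurable_funM.
  - exact: intbleZ.
  by rewrite meanZ// EZ mulr0 subr0.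
rewrite -[X in _ --> X](mean_cst P 0).
apply: (mean_dominated_cvg (g := fun w => 2 * Z 0%N w ^+ 2)) => //.
- move=> w; apply/cvgrPdist_le => e e0.
  have : `|Z 0%N w| ^+ 3 * c n @[n --> \oo] --> (0 : R).
    by rewrite -[X in _ --> X](mulr0 (`|Z 0%N w| ^+ 3)); apply: cvgMr.
  move=> /cvgrPdist_le /(_ _ e0) h; near=> n.
  have n0 : (0 < n)%N by near: n; exact: nbhs_infty_gt.
  have c0 : 0 <= c n by rewrite invr_ge0 sqrtr_ge0.
  rewrite sub0r normrN /F normrM ger0_norm//.
  apply: (@le_trans _ _ (n%:R * `|c n * Z 0%N w| ^+ 3)).
    by rewrite ler_wpM2l// norm_sinB_le.
  rewrite normrM (ger0_norm c0) exprMn.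
  have -> : n%:R * (c n ^+ 3 * `|Z 0%N w| ^+ 3) =
      (n%:R * c n ^+ 2) * (`|Z 0%N w| ^+ 3 * c n) by ring.
  rewrite c2// mul1r.
  have : `|0 - `|Z 0%N w| ^+ 3 * c n| <= e by near: n.
  by rewrite sub0r normrN ger0_norm// mulr_ge0// exprn_ge0.
- exact: intbleZ.
move=> n w; rewrite /F normrM ger0_norm//.
apply: (@le_trans _ _ (n%:R * (2 * (c n * Z 0%N w) ^+ 2))).
  by rewrite ler_wpM2l// norm_sinB_quadratic.
case: n => [|n]; first by rewrite mul0r mulr_ge0// sqr_ge0.
have -> : n.+1%:R * (2 * (c n.+1 * Z 0%N w) ^+ 2) =
    (n.+1%:R * c n.+1 ^+ 2) * (2 * Z 0%N w ^+ 2) by ring.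
by rewrite c2// mul1r.
Unshelve. all: by end_near. Qed.

(** Chosen as the n-th root of the limiting factor: for n > 0, [rho n ^+ n] is exp (- sigma2 / 2)
    exactly. *)
Let rho n : R := expR (- (sigma2 / (2 * n%:R))).

Let sigma2_ge0 : 0 <= sigma2.
Proof. by apply: mean_ge0 => w; exact: sqr_ge0. Qed.

(** The mean of cos (c_n Z_0) and [rho n] are both 1 - sigma2 / (2 n) + o(1 / n): the former by
    dominated convergence of the rescaled Taylor remainder [F], the latter by [expRN_taylor1]. *)
Let cvg_cos_part :
  n%:R * (mean P (fun w => cos (c n * Z 0%N w)) - rho n) @[n --> \oo] --> (0:R).
Proof.
pose F n w := n%:R * (cos (c n * Z 0%N w) - 1 + (c n * Z 0%N w) ^+ 2 / 2).
have mF n : measurable_fun setT (F n).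
  apply: measurable_funM => //; apply: measurable_funD.
    apply: measurable_funB => //.
    apply: (measurableT_comp (continuous_measurable_fun (@continuous_cos R))).
    exact: measurable_funM.
  by apply: measurable_funM => //; apply: measurable_funX;
    exact: measurable_funM.
have cvF : mean P (F n) @[n --> \oo] --> (0:R).
  rewrite -[X in _ --> X](mean_cst P 0).
  apply: (mean_dominated_cvg (g := fun w => 2 * Z 0%N w ^+ 2)) => //.
  - move=> w; apply/cvgrPdist_le => e e0.
    have : `|Z 0%N w| ^+ 4 * (c n * c n) @[n --> \oo] --> (0 : R).
      rewrite -[X in _ --> X](mulr0 (`|Z 0%N w| ^+ 4)); apply: cvgMr.
      by rewrite -[X in _ --> X](mulr0 0); exact: cvgM.
    move=> /cvgrPdist_le /(_ _ e0) h; near=> n.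
    have n0 : (0 < n)%N by near: n; exact: nbhs_infty_gt.
    have c0 : 0 <= c n by rewrite invr_ge0 sqrtr_ge0.
    rewrite sub0r normrN /F normrM ger0_norm//.
    apply: (@le_trans _ _ (n%:R * `|c n * Z 0%N w| ^+ 4)).
      by rewrite ler_wpM2l// norm_cos_taylor2_le.
    rewrite normrM (ger0_norm c0) exprMn.
    have -> : n%:R * (c n ^+ 4 * `|Z 0%N w| ^+ 4) =
        (n%:R * c n ^+ 2) * (`|Z 0%N w| ^+ 4 * (c n * c n)) by ring.
    rewrite c2// mul1r.
    have : `|0 - `|Z 0%N w| ^+ 4 * (c n * c n)| <= e by near: n.
    by rewrite sub0r normrN ger0_norm// mulr_ge0// ?exprn_ge0// mulr_ge0.
  - exact: intbleZ.
  move=> n w; rewrite /F normrM ger0_norm//.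
  apply: (@le_trans _ _ (n%:R * (2 * (c n * Z 0%N w) ^+ 2))).
    by rewrite ler_wpM2l// norm_cos_taylor2_quadratic.
  case: n => [|n]; first by rewrite mul0r mulr_ge0// sqr_ge0.
  have -> : n.+1%:R * (2 * (c n.+1 * Z 0%N w) ^+ 2) =
    (n.+1%:R * c n.+1 ^+ 2) * (2 * Z 0%N w ^+ 2) by ring.
by rewrite c2// mul1r.
(* This is n x^2 for x = sigma2 / (2 n), the bound on n times the error of linearizing [rho n]. *)
have cvr : sigma2 ^+ 2 / 4 * (c n * c n) @[n --> \oo] --> (0:R).
  rewrite -[X in _ --> X](mulr0 (sigma2 ^+ 2 / 4)); apply: cvgMr.
  by rewrite -[X in _ --> X](mulr0 0); exact: cvgM.
apply/cvgrPdist_le => e e0.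
have e20 : 0 < e / 2 by rewrite divr_gt0.
move/cvgrPdist_le : cvF => /(_ _ e20) h1.
move/cvgrPdist_le : cvr => /(_ _ e20) h2.
near=> n.
have n0 : (0 < n)%N by near: n; exact: nbhs_infty_gt.
have nR : n%:R != 0 :> R by rewrite pnatr_eq0 -lt0n.
have mcZ : measurable_fun setT (fun w => c n * Z 0%N w)
  by exact: measurable_funM.
have icos := intble_cos mcZ.
have EF : mean P (F n) =
    n%:R * (mean P (fun w => cos (c n * Z 0%N w)) - 1 + sigma2 / (2 * n%:R)).
  have icZ : intble P (fun w => (c n * Z 0%N w) ^+ 2 / 2).
    under eq_fun do rewrite exprMn mulrAC.
    exact: intbleZ.
  have ic1 := intbleB icos (intble_cst P 1).
  rewrite /F meanZ; last exact: intbleD.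
  rewrite meanD// meanB//; last exact: intble_cst.
  rewrite mean_cst; congr (_ * (_ + _)).
  under eq_Rintegral do rewrite exprMn mulrAC.
  rewrite meanZ// -/sigma2.
  have -> : c n ^+ 2 = n%:R^-1 by apply: (mulfI nR); rewrite c2// divff.
  by field.
set x := sigma2 / (2 * n%:R) in EF.
have x0 : 0 <= x by rewrite divr_ge0// mulr_ge0.
have -> : n%:R * (mean P (fun w => cos (c n * Z 0%N w)) - rho n) =
    mean P (F n) - n%:R * (expR (- x) - 1 + x).
  by rewrite EF /rho -/x; ring.
rewrite sub0r normrN (le_trans (ler_normB _ _))// [e]splitr lerD//.
  have : `|0 - mean P (F n)| <= e / 2 by near: n.
  by rewrite sub0r normrN.
rewrite normrM ger0_norm//.
apply: (@le_trans _ _ (n%:R * x ^+ 2));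
  first by rewrite ler_wpM2l// expRN_taylor1.
have -> : n%:R * x ^+ 2 = sigma2 ^+ 2 / 4 * (c n * c n).
  apply: (mulfI nR); have -> : n%:R * (sigma2 ^+ 2 / 4 * (c n * c n)) =
    sigma2 ^+ 2 / 4 * (n%:R * c n ^+ 2) by ring.
  by rewrite c2// mulr1 /x; field.
have : `|0 - sigma2 ^+ 2 / 4 * (c n * c n)| <= e / 2 by near: n.
by rewrite sub0r normrN; exact/le_trans/ler_norm.
Unshelve. all: by end_near. Qed.

Let clt_cos_S th :
  mean P (fun w => cos ((Num.sqrt n%:R)^-1 * S n w + th)) @[n --> \oo] -->
  expR (- (sigma2 / 2)) * cos th.
Proof.
apply/cvgrPdist_le => e e0.
have e20 : 0 < e / 2 by rewrite divr_gt0.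
move/cvgrPdist_le : cvg_cos_part => /(_ _ e20) h1.
move/cvgrPdist_le : cvg_sin_part => /(_ _ e20) h2.
near=> n.
have n0 : (0 < n)%N by near: n; exact: nbhs_infty_gt.
have nR : n%:R != 0 :> R by rewrite pnatr_eq0 -lt0n.
have -> : expR (- (sigma2 / 2)) = rho n ^+ n.
  rewrite /rho -expRM_natl; congr expR.
  by field.
rewrite distrC; apply: (le_trans (cos_sum_approx _ _ _ _)).
  by rewrite expR_ge0 expR_le1 oppr_le0 divr_ge0// mulr_ge0.
rewrite mulrDr [e]splitr lerD//.
  have : `|0 - n%:R * (mean P (fun w => cos (c n * Z 0%N w)) - rho n)| <= e / 2.
    by near: n.
  by rewrite sub0r normrN normrM ger0_norm.
have : `|0 - n%:R * mean P (fun w => sin (c n * Z 0%N w))| <= e / 2 by near: n.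
by rewrite sub0r normrN normrM ger0_norm.
Unshelve. all: by end_near. Qed.

(* The pair (cos, sin) plays the role of the complex exponential: this is the
   convergence of characteristic functions. *)
Lemma clt_cos th :
  mean P (fun w => cos ((Num.sqrt n%:R)^-1 * (\sum_(i < n) Z i w) + th))
    @[n --> \oo] -->
  expR (- (mean P (fun w => Z 0%N w ^+ 2) / 2)) * cos th.
Proof. exact: clt_cos_S. Qed.

End iid_limit_theorems.

(** * The Gaussian law *)

Section gaussian.
Context {R : realType}.
Notation mu := (@lebesgue_measure R).
Notation N01 := (normal_prob (0 : R) 1).
Let g : R -> R := normal_pdf 0 1.

Let gE x : g x = normal_peak 1 * expR (- (x ^+ 2 / 2)).
Proof.
rewrite /g normal_pdfE ?oner_neq0// /normal_fun subr0 expr1n.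
by rewrite mulNr.
Qed.

Let g_ge0 x : 0 <= g x. Proof. exact: normal_pdf_ge0. Qed.

Let mg : measurable_fun setT g. Proof. exact: measurable_normal_pdf. Qed.

(** Part of the exponential decay absorbs the quadratic factor: x^2 times the N(0, 1) density is at
    most a constant times the N(0, 2) density, which is integrable. *)
Let int_quadratic (h : R -> R) C : measurable_fun setT h ->
  (forall x, `|h x| <= C * (1 + x ^+ 2)) ->
  mu.-integrable setT (EFin \o (fun x => h x * g x)).
Proof.
move=> mh hC.
have C0 : 0 <= C.
  have := hC 0; rewrite expr0n/= addr0 mulr1; exact/le_trans.
pose s := Num.sqrt 2 : R.
have s0 : s != 0 by rewrite gt_eqF// sqrtr_gt0.
pose g2 : R -> R := normal_pdf 0 s.
(* The 4 comes from x^2 <= 4 exp (x^2 / 4); the quotient exchanges the two normalizing constants. *)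
pose K := 4 * (normal_peak 1 / normal_peak s).
have pk0 : 0 < normal_peak s by exact: normal_peak_gt0.
have g2E x : g2 x = normal_peak s * expR (- (x ^+ 2 / 4)).
  rewrite /g2 normal_pdfE// /normal_fun subr0 sqr_sqrtr// mulNr -mulr_natr.
  by congr (_ * expR (- (_ / _))); rewrite -natrM.
have int2 : mu.-integrable setT (EFin \o (fun x => C * (g x + K * g2 x))).
  have i1 : mu.-integrable setT (EFin \o g) by exact: integrable_normal_pdf.
  have i2 : mu.-integrable setT (EFin \o g2) by exact: integrable_normal_pdf.
  exact: (integrableZl measurableT C
    (integrableD measurableT i1 (integrableZl measurableT K i2))).
apply: le_integrable int2 => //.
  by apply/measurable_EFinP/measurable_funM.
move=> x _ /=; rewrite lee_fin normrM (ger0_norm (g_ge0 x)).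
apply: (le_trans _ (ler_norm _)).
apply: (@le_trans _ _ (C * (1 + x ^+ 2) * g x)); first by rewrite ler_wpM2r.
rewrite -mulrA ler_wpM2l// mulrDl mul1r lerD2l.
rewrite g2E gE /K.
have -> : 4 * (normal_peak 1 / normal_peak s) *
    (normal_peak s * expR (- (x ^+ 2 / 4))) =
    normal_peak 1 * (4 * expR (- (x ^+ 2 / 4))).
  by field; rewrite gt_eqF.
rewrite mulrCA ler_wpM2l ?normal_peak_ge0//.
have -> : - (x ^+ 2 / 2) = - (x ^+ 2 / 4) + - (x ^+ 2 / 4) by field.
rewrite expRD mulrA ler_wpM2r ?expR_ge0//.
rewrite expRN ler_pdivrMr ?expR_gt0//.
have := expR_ge1Dx (x ^+ 2 / 4); have := sqr_ge0 x; lra.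
Qed.

Let J (h : R -> R) := Rintegral mu setT (fun x => h x * g x).

(** [J] uses the explicit Lebesgue density. The change of variables yields the Radon-Nikodym
    derivative of [N01], which equals this density almost everywhere because both have the same
    integral over every measurable set. *)
Let mean_normalE (f : R -> R) (M : R) : measurable_fun setT f ->
  (forall x, `|f x| <= M) -> mean N01 f = J f.
Proof.
move=> mf fM.
have iN : N01.-integrable setT (EFin \o f).
  exact: (@intble_bounded _ _ _ N01 f M).
have M0 : 0 <= M by apply: le_trans (fM 0).
have ig : mu.-integrable setT (EFin \o (fun x => f x * g x)).
  apply: (@int_quadratic _ M) => // x; rewrite (le_trans (fM x))//.
  by rewrite ler_peMr// lerDl sqr_ge0.
rewrite /Rintegral; congr fine.
have dom := normal_prob_dominates (0:R) 1.
rewrite -(Radon_Nikodym_change_of_variables dom)//=.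
apply: ae_eq_integral => //.
- apply: emeasurable_funM; first exact/measurable_EFinP.
  apply: (measurable_int mu).
  by apply: Radon_Nikodym_integrable.
- exact: measurable_int ig.
- under [X in ae_eq _ _ _ X]eq_fun do rewrite EFinM.
  apply: ae_eqe_mul2l => /=.
  rewrite Radon_NikodymE//=.
  case: cid => /= h [h1 h2 h3].
  apply: integral_ae_eq => //=.
  + exact/measurable_EFinP.
  + by move=> E E01 mE; rewrite -h3.
Qed.

Let measurable_trig (f : R -> R) (t th : R) : continuous f ->
  measurable_fun setT (fun x => f (t * x + th)).
Proof.
move=> cf; apply: (measurableT_comp (continuous_measurable_fun cf)).
by apply: measurable_funD => //; exact: measurable_funM.
Qed.

Let abs_le x : `|x| <= 1 + x ^+ 2 :> R.
Proof.
rewrite -(real_normK (num_real x)); have := sqr_ge0 (`|x| - 1); nra.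
Qed.

(** For differentiation under the integral sign: an increment known up to O(h^2) determines the
    derivative, so a single bound on integrals suffices. *)
Let is_derive_quadratic (f : R -> R) t l K :
  (forall h, `|f (t + h) - f t - h * l| <= K * h ^+ 2) -> is_derive t 1 f l.
Proof.
move=> fK.
have K0 : 0 <= K by have := fK 1; rewrite expr1n mulr1; exact/le_trans.
have cv : h^-1 *: ((f \o shift t) (h *: (1:R)) - f t) @[h --> 0^'] --> l.
  apply/cvgrPdist_le => e e0; near=> h.
  have h0 : h != 0 by near: h; exact: nbhs_dnbhs_neq.
  have -> : l - h^-1 *: ((f \o shift t) (h *: (1:R)) - f t) =
      - (h^-1 * (f (t + h) - f t - h * l)).
    rewrite /= /GRing.scale/= mulr1 [h + t]addrC; field.
    exact: h0.
  rewrite normrN normrM normfV ler_pdivrMl ?normr_gt0//.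
  rewrite (le_trans (fK h))// -(real_normK (num_real h)) expr2 mulrA mulrC.
  rewrite ler_wpM2l//.
  have : `|h| <= e / (K + 1).
    near: h; apply: dnbhs0_le; rewrite divr_gt0// ltr_wpDl//.
  rewrite ler_pdivlMr ?ltr_wpDl// mulrDr mulr1 => he.
  by rewrite mulrC (le_trans _ he)// lerDl.
apply: DeriveDef; first by apply/cvg_ex; exists l.
exact: cvg_lim.
Unshelve. all: by end_near. Qed.

Let int_trig (f : R -> R) (t th : R) : continuous f ->
  (forall x, `|f x| <= 1) ->
  mu.-integrable setT (EFin \o (fun x => f (t * x + th) * g x)) /\
  mu.-integrable setT (EFin \o (fun x => (x * f (t * x + th)) * g x)).
Proof.
move=> cf f1; split; apply: (@int_quadratic _ 1).
- exact: measurable_trig.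
- by move=> x; rewrite mul1r (le_trans (f1 _))// lerDl sqr_ge0.
- by apply: measurable_funM => //; exact: measurable_trig.
move=> x; rewrite mul1r normrM (le_trans _ (abs_le x))//.
by rewrite -[leRHS]mulr1 ler_wpM2l.
Qed.

(* Stein's identity for sin, i.e. integration by parts. *)
Let stein (t th : R) :
  J (fun x => x * sin (t * x + th)) = t * J (fun x => cos (t * x + th)).
Proof.
pose F x := sin (t * x + th) * expR (- (x ^+ 2 / 2)).
pose f x := (t * cos (t * x + th) - x * sin (t * x + th)) * expR (- (x ^+ 2 /
  2)).
have dF (x : R) : is_derive x 1 F (f x).
  apply: is_derive_eq.
  by rewrite /f /GRing.scale/=; field.
have cf : continuous f.
  by move=> x; apply/differentiable_continuous/derivable1_diffP;
    exact: ex_derive.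
have cF : continuous F.
  by move=> x; apply/differentiable_continuous/derivable1_diffP;
    exact: ex_derive.
have [i1 _] := @int_trig _ t th (@continuous_cos R) (@cos_max R).
have [_ i2] := @int_trig _ t th (@continuous_sin R) (@sin_max R).
have pk0 : normal_peak 1 != 0 :> R
  by rewrite gt_eqF// normal_peak_gt0// oner_neq0.
have fE : (fun x => normal_peak 1 * f x) =
  fun x => t * (cos (t * x + th) * g x) - x * sin (t * x + th) * g x.
  by apply/funext => x; rewrite /f gE; ring.
have intpf : intble mu (fun x => normal_peak 1 * f x).
  by rewrite fE; apply: intbleB => //; exact: intbleZ.
have intf : intble mu f.
  have -> : f = fun x => (normal_peak 1)^-1 * (normal_peak 1 * f x).
    by apply/funext => x; rewrite mulKf.
  exact: intbleZ.
(* [f] is the derivative of [F], and expanding its mean gives the identity. That mean is zero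
   because the integrals of [f] over growing intervals are differences of boundary values of [F],
   which vanish at infinity. *)
suff f0 : mean mu f = 0.
  have : mean mu (fun x => normal_peak 1 * f x) = 0 by rewrite meanZ// f0 mulr0.
  rewrite fE meanB//; last exact: intbleZ.
  by rewrite meanZ// -/(J _) -/(J _) => /eqP; rewrite subr_eq0 eq_sym => /eqP.
pose I n : set R := `[- n.+1%:R, n.+1%:R]%classic.
have FTC n : mean mu (fun x => f x * \1_(I n) x) = F n.+1%:R - F (- n.+1%:R).
  rewrite /Rintegral.
  have -> : (\int[mu]_x (f x * \1_(I n) x)%:E = \int[mu]_(x in I n) (f x)%:E)%E.
    rewrite [RHS]integral_mkcond; apply: eq_integral => x _.
    by rewrite patchE indicE; case: ifP => _; rewrite ?mulr1 ?mulr0.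
  rewrite (@continuous_FTC2 _ f F)//.
  - by rewrite gtrN.
  - exact: continuous_subspaceT.
  - split.
    + by move=> x _; apply: ex_derive.
    + exact/cvg_at_right_filter/cF.
    + exact/cvg_at_left_filter/cF.
  - by move=> x _; rewrite derive1E; apply: derive_val.
have cv1 : mean mu (fun x => f x * \1_(I n) x) @[n --> \oo] --> mean mu f.
  refine (@mean_dominated_cvg _ _ R mu (fun n x => f x * \1_(I n) x) f
    (fun x => `|f x|) _ _ _ _ _).
  - move=> n; apply: measurable_funM; first exact: intble_measurable intf.
    by apply: measurable_indic; exact: measurable_itv.
  - exact: intble_measurable intf.
  - move=> x; apply/cvgrPdist_le => e e0; near=> n.
    rewrite indicE mem_set ?mulr1 ?subrr ?normr0 ?ltW//.
    rewrite /I /= in_itv/= -ler_norml.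
    have : `|x| <= n%:R by near: n; exact: nbhs_infty_ger.
    by move=> /le_trans; apply; rewrite ler_nat.
  - exact: intble_norm.
  - move=> n x; rewrite normrM indicE.
    by case: (_ \in _); rewrite ?normr1 ?mulr1// normr0 mulr0.
have cv2 : F n.+1%:R - F (- n.+1%:R) @[n --> \oo] --> (0:R).
  apply/cvgrPdist_le => e e0; near=> n.
  rewrite sub0r normrN.
  have Fb x : `|F x| * (1 + x ^+ 2 / 2) <= 1.
    rewrite /F normrM.
    apply: (@le_trans _ _ (expR (- (x ^+ 2 / 2)) * (1 + x ^+ 2 / 2))).
      rewrite ler_wpM2r//; first by rewrite addr_ge0// divr_ge0// sqr_ge0.
      by rewrite (ger0_norm (expR_ge0 _)) -[leRHS]mul1r ler_wpM2r ?expR_ge0//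
        sin_max.
    by rewrite expRN ler_pdivrMl ?expR_gt0// mulr1 expR_ge1Dx.
  have Fn x : x ^+ 2 = n.+1%:R ^+ 2 -> `|F x| <= 2 / n.+1%:R.
    move=> xn; rewrite ler_pdivlMr ?ltr0n//.
    have := Fb x; rewrite xn => h.
    have n1 : (1:R) <= n.+1%:R by rewrite ler1n.
    have := normr_ge0 (F x); nra.
  apply: (@le_trans _ _ (2 / n.+1%:R + 2 / n.+1%:R)).
    by rewrite (le_trans (ler_normB _ _))// lerD// Fn// sqrrN.
  rewrite -mulrDl ler_pdivrMr ?ltr0n// mulrC -ler_pdivrMr//.
  have : (2 + 2) / e <= n%:R by near: n; exact: nbhs_infty_ger.
  by move=> /le_trans; apply; rewrite ler_nat.
by have := cvg_unique _ cv1; under eq_fun do rewrite FTC; apply.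
Unshelve. all: by end_near. Qed.

(** Expanding cos ((t x + th) + h x) leaves cos (h x) - 1 and sin (h x) - h x, bounded by (h x)^2
    and 2 (h x)^2: hence the factor 3. *)
Let diff_bound (t th h : R) :
  `|J (fun x => cos ((t + h) * x + th)) - J (fun x => cos (t * x + th)) -
    h * - J (fun x => x * sin (t * x + th))| <=
  3 * J (fun x => x ^+ 2) * h ^+ 2.
Proof.
have [c1 _] := @int_trig _ (t + h) th (@continuous_cos R) (@cos_max R).
have [c2 _] := @int_trig _ t th (@continuous_cos R) (@cos_max R).
have [_ s2] := @int_trig _ t th (@continuous_sin R) (@sin_max R).
have q : intble mu (fun x => x ^+ 2 * g x).
  apply: (@int_quadratic _ 1) => // x.
  by rewrite ger0_norm ?sqr_ge0// mul1r lerDr.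
have -> : 3 * J (fun x => x ^+ 2) * h ^+ 2 =
    mean mu (fun x => (3 * h ^+ 2) * (x ^+ 2 * g x)).
  by rewrite meanZ// /J; ring.
have -> : J (fun x => cos ((t + h) * x + th)) - J (fun x => cos (t * x + th)) -
    h * - J (fun x => x * sin (t * x + th)) =
  mean mu (fun x => (cos ((t + h) * x + th) * g x - cos (t * x + th) * g x) +
     h * (x * sin (t * x + th) * g x)).
  by rewrite meanD ?meanB ?meanZ ?mulrN ?opprK//;
    [exact: intbleB|exact: intbleZ].
apply: le_norm_mean.
- by apply: intbleD; [exact: intbleB|exact: intbleZ].
- exact: intbleZ.
move=> x.
have -> : cos ((t + h) * x + th) * g x - cos (t * x + th) * g x +
     h * (x * sin (t * x + th) * g x) =
  (cos (t * x + th) * (cos (h * x) - 1) - sin (t * x + th) * (sin (h * x) - h *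
    x)) * g x.
  have -> : (t + h) * x + th = (t * x + th) + h * x by ring.
  by rewrite cosD; ring.
rewrite normrM (ger0_norm (g_ge0 x)) mulrA ler_wpM2r//.
have -> : 3 * h ^+ 2 * x ^+ 2 = (h * x) ^+ 2 + 2 * (h * x) ^+ 2 by ring.
rewrite (le_trans (ler_normB _ _))// !normrM lerD//.
  rewrite (le_trans _ (norm_cosB1_le _))//.
  by rewrite -[leRHS]mul1r ler_wpM2r// cos_max.
rewrite (le_trans _ (norm_sinB_quadratic _))//.
by rewrite -[leRHS]mul1r ler_wpM2r// sin_max.
Qed.

(** By Stein's identity the mean A, as a function of its frequency s, satisfies A' = - s A; so A(s)
    exp (s^2 / 2) is constant, and it is cos th at s = 0. *)
Lemma mean_normal_cos (t th : R) :
  mean N01 (fun x => cos (t * x + th)) = expR (- (t ^+ 2 / 2)) * cos th.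
Proof.
rewrite (@mean_normalE _ 1); last 2 first.
- by apply: measurable_trig; exact: continuous_cos.
- by move=> x; exact: cos_max.
pose A s := J (fun x => cos (s * x + th)).
have dA (s : R) : is_derive s 1 A (- (s * A s)).
  rewrite /A -stein; apply: is_derive_quadratic => h; exact: diff_bound.
pose G s := A s * expR (s ^+ 2 / 2).
have dG (s : R) : is_derive s 1 G 0.
  apply: is_derive_eq.
  by rewrite /GRing.scale/=; field.
have := @is_derive_0_is_cst R G t 0 dG.
rewrite /G /A expr0n mul0r expR0 mulr1.
have -> : J (fun x => cos (0 * x + th)) = cos th.
  rewrite -(@mean_normalE (fun x => cos (0 * x + th)) 1); last 2 first.
  - by apply: measurable_trig; exact: continuous_cos.
  - by move=> x; exact: cos_max.
  under eq_Rintegral do rewrite mul0r add0r.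
  exact: (mean_cst N01).
by move=> <-; rewrite expRN mulrC mulfK// gt_eqF// expR_gt0.
Qed.
End gaussian.

(** * The Euclidean inner product and the standard normal vector *)

Section dotv.
Context {R : realType}.

Lemma measurable_dotv p (t : 'cV[R]_p) : measurable_fun setT (dotv t).
Proof.
by apply: measurable_sum => j; apply: measurable_funM => //;
  exact: measurable_entry.
Qed.

Lemma dotvDl p (s t x : 'cV[R]_p) : dotv (s + t) x = dotv s x + dotv t x.
Proof.
by rewrite /dotv -big_split/=; apply: eq_bigr => j _; rewrite mxE mulrDl.
Qed.

Lemma dotvNl p (t x : 'cV[R]_p) : dotv (- t) x = - dotv t x.
Proof.
by rewrite /dotv -sumrN; apply: eq_bigr => j _; rewrite mxE mulNr.
Qed.

Lemma dotvZl p c (t x : 'cV[R]_p) : dotv (c *: t) x = c * dotv t x.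
Proof.
by rewrite /dotv mulr_sumr; apply: eq_bigr => j _; rewrite mxE mulrA.
Qed.

Lemma dotvC p (t x : 'cV[R]_p) : dotv t x = dotv x t.
Proof. by apply: eq_bigr => j _; rewrite mulrC. Qed.

Lemma dotv_ge0 p (x : 'cV[R]_p) : 0 <= dotv x x.
Proof. by apply: sumr_ge0 => j _; rewrite -expr2 sqr_ge0. Qed.

Lemma dotv_eq0 p (u : 'cV[R]_p) : dotv u u = 0 -> u = 0.
Proof.
move=> /eqP; rewrite psumr_eq0 => [/allP u0|j _];
  last by rewrite -expr2 sqr_ge0.
apply/colP => j; rewrite mxE; apply/eqP.
by have := u0 j (mem_index_enum _); rewrite mulf_eq0 orbb.
Qed.

Lemma dotvDr p (u v h : 'cV[R]_p) : dotv u (v + h) = dotv u v + dotv u h.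
Proof. by rewrite dotvC dotvDl !(dotvC u). Qed.

Lemma dotvZr p a (u v : 'cV[R]_p) : dotv u (a *: v) = a * dotv u v.
Proof. by rewrite dotvC dotvZl (dotvC u). Qed.

Lemma dotvNr p (u v : 'cV[R]_p) : dotv u (- v) = - dotv u v.
Proof. by rewrite dotvC dotvNl (dotvC u). Qed.

Lemma dotv_cauchy_schwarz p (u v : 'cV[R]_p) : dotv u v ^+ 2 <= dotv u u * dotv
  v v.
Proof.
have [v0|/eqP v0] := pselect (dotv v v = 0).
  rewrite v0 mulr0 (dotv_eq0 v0) /dotv big1 ?expr0n// => j _.
  by rewrite mxE mulr0.
have vv : 0 < dotv v v by rewrite lt_def v0 dotv_ge0.
have := dotv_ge0 (dotv v v *: u - dotv u v *: v).
rewrite !(dotvDl, dotvDr, dotvNl, dotvNr, dotvZl, dotvZr) (dotvC v u).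
set a := dotv u u; set b := dotv u v; set c := dotv v v in vv *.
rewrite [X in 0 <= X](_ : _ = c * (a * c - b ^+ 2)); last by ring.
by rewrite pmulr_rge0// subr_ge0.
Qed.

Lemma coord_le_dotv p (u : 'cV[R]_p) j : u j 0 ^+ 2 <= dotv u u.
Proof.
rewrite /dotv (bigD1 j)//= -expr2 lerDl sumr_ge0// => i _.
by rewrite -expr2 sqr_ge0.
Qed.

Lemma measurable_cos_dotv p (t : 'cV[R]_p) (th : R) :
  measurable_fun setT (fun x => cos (dotv t x + th)).
Proof.
apply: (measurableT_comp (continuous_measurable_fun (@continuous_cos R))).
by apply: measurable_funD => //; exact: measurable_dotv.
Qed.

Lemma dotv_cons n (t : 'cV[R]_n.+1) (z : measurableTypeR R * 'cV[R]_n) :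
  dotv t (cons_cV z) =
  t ord0 0 * z.1 + dotv (dsubmx (t : 'cV[R]_(1 + n))) z.2.
Proof.
rewrite /dotv big_ord_recl; congr (_ * _ + _).
  have -> : ord0 = lshift n (ord0 : 'I_1) by exact: val_inj.
  exact: etrans (@col_mxEu R 1 n 1 (const_mx z.1) z.2 ord0 0) (mxE _ _ _ _).
apply: eq_bigr => j _.
have -> : lift ord0 j = rshift 1 j by exact: val_inj.
congr (_ * _); first by rewrite mxE.
exact: (@col_mxEd R 1 n 1 (const_mx z.1) z.2 j 0).
Qed.

(** Induction along the recursive definition of [std_normal]: the last n coordinates are integrated
    first, with t_0 x moved into the phase. This is why the statement has an arbitrary [th]. *)
Lemma mean_std_normal_cos p (t : 'cV[R]_p) (th : R) :
  mean (std_normal R p) (fun x => cos (dotv t x + th)) =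
  expR (- (dotv t t / 2)) * cos th.
Proof.
elim: p t th => [|n IH] t th.
  rewrite /Rintegral integral_dirac//=; last first.
    by apply/measurable_EFinP; exact: measurable_cos_dotv.
  by rewrite indicT mul1r /dotv !big_ord0 mul0r oppr0 expR0 mul1r add0r.
pose m1 : probability _ R := normal_prob (0:R) 1.
pose m2 := std_normal R n.
pose f x := cos (dotv t x + th).
have mf : measurable_fun setT f by exact: measurable_cos_dotv.
have if_ : intble (m1 \x m2)%E (f \o @cons_cV R n).
  apply: (@intble_bounded _ _ _ _ _ 1) => [|x]; last exact: cos_max.
  exact: measurableT_comp.
rewrite {1}/Rintegral /= integral_distribution//; last exact/measurable_EFinP.
rewrite -integral12_prod_meas1// /fubini_F.
pose t' := dsubmx (t : 'cV[R]_(1 + n)).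
have E x : (\int[m2]_v ((EFin \o f) \o @cons_cV R n) (x, v) =
    (expR (- (dotv t' t' / 2)) * cos (t ord0 0 * x + th))%:E)%E.
  rewrite -IH -mean_intE; last first.
    apply: (@intble_bounded _ _ _ _ _ 1) => [|y]; last exact: cos_max.
    exact: measurable_cos_dotv.
  apply: eq_integral => v _ /=; congr (cos _)%:E.
  by rewrite dotv_cons /= -/t'; ring.
under eq_integral do rewrite E.
rewrite -/(Rintegral _ _ _) (@meanZ _ _ _ m1); last first.
  apply: (@intble_bounded _ _ _ m1 _ 1) => [|y]; last exact: cos_max.
  apply: (measurableT_comp (continuous_measurable_fun (@continuous_cos R))).
  by apply: measurable_funD => //; exact: measurable_funM.
rewrite mean_normal_cos mulrA -expRD; congr (expR _ * _).
have -> : dotv t t = t ord0 0 ^+ 2 + dotv t' t'.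
  rewrite /dotv big_ord_recl; congr (_ + _).
  apply: eq_bigr => j _; rewrite !mxE.
  by rewrite (_ : lift ord0 j = rshift 1 j)//; exact: val_inj.
by field.
Qed.

End dotv.

(** * Trigonometric polynomials *)

Section bernstein.
Context {R : realType}.
Implicit Types (y : R) (m k : nat).

(* The binomial weights [binomial m k * y^k * (1-y)^(m-k)], by Pascal's rule. *)
Fixpoint bernstein m k y : R :=
  if m is m'.+1 then
    (1 - y) * bernstein m' k y + y * (if k is k'.+1 then bernstein m' k' y else
      0)
  else (k == 0%N)%:R.

Lemma bernstein_ge0 m k y : 0 <= y <= 1 -> 0 <= bernstein m k y.
Proof.
move=> /andP[y0 y1]; elim: m k => [|m IH] k /=; first by rewrite ler0n.
rewrite addr_ge0// mulr_ge0 ?subr_ge0//.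
by case: k.
Qed.

Let bernstein_gt m k y : (m < k)%N -> bernstein m k y = 0.
Proof.
elim: m k => [|m IH] [|k]//= mk; rewrite IH ?mulr0 ?add0r; last exact: ltnW.
by rewrite IH// mulr0.
Qed.

(** For K_m binomial, conditioning on one trial gives E f(K_(m+1)) = (1 - y) E f(K_m) + y E f(K_m +
    1). The functions 1, k and k^2 then yield the moments by induction. *)
Let bernstein_rec m y (f : nat -> R) :
  \sum_(k < m.+2) f k * bernstein m.+1 k y =
  (1 - y) * (\sum_(k < m.+1) f k * bernstein m k y) +
  y * (\sum_(k < m.+1) f k.+1 * bernstein m k y).
Proof.
under eq_bigr do rewrite /= mulrDr.
rewrite big_split/=; congr (_ + _).
  rewrite big_ord_recr/= bernstein_gt// !mulr0 addr0 mulr_sumr.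
  by apply: eq_bigr => k _; rewrite mulrCA.
rewrite big_ord_recl/= !mulr0 add0r mulr_sumr.
by apply: eq_bigr => k _; rewrite mulrCA.
Qed.

Lemma sum_bernstein m y : \sum_(k < m.+1) bernstein m k y = 1.
Proof.
have h n : \sum_(k < n.+1) 1 * bernstein n k y = 1.
  elim: n => [|n IH]; first by rewrite big_ord1/= mulr1.
  by rewrite (bernstein_rec n y (fun=> 1)) IH; ring.
by rewrite -[RHS](h m); apply: eq_bigr => k _; rewrite mul1r.
Qed.

Let mean_bernstein m y : \sum_(k < m.+1) k%:R * bernstein m k y = m%:R * y.
Proof.
elim: m => [|m IH]; first by rewrite big_ord1/= !mul0r.
rewrite (bernstein_rec m y (fun k => k%:R)) IH.
have -> : \sum_(k < m.+1) k.+1%:R * bernstein m k y = m%:R * y + 1.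
  rewrite -IH -[X in _ = _ + X](sum_bernstein m y) -big_split/=;
    apply: eq_bigr => k _.
  by rewrite -natr1; ring.
by rewrite -natr1; ring.
Qed.

Let square_bernstein m y : \sum_(k < m.+1) k%:R ^+ 2 * bernstein m k y =
  m%:R * y + (m%:R ^+ 2 - m%:R) * y ^+ 2.
Proof.
elim: m => [|m IH]; first by rewrite big_ord1/= expr0n/= !mul0r; ring.
rewrite (bernstein_rec m y (fun k => k%:R ^+ 2)) IH.
have -> : \sum_(k < m.+1) k.+1%:R ^+ 2 * bernstein m k y =
    m%:R * y + (m%:R ^+ 2 - m%:R) * y ^+ 2 + 2 * (m%:R * y) + 1.
  rewrite -IH -(mean_bernstein m y) -[X in _ = _ + X](sum_bernstein m y).
  rewrite mulr_sumr -!big_split/=.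
  by apply: eq_bigr => k _; rewrite -natr1; ring.
by rewrite -natr1; ring.
Qed.

Lemma variance_bernstein m y : (0 < m)%N ->
  \sum_(k < m.+1) (k%:R / m%:R - y) ^+ 2 * bernstein m k y = y * (1 - y) / m%:R.
Proof.
move=> m0; have mR : m%:R != 0 :> R by rewrite pnatr_eq0 -lt0n.
transitivity (m%:R ^- 2 * (\sum_(k < m.+1) k%:R ^+ 2 * bernstein m k y) -
    2 * y / m%:R * (\sum_(k < m.+1) k%:R * bernstein m k y) +
    y ^+ 2 * (\sum_(k < m.+1) bernstein m k y)).
  rewrite !mulr_sumr -sumrB -big_split/=; apply: eq_bigr => k _.
  by field.
rewrite square_bernstein mean_bernstein sum_bernstein; field; exact: mR.
Qed.

End bernstein.

Section trigonometric_polynomials.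
Context {R : realType} {p : nat}.
Implicit Types (f g : 'cV[R]_p -> R) (x t : 'cV[R]_p).

Definition trig_poly f : Prop := exists s : seq (R * 'cV[R]_p * R),
  forall x, f x = \sum_(c <- s) c.1.1 * cos (dotv c.1.2 x + c.2).

Lemma trig_poly_ext f g : f =1 g -> trig_poly f -> trig_poly g.
Proof. by move=> fg [s fs]; exists s => x; rewrite -fg. Qed.

Lemma trig_polyZcos a t th : trig_poly (fun x => a * cos (dotv t x + th)).
Proof. by exists [:: (a, t, th)] => x; rewrite big_seq1. Qed.

Lemma trig_polyD f g : trig_poly f -> trig_poly g ->
  trig_poly (fun x => f x + g x).
Proof.
by move=> [s fs] [s' gs]; exists (s ++ s') => x; rewrite big_cat fs gs.
Qed.

Lemma trig_poly_cst a : trig_poly (fun=> a).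
Proof.
exists [:: (a, 0, 0)] => x; rewrite big_seq1/= addr0.
by rewrite /dotv big1 ?cos0 ?mulr1// => j _; rewrite mxE mul0r.
Qed.

Lemma trig_poly_sum I (s : seq I) (F : I -> 'cV[R]_p -> R) :
  (forall i, trig_poly (F i)) -> trig_poly (fun x => \sum_(i <- s) F i x).
Proof.
move=> tF; elim: s => [|i s IH].
  by apply: trig_poly_ext (trig_poly_cst 0) => x; rewrite big_nil.
by apply: trig_poly_ext (trig_polyD (tF i) IH) => x; rewrite big_cons.
Qed.

Lemma trig_polyM f g : trig_poly f -> trig_poly g ->
  trig_poly (fun x => f x * g x).
Proof.
move=> [s fs] [s' gs].
apply: (@trig_poly_ext (fun x => \sum_(c <- s) \sum_(c' <- s')
    (c.1.1 * c'.1.1 / 2 * cos (dotv (c.1.2 + c'.1.2) x + (c.2 + c'.2)) +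
     c.1.1 * c'.1.1 / 2 * cos (dotv (c.1.2 - c'.1.2) x + (c.2 - c'.2))))).
  move=> x; rewrite fs gs mulr_suml; apply: eq_bigr => c _.
  rewrite mulr_sumr; apply: eq_bigr => c' _.
  rewrite !dotvDl dotvNl.
  set A := dotv c.1.2 x; set B := dotv c'.1.2 x.
  have -> : A + B + (c.2 + c'.2) = (A + c.2) + (B + c'.2) by ring.
  have -> : A - B + (c.2 - c'.2) = (A + c.2) - (B + c'.2) by ring.
  by rewrite cosD cosB; field.
apply: trig_poly_sum => c; apply: trig_poly_sum => c'.
by apply: trig_polyD; exact: trig_polyZcos.
Qed.

Lemma trig_poly_prod I (s : seq I) (F : I -> 'cV[R]_p -> R) :
  (forall i, trig_poly (F i)) -> trig_poly (fun x => \prod_(i <- s) F i x).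
Proof.
move=> tF; elim: s => [|i s IH].
  by apply: trig_poly_ext (trig_poly_cst 1) => x; rewrite big_nil.
by apply: trig_poly_ext (trig_polyM (tF i) IH) => x; rewrite big_cons.
Qed.

Lemma trig_poly_bernstein f m k : trig_poly f ->
  trig_poly (fun x => bernstein m k (f x)).
Proof.
move=> tf; elim: m k => [|m IH] k /=; first exact: trig_poly_cst.
apply: trig_polyD.
  apply: trig_polyM => //; apply: trig_polyD; first exact: trig_poly_cst.
  apply: trig_poly_ext (trig_polyM (trig_poly_cst (-1)) tf) => x.
  by rewrite mulN1r.
by apply: trig_polyM => //; case: k => [|k]; [exact: trig_poly_cst|].
Qed.

Lemma trig_poly_sin_coord (M : R) (j : 'I_p) :
  trig_poly (fun x => (1 + sin (x j 0 / M)) / 2).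
Proof.
have h : trig_poly (fun x => 2^-1 * cos (dotv (M^-1 *: delta_mx j 0) x + - (pi
  / 2))).
  exact: trig_polyZcos.
apply: trig_poly_ext (trig_polyD (trig_poly_cst 2^-1) h) => x.
rewrite dotvZl cosBpihalf.
have -> : dotv (delta_mx j 0) x = x j 0.
  rewrite /dotv (bigD1 j)//= big1 ?addr0 ?mxE ?eqxx ?mul1r// => i ij.
  by rewrite mxE (negbTE ij) mul0r.
by rewrite [M^-1 * _]mulrC; field.
Qed.

End trigonometric_polynomials.

(** * Approximation of continuous functions on cubes *)

Section uniform_continuity.
Context {R : realType} {p : nat}.

(** Heine-Cantor in the entrywise metric, by the near-covering form of compactness: a scale that
    works near each point of the cube can be chosen for the whole cube. *)
Lemma cube_uniform_continuous (g : 'cV[R]_p -> R) (M e : R) :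
  continuous g -> 0 < e -> exists2 dl : R, 0 < dl &
  forall x z : 'cV[R]_p, (forall j, `|x j 0| <= M) ->
    (forall j, `|z j 0 - x j 0| <= dl) -> `|g z - g x| <= e.
Proof.
move=> cg e0.
pose K := [set v : 'rV[R]_p | forall i, `[- M, M]%classic (v ord0 i)].
have cK : compact K.
  exact: (@rV_compact R p (fun=> `[- M, M]%classic)
    (fun=> @segment_compact R _ _)).
pose Q (dl : R) (v : 'rV[R]_p) := forall z : 'cV[R]_p,
  (forall j, `|z j 0 - v 0 j| <= dl) -> `|g z - g v^T| <= e.
have e20 : 0 < e / 2 by rewrite divr_gt0.
have KQ : \forall dl \near 0^'+, K `<=` Q dl.
  move/compact_near_coveringP : cK; apply => v _.
  have [r /= r0 hr] : exists2 r : R, 0 < r &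
      forall z : 'cV[R]_p, (forall j, `|z j 0 - v 0 j| < r) ->
        `|g z - g v^T| < e / 2.
    have /cvgrPdist_lt/(_ _ e20) := cg v^T.
    rewrite -nbhs_ballE => -[r /= r0 hr]; exists r => // z hz.
    rewrite distrC; apply: hr; split => // i j.
    by rewrite (ord1 j) mxE /ball/= distrC; exact: hz.
  have r20 : 0 < r / 2 by rewrite divr_gt0.
  exists (ball v (r / 2), [set dl | dl < r / 2]); first split => /=.
  - exact: nbhsx_ballx.
  - exact: nbhs_right_lt.
  move=> [v' dl] /= [[_ vv'] dlr] z zv'.
  rewrite -(subrKA (g v^T)) (le_trans (ler_normD _ _))// [e]splitr.
  have vv'j j : `|v 0 j - v' 0 j| < r / 2 by exact: vv'.
  rewrite lerD// ltW//.
    apply: hr => j; rewrite -(subrKA (v' 0 j)) (le_lt_trans (ler_normD _ _))//.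
    by rewrite [r]splitr ltrD// ?[`|v' 0 j - _|]distrC// (le_lt_trans (zv' j)).
  rewrite distrC; apply: hr => j; rewrite mxE distrC.
  by rewrite (lt_trans (vv'j j))// ltr_pdivrMr// ltr_pMr// ltr1n.
have [dl [h dl0]] :=
  @filter_ex _ _ (at_right_proper_filter (0 : R)) _ (filterI KQ (nbhs_right_gt
    0)).
exists dl => // x z xM zx.
have Kx : K x^T by move=> i /=; rewrite mxE in_itv/= -ler_norml.
have := h _ Kx z; rewrite trmxK; apply => j.
by rewrite mxE.
Qed.

End uniform_continuity.

Section trigonometric_approximation.
Context {R : realType}.
Implicit Types a b c : R.

Let cos1_le c : `|c| <= 1 -> cos 1 <= cos c.
Proof.
have pi1 : 1 <= pi :> R by rewrite (le_trans _ (@pi_ge2 R))// ler1n.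
move=> c1; have cpi := le_trans c1 pi1.
rewrite -(cos_norm c) leNgt ltr_cos ?in_itv/= ?ler01 ?normr_ge0 ?pi1 ?cpi//.
by rewrite -leNgt.
Qed.

Let sin_expand a b : `|a| <= 1 -> `|b| <= 1 -> a <= b ->
  cos 1 * (b - a) <= sin b - sin a.
Proof.
move=> a1 b1 ab.
have [|c] := @MVT_segment R sin cos a b ab (fun x _ => is_derive_sin x).
  exact/continuous_subspaceT/continuous_sin.
rewrite in_itv/= => /andP[ac cb] ->.
rewrite ler_wpM2r ?subr_ge0// cos1_le// ler_norml.
move: a1 b1; rewrite !ler_norml => /andP[a1 _] /andP[_ b1].
by rewrite (le_trans a1 ac) (le_trans cb b1).
Qed.

(** A stand-in for arcsine defined for every real [c]: a grid value 2 k / m - 1 may leave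
    [- sin 1, sin 1], and then an endpoint of [-1, 1] is taken. On [-1, 1] sin shrinks distances at
    most by the factor cos 1, so [a] is close to each b whose sine is close to [c]. *)
Let sin_near_inverse c : exists2 a, `|a| <= 1 &
  forall b, `|b| <= 1 -> cos 1 * `|a - b| <= `|c - sin b|.
Proof.
have n1 : `|1 : R| <= 1 by rewrite normr1.
have nN1 : `|- 1 : R| <= 1 by rewrite normrN1.
have bnd b : `|b| <= 1 -> - sin 1 <= sin b <= sin 1 /\ -1 <= b <= 1.
  move=> b1; have /andP[b2 b3] : -1 <= b <= 1 by rewrite -ler_norml.
  have h1 := sin_expand b1 n1 b3; have h2 := sin_expand nN1 b1 b2.
  rewrite sinN in h2; have := @cos1_gt0 R.
  have p1 : 0 <= cos 1 * (1 - b) by rewrite mulr_ge0 ?subr_ge0// ltW// cos1_gt0.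
  have p2 : 0 <= cos 1 * (b - -1)
    by rewrite mulr_ge0 ?subr_ge0// ltW// cos1_gt0.
  by move=> _; rewrite b2 b3; split=> //; apply/andP; split; lra.
have key a b : `|a| <= 1 -> `|b| <= 1 -> cos 1 * `|a - b| <= `|sin a - sin b|.
  move=> a1 b1; have [ab|/ltW ba] := leP a b.
    rewrite distrC [leRHS]distrC ger0_norm ?subr_ge0//.
    exact: (le_trans (sin_expand a1 b1 ab) (ler_norm _)).
  rewrite ger0_norm ?subr_ge0//.
  exact: (le_trans (sin_expand b1 a1 ba) (ler_norm _)).
have [c1|c1] := leP (sin 1) c.
  exists 1 => // b b1; apply: (le_trans (key _ _ n1 b1)).
  have [/andP[_ s1] _] := bnd _ b1.
  by rewrite !ger0_norm ?subr_ge0 ?(le_trans s1)// lerD2r.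
have [c2|c2] := leP c (- sin 1).
  exists (-1) => // b b1; apply: (le_trans (key _ _ nN1 b1)).
  have [/andP[s1 _] _] := bnd _ b1.
  by rewrite sinN !ler0_norm ?subr_le0 ?(le_trans c2)// lerN2 lerD2r.
have [|||a] := @IVT R sin (-1) 1 c.
- by rewrite (@le_trans _ _ 0) ?lerN10.
- exact/continuous_subspaceT/continuous_sin.
- rewrite sinN /Order.min /Order.max.
  have : - sin 1 < sin 1 :> R by exact: lt_trans c1.
  by move=> ->; rewrite !ltW.
rewrite in_itv/= -ler_norml => a1 <-; exists a => // b b1; exact: key.
Qed.

Variable p : nat.
Implicit Types x : 'cV[R]_p.

(** Marginalization of a product law: after expanding the product of sums, every factor other than
    the j-th is a total mass 1. *)
Let sum_prod_coord m (w : 'I_p -> 'I_m.+1 -> R) (j : 'I_p) (h : 'I_m.+1 -> R) :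
  (forall i, \sum_l w i l = 1) ->
  \sum_(k : {ffun 'I_p -> 'I_m.+1}) h (k j) * \prod_i w i (k i) =
  \sum_l h l * w j l.
Proof.
move=> w1.
pose F i l := (if i == j then h l else 1) * w i l.
transitivity (\sum_(k : {ffun 'I_p -> 'I_m.+1}) \prod_i F i (k i)).
  apply: eq_bigr => k _; rewrite /F big_split/=; congr (_ * _).
  by rewrite -big_mkcond/= big_pred1_eq.
rewrite -(bigA_distr_bigA F) (bigD1 j)//= [X in _ * X]big1 ?mulr1.
  by apply: eq_bigr => l _; rewrite /F eqxx.
by move=> i ij; rewrite -[RHS](w1 i); apply: eq_bigr => l _;
  rewrite /F (negbTE ij) mul1r.
Qed.

Let sum_prod m (w : 'I_p -> 'I_m.+1 -> R) :
  (forall i, \sum_l w i l = 1) ->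
  \sum_(k : {ffun 'I_p -> 'I_m.+1}) \prod_i w i (k i) = 1.
Proof.
by move=> w1; rewrite -(bigA_distr_bigA w) big1.
Qed.

(* [x |-> (1 + sin (x / M)) / 2] maps the cube of side [2 M] homeomorphically
   into [0, 1]^p, where Bernstein polynomials approximate; being bounded
   everywhere, it keeps the approximant bounded outside of the cube too. *)
Lemma trig_poly_approx (g : 'cV[R]_p -> R) (B M e : R) :
  continuous g -> (forall x, `|g x| <= B) -> 0 < M -> 0 < e ->
  exists2 q, trig_poly q & (forall x, `|q x| <= B) /\
    forall x, (forall j, `|x j 0| <= M) -> `|q x - g x| <= e.
Proof.
move=> cg gB M0 e0.
have B0 : 0 <= B := le_trans (normr_ge0 _) (gB 0).
have e20 : 0 < e / 2 by rewrite divr_gt0.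
have [dl dl0 unif] := cube_uniform_continuous M cg e20.
have c10 := @cos1_gt0 R.
pose inv c := projT1 (cid2 (sin_near_inverse c)).
have inv1 c : `|inv c| <= 1 by rewrite /inv; case: cid2.
have invP c b : `|b| <= 1 -> cos 1 * `|inv c - b| <= `|c - sin b|.
  by move: b; rewrite /inv; case: cid2.
(* If k_j / m is within [eta] of [y x j], coordinate j of the node is within 2 M eta / cos 1 = dl of
   that of x. *)
pose eta := dl * cos 1 / (2 * M).
have eta0 : 0 < eta by rewrite divr_gt0 ?mulr_gt0.
(* Chebyshev's constant: a node farther than [eta] in some coordinate pays the crude bound 2 B,
   which is at most L times the squared distance. *)
pose L := 2 * B / eta ^+ 2.
have L0 : 0 <= L.
  rewrite /L; apply: divr_ge0; [exact: mulr_ge0|exact: sqr_ge0].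
(* The binomial variance is at most 1 / m per coordinate, so with this [m] the term in L contributes
   at most e / 2. *)
have [m hm] : exists m : nat, (0 < m)%N /\ L * p%:R / (e / 2) <= m%:R.
  have := filter_ex (filterI (nbhs_infty_gt 0) (nbhs_infty_ger (L * p%:R / (e /
    2)))).
  by move=> [m [m0 hm]]; exists m.
have [m0 mL] := hm.
have mR : 0 < m%:R :> R by rewrite ltr0n.
pose y x j := (1 + sin (x j 0 / M)) / 2.
have y01 x j : 0 <= y x j <= 1.
  have := @sin_max R (x j 0 / M); rewrite ler_norml /y => /andP[h1 h2].
  by apply/andP; split; lra.
(* The preimage of the grid point k / m under the change of variables, clamped to the cube. *)
pose pt (k : {ffun 'I_p -> 'I_m.+1}) : 'cV[R]_p :=
  \col_j (M * inv (2 * ((k j : nat)%:R / m%:R) - 1)).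
pose W x (k : {ffun 'I_p -> 'I_m.+1}) := \prod_j bernstein m (k j) (y x j).
have W0 x k : 0 <= W x k by apply: prodr_ge0 => j _; exact: bernstein_ge0.
have W1 x : \sum_k W x k = 1.
  by apply: (sum_prod (w := fun i l => bernstein m l (y x i))) => i;
    exact: sum_bernstein.
exists (fun x => \sum_k g (pt k) * W x k).
  apply: trig_poly_sum => k; apply: trig_polyM; first exact: trig_poly_cst.
  apply: trig_poly_prod => j; apply: trig_poly_bernstein.
  exact: trig_poly_sin_coord.
split=> x.
  rewrite (le_trans (ler_norm_sum _ _ _))// -[leRHS]mulr1 -(W1 x) mulr_sumr.
  apply: ler_sum => k _; rewrite normrM (ger0_norm (W0 _ _)) ler_wpM2r//.
move=> xM.
have -> : \sum_k g (pt k) * W x k - g x = \sum_k (g (pt k) - g x) * W x k.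
  rewrite -[X in _ - X]mulr1 -(W1 x) mulr_sumr -sumrB.
  by apply: eq_bigr => k _; rewrite mulrBl.
have bound k : `|g (pt k) - g x| <=
    e / 2 + L * \sum_j ((k j : nat)%:R / m%:R - y x j) ^+ 2.
  have sum0 : 0 <= \sum_j ((k j : nat)%:R / m%:R - y x j) ^+ 2.
    by apply: sumr_ge0 => j _; exact: sqr_ge0.
  have [/forallP near|] :=
    boolP [forall j, `|(k j : nat)%:R / m%:R - y x j| <= eta].
    rewrite (@le_trans _ _ (e / 2))//; last by rewrite lerDl mulr_ge0.
    apply: unif => // j; rewrite mxE.
    have xjM : `|x j 0 / M| <= 1.
      by rewrite normrM normfV (gtr0_norm M0) ler_pdivrMr// mul1r.
    have := invP (2 * ((k j : nat)%:R / m%:R) - 1) _ xjM.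
    have -> : 2 * ((k j : nat)%:R / m%:R) - 1 - sin (x j 0 / M) =
        2 * ((k j : nat)%:R / m%:R - y x j) by rewrite /y; field;
          rewrite gt_eqF.
    have -> : M * inv (2 * ((k j : nat)%:R / m%:R) - 1) - x j 0 =
        M * (inv (2 * ((k j : nat)%:R / m%:R) - 1) - x j 0 / M).
      by field; rewrite gt_eqF.
    rewrite !normrM (gtr0_norm M0) gtr0_norm// => h.
    rewrite -ler_pdivlMl// -(ler_pM2l c10) (le_trans h)//.
    rewrite -ler_pdivlMl// (le_trans (near j))// /eta.
    by rewrite le_eqVlt; apply/orP; left; apply/eqP; field; rewrite gt_eqF.
  rewrite negb_forall => /existsP[j]; rewrite -ltNge => far.
  rewrite (@le_trans _ _ (2 * B))//.
    by rewrite (le_trans (ler_normB _ _))// mulr_natl mulr2n lerD.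
  rewrite ler_wpDl ?(ltW e20)//.
  have -> : 2 * B = L * eta ^+ 2 by rewrite /L divfK// gt_eqF// exprn_gt0.
  rewrite ler_wpM2l// (bigD1 j)//= ler_wpDr//.
    by apply: sumr_ge0 => i _; exact: sqr_ge0.
  by rewrite -[leRHS](real_normK (num_real _)) lerXn2r ?nnegrE// ltW.
rewrite (le_trans (ler_norm_sum _ _ _))//.
apply: (@le_trans _ _ (\sum_(k : {ffun 'I_p -> 'I_m.+1}) (e / 2 + L *
    \sum_j ((k j : nat)%:R / m%:R - y x j) ^+ 2) * W x k)).
  by apply: ler_sum => k _; rewrite normrM (ger0_norm (W0 _ _)) ler_wpM2r.
under eq_bigr do rewrite mulrDl.
rewrite big_split/= -mulr_sumr W1 mulr1 [leRHS]splitr lerD2l.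
under eq_bigr do rewrite -mulrA mulr_suml.
rewrite -mulr_sumr exchange_big/=.
apply: (@le_trans _ _ (L * \sum_(j < p) m%:R^-1)).
  rewrite ler_wpM2l//; apply: ler_sum => j _.
  rewrite (sum_prod_coord (w := fun i l => bernstein m l (y x i)) j
    (fun l => ((l : nat)%:R / m%:R - y x j) ^+ 2)); last first.
    by move=> i; exact: sum_bernstein.
  rewrite variance_bernstein// ler_piMl ?invr_ge0//.
  by have /andP[] := y01 x j; nra.
have -> : L * \sum_(j < p) m%:R^-1 = L * p%:R / m%:R.
  by rewrite sumr_const card_ord -mulr_natr; ring.
by rewrite ler_pdivrMr// [leRHS]mulrC -ler_pdivrMr.
Qed.

End trigonometric_approximation.

Lemma cvg_sum_seq (R : realType) I (s : seq I) (F : I -> nat -> R) (a : I ->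
  R) :
  (forall i, F i n @[n --> \oo] --> a i) ->
  \sum_(i <- s) F i n @[n --> \oo] --> \sum_(i <- s) a i.
Proof.
move=> Fa; elim: s => [|i s IH].
  by under eq_fun do rewrite big_nil; rewrite big_nil; exact: cvg_cst.
by under eq_fun do rewrite big_cons; rewrite big_cons; exact: cvgD.
Qed.

(** * From cosine means to convergence in distribution *)

Section trig_poly_analysis.
Context {R : realType} {p : nat}.
Implicit Types q : 'cV[R]_p -> R.

Lemma trig_poly_measurable q : trig_poly q -> measurable_fun setT q.
Proof.
move=> [s qs]; rewrite (_ : q = fun x => \sum_(c <- s) c.1.1 * cos (dotv c.1.2
  x + c.2)).
  apply: measurable_sum => c; apply: measurable_funM => //.
  exact: measurable_cos_dotv.
exact/funext.
Qed.

Lemma norm_cosB_le (a b : R) : `|cos a - cos b| <= `|a - b|.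
Proof.
have [c _ ->] := MVT_norm b a (fun x : R => is_derive_cos x).
by rewrite normrM normrN -[leRHS]mul1r ler_wpM2r// sin_max.
Qed.

Lemma trig_poly_lipschitz q : trig_poly q ->
  exists2 L, 0 <= L & forall x y : 'cV[R]_p, `|q x - q y| <= L * \sum_j `|x j 0
    - y j 0|.
Proof.
move=> [s qs].
exists (\sum_(c <- s) `|c.1.1| * \sum_j `|c.1.2 j 0|).
  by apply: sumr_ge0 => c _; rewrite mulr_ge0// sumr_ge0.
move=> x y; rewrite !qs -sumrB (le_trans (ler_norm_sum _ _ _))// mulr_suml.
apply: ler_sum => c _; rewrite -mulrBr normrM -mulrA ler_wpM2l//.
rewrite (le_trans (norm_cosB_le _ _))//.
have -> : dotv c.1.2 x + c.2 - (dotv c.1.2 y + c.2) =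
    \sum_j c.1.2 j 0 * (x j 0 - y j 0).
  rewrite opprD addrACA subrr addr0 /dotv -sumrB.
  by apply: eq_bigr => j _; rewrite mulrBr.
rewrite (le_trans (ler_norm_sum _ _ _))// mulr_suml.
apply: ler_sum => j _; rewrite normrM ler_wpM2l//.
by rewrite (bigD1 j)//= lerDl sumr_ge0.
Qed.

(** The sigma-algebra on vectors is generated by the entries, so continuity does not give
    measurability at once. Here [g] is a pointwise limit of trigonometric polynomials, with
    precision 1 / (n + 1) on the cube of half-side n + 1. *)
Lemma continuous_bounded_measurable (g : 'cV[R]_p -> R) (B : R) :
  continuous g -> (forall x, `|g x| <= B) -> measurable_fun setT g.
Proof.
move=> cg gB.
pose Q n := trig_poly_approx cg gB (ltr0Sn R n) (divr_gt0 ltr01 (ltr0Sn R n)).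
pose q n := s2val (cid2 (Q n)).
have tq n : trig_poly (q n) by rewrite /q; case: cid2.
have qg n (x : 'cV[R]_p) : (forall j, `|x j 0| <= n.+1%:R) ->
  `|q n x - g x| <= n.+1%:R^-1.
  by rewrite /q; case: cid2 => /= f _ [_ h]; rewrite -div1r; exact: h.
apply: (measurable_fun_cvg (h := q)) => [n|x _].
  exact: trig_poly_measurable.
apply/cvgrPdist_le => e e0; near=> n.
rewrite distrC (le_trans (qg n x _))//.
  move=> j; have : \sum_i `|x i 0| <= n%:R by near: n; exact: nbhs_infty_ger.
  move=> h; apply: (@le_trans _ _ n%:R); last by rewrite ler_nat.
  by rewrite (le_trans _ h)// (bigD1 j)//= lerDl sumr_ge0.
rewrite -[leRHS]invrK lef_pV2 ?posrE ?invr_gt0//.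
have : e^-1 <= n%:R by near: n; exact: nbhs_infty_ger.
by move=> /le_trans; apply; rewrite ler_nat.
Unshelve. all: by end_near. Qed.

(** For M > 0, a measurable majorant of the indicator of the complement of the cube; it tends to 0
    at each point as M grows, so its mean controls the tail of the limit law. *)
Let cap (M : R) (x : 'cV[R]_p) := Num.min 1 ((\sum_j x j 0 ^+ 2) / M ^+ 2).

Let measurable_cap M : measurable_fun setT (cap M).
Proof.
apply: measurable_minr => //; apply: measurable_funM => //.
by apply: measurable_sum => j; apply: measurable_funX; exact: measurable_entry.
Qed.

Let cap_ge0 M x : 0 <= cap M x.
Proof. by rewrite le_min ler01/= divr_ge0 ?sqr_ge0// sumr_ge0// => j _;
  exact: sqr_ge0. Qed.

Let cap_le1 M x : cap M x <= 1. Proof. by rewrite ge_min lexx. Qed.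

Let cap_out (M : R) (x : 'cV[R]_p) : 0 < M ->
  ~~ [forall j, `|x j 0| <= M] -> cap M x = 1.
Proof.
move=> M0; rewrite negb_forall => /existsP[j]; rewrite -ltNge => xM.
rewrite /cap min_l// ler_pdivlMr ?exprn_gt0// mul1r (bigD1 j)//=.
rewrite ler_wpDr ?sumr_ge0// => [i _|]; first exact: sqr_ge0.
by rewrite -[leRHS](real_normK (num_real _)) lerXn2r ?nnegrE// ltW.
Qed.

Let approx_bound (g q : 'cV[R]_p ->
  R) (B M e : R) (x : 'cV[R]_p) : 0 <= B -> 0 < M -> 0 <= e ->
  (forall y, `|g y| <= B) -> (forall y, `|q y| <= B) ->
  (forall y : 'cV[R]_p, (forall j, `|y j 0| <= M) -> `|q y - g y| <= e) ->
  `|g x - q x| <= e + 2 * B * cap M x.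
Proof.
move=> B0 M0 e0 gB qB qg; rewrite distrC.
have [/forallP h|h] := boolP [forall j, `|x j 0| <= M].
  by rewrite (le_trans (qg _ h))// lerDl !mulr_ge0.
rewrite cap_out// mulr1 (le_trans (ler_normB _ _))// ler_wpDl//.
by rewrite [leRHS]mulr_natl mulr2n lerD.
Qed.

(** Levy's continuity theorem and Slutsky's lemma in one: [W] carries the convergence on cosines,
    its second moments give tightness, and [V] is close to [W] off an event of small probability. *)
Lemma cvg_in_distribution_trig d (T : measurableType d) (P : probability T R)
    (mu : probability 'cV[R]_p R) (V W : nat -> T -> 'cV[R]_p) (K : R) :
  (forall n, measurable_fun setT (V n)) ->
  (forall n, measurable_fun setT (W n)) ->
  (forall t th, mean P (fun w => cos (dotv t (W n w) + th)) @[n --> \oo] -->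
    mean mu (fun x => cos (dotv t x + th))) ->
  (forall n j, intble P (fun w => W n w j 0 ^+ 2) /\
    mean P (fun w => W n w j 0 ^+ 2) <= K) ->
  (forall dl e : R, 0 < dl -> 0 < e -> \forall n \near \oo,
    exists A, [/\ measurable A, (P A <= e%:E)%E &
      forall w, ~ A w -> forall j, `|V n w j 0 - W n w j 0| <= dl]) ->
  cvg_in_distribution P V mu.
Proof.
move=> mV mW Wmu WK VW g cg [B gB].
have B0 : 0 <= B := le_trans (normr_ge0 _) (gB 0).
have mg := continuous_bounded_measurable cg gB.
have igV n : intble P (g \o V n).
  by apply: (@intble_bounded _ _ _ P _ B) => [|w];
    [exact: (measurableT_comp mg (mV n))|exact: gB].
have igmu : intble mu g by exact: (@intble_bounded _ _ _ mu _ B).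
rewrite mean_intE//; under eq_fun do rewrite expectationE//.
apply: cvg_EFin; first by near=> n.
(* In dimension zero the bound on the entries is void and [K] may be negative; what is needed is p K
   >= 0. *)
have K0 : p = 0%N \/ 0 <= K.
  case: (posnP p) => [->|p0]; [by left|right].
  have [_] := WK 0%N (Ordinal p0); apply: le_trans.
  by apply: mean_ge0 => w; exact: sqr_ge0.
have pK0 : 0 <= p%:R * K :> R.
  by case: K0 => [->|K0]; rewrite ?mul0r// mulr_ge0.
apply/cvgrPdist_le => e0 e00.
(* Seven errors of size [e] accumulate: two for replacing g by q under [mu], one for the convergence
   of the means of q along [W], four for passing from g at V to q at W. *)
pose e := e0 / 8.
have ee0 : 0 < e by rewrite divr_gt0.
have capmu : mean mu (cap n%:R) @[n --> \oo] --> (0 : R).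
  rewrite -[X in _ --> X](mean_cst mu 0).
  apply: (mean_dominated_cvg (g := fun=> 1)) => //.
  - move=> x; apply/cvgrPdist_le => r r0; near=> n.
    rewrite sub0r normrN (ger0_norm (cap_ge0 _ _)) ge_min; apply/orP; right.
    have n1 : (1 : R) <= n%:R by rewrite ler1n; near: n; exact: nbhs_infty_gt.
    rewrite ler_pdivrMr ?exprn_gt0 ?(lt_le_trans _ n1)//.
    have : (\sum_j x j 0 ^+ 2) / r <= n%:R by near: n; exact: nbhs_infty_ger.
    rewrite ler_pdivrMr// mulrC => /le_trans; apply.
    by rewrite ler_wpM2l ?(ltW r0)// expr2 ler_peMr// (le_trans _ n1).
  - exact: intble_cst.
  - by move=> n x; rewrite ger0_norm.
(* One cube controls both tails: the first bound is for [mu], the second is Chebyshev's for [W],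
   where 8 B / M^2 times (M / 2)^2 is the crude bound 2 B. *)
have [M [M0 [hM1 hM2]]] : exists M : R, 0 < M /\
    (2 * B * mean mu (cap M) <= e /\ 8 * B * (p%:R * K) / M ^+ 2 <= e).
  have h1 : 2 * B * mean mu (cap n%:R) @[n --> \oo] --> (0 : R).
    by rewrite -[X in _ --> X](mulr0 (2 * B)); exact: cvgMr.
  have /cvgrPdist_le/(_ _ ee0) h2 := h1.
  have [n [[hn1 hn2] hn3]] := filter_ex (filterI (filterI h2 (nbhs_infty_gt 0))
    (nbhs_infty_ger (8 * B * (p%:R * K) / e))).
  have n0 : (0:R) < n%:R by rewrite ltr0n.
  have n1 : (1:R) <= n%:R by rewrite ler1n.
  exists n%:R; split => //; split.
    have := hn1; rewrite sub0r normrN; exact/le_trans/ler_norm.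
  rewrite ler_pdivrMr ?exprn_gt0//.
  have := hn3; rewrite /= ler_pdivrMr// => /le_trans; apply.
  by rewrite mulrC ler_wpM2l ?(ltW ee0)// expr2 ler_peMr// (le_trans _ n1).
have [q tq [qB qg]] := trig_poly_approx cg gB M0 ee0.
have mq := trig_poly_measurable tq.
have [L L0 qL] := trig_poly_lipschitz tq.
have iqmu : intble mu q by exact: (@intble_bounded _ _ _ mu _ B).
have iqW n : intble P (q \o W n).
  by apply: (@intble_bounded _ _ _ P _ B) => [|w];
    [exact: (measurableT_comp mq (mW n))|exact: qB].
have qmu : `|mean mu q - mean mu g| <= e + e.
  rewrite distrC -meanB//.
  apply: (@le_trans _ _ (mean mu (fun x => e + 2 * B * cap M x))).
    have icap : intble mu (cap M).
      by apply: (@intble_bounded _ _ _ mu _ 1) => // x; rewrite ger0_norm.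
    apply: le_norm_mean.
    - exact: intbleB.
    - by apply: intbleD; [exact: intble_cst|exact: intbleZ].
    - by move=> x; apply: approx_bound => //; exact: ltW.
  have icap : intble mu (cap M).
    by apply: (@intble_bounded _ _ _ mu _ 1) => // x; rewrite ger0_norm.
  rewrite meanD; [|exact: intble_cst|exact: intbleZ].
  by rewrite mean_cst meanZ// lerD2l.
have qW : mean P (q \o W n) @[n --> \oo] --> mean mu q.
  have [s qs] := tq.
  have icos (m : probability 'cV[R]_p R) (c : R * 'cV[R]_p * R) :
      intble m (fun x => cos (dotv c.1.2 x + c.2)).
    apply: (@intble_bounded _ _ _ m _ 1) => [|x]; last exact: cos_max.
    exact: measurable_cos_dotv.
  have icosW n (c : R * 'cV[R]_p * R) :
      intble P (fun w => cos (dotv c.1.2 (W n w) + c.2)).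
    apply: (@intble_bounded _ _ _ P _ 1) => [|x]; last exact: cos_max.
    apply: (measurableT_comp (measurable_cos_dotv c.1.2 c.2)); exact: mW.
  rewrite (_ : q = fun x => \sum_(c <- s) c.1.1 * cos (dotv c.1.2 x + c.2));
    last exact/funext.
  rewrite mean_sum; last by move=> c; exact: intbleZ.
  under eq_fun => n.
    rewrite (_ : mean P _ = \sum_(c <- s) c.1.1 *
        mean P (fun w => cos (dotv c.1.2 (W n w) + c.2))).
      over.
    rewrite mean_sum; last by move=> c; exact: intbleZ.
    by apply: eq_bigr => c _; rewrite meanZ.
  apply: cvg_sum_seq => c; rewrite meanZ//; apply: cvgMr; exact: Wmu.
(* The first bound keeps V in the cube when W is in the half cube, the second keeps q(V) within [e]
   of q(W); the + 1 guards against L p = 0. *)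
pose dl := Num.min (M / 2) (e / (L * p%:R + 1)).
have Lp0 : 0 < L * p%:R + 1 by rewrite ltr_wpDl ?mulr_ge0.
have dl0 : 0 < dl by rewrite lt_min !divr_gt0.
have e20 : 0 < e / (2 * B + 1) by rewrite divr_gt0// ltr_wpDl ?mulr_ge0.
have dl1 : dl <= M / 2 by rewrite ge_min lexx.
have dl2 : L * p%:R * dl <= e.
  rewrite (@le_trans _ _ ((L * p%:R + 1) * dl))//.
    by rewrite ler_wpM2r ?(ltW dl0)// lerDl.
  by rewrite mulrC -ler_pdivlMr// ge_min lexx orbT.
move/cvgrPdist_le : qW => /(_ _ ee0) qW.
have VWn := VW _ _ dl0 e20.
near=> n.
have [A [mA PA hA]] : exists A, [/\ measurable A, (P A <= (e / (2 * B +
  1))%:E)%E &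
      forall w, ~ A w -> forall j, `|V n w j 0 - W n w j 0| <= dl] by near: n.
have iA : intble P (\1_A : T -> R).
  by apply: (@intble_bounded _ _ _ P _ 1) => // w; rewrite ger0_norm// indicE;
    case: (_ \in _).
have mAe : 2 * B * mean P (\1_A : T -> R) <= e.
  have : mean P (\1_A : T -> R) <= e / (2 * B + 1).
    by rewrite -lee_fin -mean_intE// integral_indic// setIT.
  move=> h; rewrite (@le_trans _ _ (2 * B * (e / (2 * B + 1))))//.
    by rewrite ler_wpM2l// mulr_ge0.
  by rewrite mulrCA ler_piMr ?(ltW ee0)// ler_pdivrMr ?mul1r ?lerDl//
    ltr_wpDl ?mulr_ge0.
(* On [A], or when W leaves the half cube, one of the last two terms pays the crude bound 2 B;
   otherwise q is close to g at V and Lipschitz between V and W. *)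
have gVqW w : `|g (V n w) - q (W n w)| <= (e + e) +
    (2 * B * \1_A w + 8 * B / M ^+ 2 * \sum_j W n w j 0 ^+ 2).
  have S0 : 0 <= 8 * B / M ^+ 2 * \sum_j W n w j 0 ^+ 2.
    apply: mulr_ge0; last by apply: sumr_ge0 => j _; exact: sqr_ge0.
    by apply: divr_ge0; [exact: mulr_ge0|exact: sqr_ge0].
  have T0 : 0 <= 2 * B * \1_A w :> R by rewrite !mulr_ge0.
  have crude : `|g (V n w) - q (W n w)| <= 2 * B.
    by rewrite (le_trans (ler_normB _ _))// [leRHS]mulr_natl mulr2n lerD.
  have [Aw|Aw] := pselect (A w).
    rewrite (le_trans crude)// indicE mem_set//
      mulr1 ler_wpDl ?addr_ge0 ?(ltW ee0)//.
    by rewrite lerDl.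
  have VWw := hA w Aw.
  have [/forallP h|] := boolP [forall j, `|W n w j 0| <= M / 2].
    rewrite ler_wpDr ?addr_ge0//.
    rewrite -(subrKA (q (V n w))) (le_trans (ler_normD _ _))// lerD//.
      rewrite distrC qg// => j; rewrite -[V n w j 0](subrK (W n w j 0)).
      rewrite (le_trans (ler_normD _ _))// [M]splitr lerD//.
      exact: le_trans (VWw j) dl1.
    rewrite (le_trans (qL _ _))// (le_trans _ dl2)// -mulrA ler_wpM2l//.
    rewrite (le_trans (ler_sum _ (fun j _ => VWw j)))// sumr_const card_ord.
    by rewrite mulr_natl.
  rewrite negb_forall => /existsP[j]; rewrite -ltNge => far.
  rewrite (le_trans crude)// ler_wpDl ?addr_ge0 ?(ltW ee0)// ler_wpDl//.
  have -> : 2 * B = 8 * B / M ^+ 2 * (M / 2) ^+ 2.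
    by field; rewrite gt_eqF.
  apply: ler_wpM2l; first by apply: divr_ge0; [exact: mulr_ge0|exact: sqr_ge0].
  rewrite (bigD1 j)//= ler_wpDr//.
    by apply: sumr_ge0 => i _; exact: sqr_ge0.
  rewrite -[leRHS](real_normK (num_real _)); apply: lerXn2r; rewrite ?nnegrE//.
    by rewrite divr_ge0// ltW.
  exact: ltW.
have meanVW : `|mean P (g \o V n) - mean P (q \o W n)| <= (e + e) + (e + e).
  rewrite -meanB//.
  have iS : intble P (fun w => \sum_j W n w j 0 ^+ 2).
    by apply: intble_sum => j; have [] := WK n j.
  have i1 := intble_cst P (e + e).
  have i2 := intbleD (intbleZ (2 * B) iA) (intbleZ (8 * B / M ^+ 2) iS).
  apply: (le_trans (le_norm_mean (intbleB (igV n) (iqW n)) (intbleD i1 i2)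
    gVqW)).
  rewrite meanD// mean_cst lerD2l meanD; [|exact: intbleZ|exact: intbleZ].
  rewrite !meanZ// lerD//.
  rewrite mean_sum; last by move=> j; have [] := WK n j.
  rewrite (le_trans _ hM2)// mulrAC ler_wpM2r ?invr_ge0 ?sqr_ge0//
    ler_wpM2l ?mulr_ge0//.
  rewrite (@le_trans _ _ (\sum_(j < p) K))//.
    by apply: ler_sum => j _; have [] := WK n j.
  by rewrite sumr_const card_ord mulr_natl.
have qWn : `|mean mu q - mean P (q \o W n)| <= e by near: n.
have -> : mean mu g - mean P (g \o V n) = (mean mu g - mean mu q) +
    ((mean mu q - mean P (q \o W n)) + (mean P (q \o W n) - mean P (g \o V n))).
  by ring.
rewrite (le_trans (ler_normD _ _))//.
rewrite (@le_trans _ _ ((e + e) + (e + ((e + e) + (e + e)))))//.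
  rewrite lerD//; first by rewrite distrC.
  by rewrite (le_trans (ler_normD _ _))// lerD// distrC.
by rewrite /e; lra.
Unshelve. all: by end_near. Qed.

End trig_poly_analysis.

(** * The Welsch loss *)

Section welsch_function.
Context {R : realType}.
Variable tau : R.
Hypothesis tau0 : 0 < tau.
Implicit Types r s : R.

Let E r := expR (- (tau / 2) * r ^+ 2).

(* Half the square minus the Welsch function, and its derivative. *)
Definition welsch_defect r := r ^+ 2 / 2 - (1 - E r) / tau.
Definition welsch_defect' r := r * (1 - E r).
Let D2 r := 1 - E r + tau * r ^+ 2 * E r.

Let is_derive_defect r : is_derive r 1 welsch_defect (welsch_defect' r).
Proof.
apply: is_derive_eq.
rewrite /GRing.scale/= /welsch_defect' /E; set e := expR _; field.
by rewrite gt_eqF.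
Qed.

Let is_derive_defect' r : is_derive r 1 welsch_defect' (D2 r).
Proof.
apply: is_derive_eq.
by rewrite /D2 /E /GRing.scale/=; field.
Qed.

Let E_bounds r : [/\ 0 < E r, E r <= 1, 1 - E r <= tau * r ^+ 2 / 2 &
  tau * r ^+ 2 * E r <= 2].
Proof.
have q0 : 0 <= tau * r ^+ 2 by rewrite mulr_ge0 ?sqr_ge0// ltW.
split.
- exact: expR_gt0.
- by rewrite expR_le1 mulNr oppr_le0 mulrAC divr_ge0.
- have := expR_ge1Dx (- (tau / 2) * r ^+ 2); rewrite -/(E r); lra.
rewrite /E mulNr expRN ler_pdivrMr ?expR_gt0//.
have := expR_ge1Dx (tau / 2 * r ^+ 2); lra.
Qed.

(** The bound 3 holds at all residuals and will give majorants; the other one tends to 0 with [tau]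
    at a fixed residual. They arise as 1 + 2 and as tau r^2 / 2 + tau r^2. *)
Let D2_bound r : `|D2 r| <= Num.min 3 (3 / 2 * (tau * r ^+ 2)).
Proof.
have [E0 E1 h1 h2] := E_bounds r.
have q0 : 0 <= tau * r ^+ 2 by rewrite mulr_ge0 ?sqr_ge0// ltW.
have qE0 : 0 <= tau * r ^+ 2 * E r by rewrite mulr_ge0// ltW.
have qE1 : tau * r ^+ 2 * E r <= tau * r ^+ 2 by rewrite ler_piMr.
by rewrite ger0_norm /D2 ?le_min; [apply/andP; split; lra|lra].
Qed.

Lemma welsch_defect'_le r : `|welsch_defect' r| <= `|r|.
Proof.
have [E0 E1 _ _] := E_bounds r.
rewrite /welsch_defect' normrM -[leRHS]mulr1 ler_wpM2l//.
by rewrite ger0_norm; lra.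
Qed.

Lemma welsch_defect'_small r : `|welsch_defect' r| <= `|r| ^+ 3 / 2 * tau.
Proof.
have [E0 E1 h _] := E_bounds r.
rewrite /welsch_defect' normrM [leRHS](_ : _ = `|r| * (tau * r ^+ 2 / 2)).
  by rewrite ler_wpM2l// ger0_norm; lra.
by rewrite -(real_normK (num_real r)); ring.
Qed.

(** The mean value theorem is applied to the defect and then to its derivative; the last
    intermediate point stays within |s| of r. *)
Lemma welsch_defect_taylor r s :
  `|welsch_defect (r - s) - welsch_defect r + s * welsch_defect' r| <=
  s ^+ 2 * Num.min 3 (3 * tau * (r ^+ 2 + s ^+ 2)).
Proof.
have [c cr ->] := MVT_norm r (r - s) is_derive_defect.
have [b bc E1] := MVT_norm r c is_derive_defect'.
have -> : welsch_defect' c * (r - s - r) + s * welsch_defect' r =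
  - s * (welsch_defect' c - welsch_defect' r) by ring.
move: cr; rewrite [r - s - r]addrAC subrr sub0r normrN => cr.
have bs : `|b - r| <= `|s| by exact: le_trans cr.
rewrite E1 !normrM normrN -(real_normK (num_real s)) expr2.
rewrite [X in `|s| * X]mulrC mulrA.
apply: ler_pM => //.
  by rewrite ler_wpM2l.
apply: (le_trans (D2_bound b)); rewrite le_min !ge_min lexx/=.
apply/orP; right.
have b2 : b ^+ 2 <= 2 * (r ^+ 2 + s ^+ 2).
  have h : (b - r) ^+ 2 <= s ^+ 2.
    rewrite -(real_normK (num_real s)) -(real_normK (num_real (b - r))).
    by apply: lerXn2r; rewrite ?nnegrE.
  (* From b^2 = 2 (b - r)^2 + 2 r^2 - (b - 2 r)^2. *)
  have := sqr_ge0 (b - 2 * r); lra.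
have : tau * b ^+ 2 <= tau * (2 * (r ^+ 2 + s ^+ 2)) by rewrite ler_pM2l.
rewrite -expr2 (real_normK (num_real s)); lra.
Qed.

End welsch_function.

(** * Quadratic expansion of the loss and location of its minimizer *)

Section quadratic_expansion.
Context {R : realType} {p : nat}.
Implicit Types (u v h : 'cV[R]_p).

(* [g] minimizes the quadratic part. *)
Lemma approx_quadratic_argmin (Q : 'cV[R]_p -> R) (g v : 'cV[R]_p) (k : R) :
  0 <= k <= 1 / 8 ->
  (forall u, u = g \/ u = v ->
    `|Q u - (dotv u u / 2 - dotv g u)| <= k * dotv u u) ->
  Q v <= Q g -> dotv (v - g) (v - g) <= 12 * k * dotv g g.
Proof.
move=> /andP[k0 k1] Qk Qvg.
have := Qk g (or_introl erefl); have := Qk v (or_intror erefl).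
rewrite !ler_norml => /andP[hv _] /andP[_ hg].
(* With D = |v - g|^2, Q v <= Q g yields D / 2 <= k (|v|^2 + |g|^2). The second inequality says
   |v|^2 <= 2 D + 2 |g|^2, so D (1 / 2 - 2 k) <= 3 k |g|^2; for k <= 1 / 8 the factor of D is at
   least 1 / 4, whence the 12. *)
have d0 := dotv_ge0 (v - g); have d1 := dotv_ge0 (v + (- 2) *: g).
move: d0 d1; rewrite !(dotvDl, dotvDr, dotvNl, dotvNr, dotvZl, dotvZr) (dotvC v
  g).
move: hv hg; set a := dotv v v; set b := dotv g v;
  set c := dotv g g => hv hg d0 d1.
have c0 : 0 <= c := dotv_ge0 g.
have : k * (a - b + (- b - - c)) <= 1 / 8 * (a - b + (- b - - c)).
  by rewrite ler_wpM2r.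
have : 0 <= k * (a + - 2 * b + (- 2 * b + - 2 * (- 2 * c))) by rewrite mulr_ge0.
nra.
Qed.

Variables (n : nat) (x : nat -> 'cV[R]_p) (xi : nat -> R) (tau c : R).
Variable bstar : 'cV[R]_p.
Hypotheses (n0 : (0 < n)%N) (tau0 : 0 < tau).
Let y i := dotv (x i) bstar + xi i.
Let sn := Num.sqrt (n%:R : R).

Definition score : 'cV[R]_p := \col_j (sn^-1 * \sum_(i < n) xi i * x i j 0).
Definition score_defect : 'cV[R]_p :=
  \col_j (sn^-1 * \sum_(i < n) welsch_defect' tau (xi i) * x i j 0).
Definition gram_error (j k : 'I_p) : R :=
  n%:R^-1 * \sum_(i < n) (x i j 0 * x i k 0 - (j == k)%:R).
(** Bounds the mean remainder of [welsch_defect_taylor] at increments <x_i, h>, per unit of |h|^2.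
    Cauchy-Schwarz is used outside the minimum with |h|^2 and inside it with |h| <= c, so that no h
    is left. *)
Definition curvature_error : R := n%:R^-1 * \sum_(i < n)
  (Num.min 3 (3 * tau * (xi i ^+ 2 + c ^+ 2 * dotv (x i) (x i))) *
   dotv (x i) (x i)).

Let nR : n%:R != 0 :> R. Proof. by rewrite pnatr_eq0 -lt0n. Qed.
Let sn0 : 0 < sn. Proof. by rewrite sqrtr_gt0 ltr0n. Qed.
Let sn2 : sn ^+ 2 = n%:R. Proof. by rewrite sqr_sqrtr. Qed.

Let kappa := (\sum_j \sum_k `|gram_error j k|) / 2 + curvature_error.

(** With the loss written as half the squares minus [welsch_defect], the square part is exactly
    quadratic and deviates from |v|^2 / 2 by the Gram error; the defect beyond its linear term is
    the curvature error. *)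
Let welsch_expansion h v : dotv h h <= c ^+ 2 -> v = sn *: h ->
  `|n%:R * (welsch_loss n x y tau (bstar + h) - welsch_loss n x y tau bstar) -
    (dotv v v / 2 - dotv (score - score_defect) v)| <= kappa * dotv v v.
Proof.
move=> hc vE; set s := fun i => dotv (x i) h.
have lossE b : welsch_loss n x y tau b =
    n%:R^-1 * \sum_(i < n) ((residual x y b i) ^+ 2 / 2 -
      welsch_defect tau (residual x y b i)).
  rewrite /welsch_loss invfM [tau^-1 * _]mulrC -mulrA; congr (_ * _).
  rewrite mulr_sumr.
  apply: eq_bigr => i _; rewrite /welsch_defect; field.
  by rewrite gt_eqF.
have res1 i : residual x y (bstar + h) i = xi i - s i.
  by rewrite /residual dotvDr /y /s; ring.
have res0 i : residual x y bstar i = xi i by rewrite /residual /y; ring.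
pose rho i := welsch_defect tau (xi i - s i) - welsch_defect tau (xi i) +
  s i * welsch_defect' tau (xi i).
have -> : n%:R * (welsch_loss n x y tau (bstar + h) - welsch_loss n x y tau
  bstar)
    = (\sum_(i < n) s i ^+ 2) / 2 - \sum_(i < n) xi i * s i +
      \sum_(i < n) welsch_defect' tau (xi i) * s i - \sum_(i < n) rho i.
  rewrite !lossE -mulrBr mulVKf// -sumrB mulr_suml -sumrB -big_split/= -sumrB.
  by apply: eq_bigr => i _; rewrite res1 res0 /rho; field.
have linE (z : nat -> R) : \sum_(i < n) z i * s i =
    dotv (\col_j (sn^-1 * \sum_(i < n) z i * x i j 0)) v.
  rewrite vE /dotv; under [RHS]eq_bigr => j _.
    rewrite !mxE mulrACA mulVf ?gt_eqF// mul1r mulr_suml.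
    over.
  rewrite exchange_big/=; apply: eq_bigr => i _.
  by rewrite /s /dotv mulr_sumr; apply: eq_bigr => j _; rewrite mulrA.
rewrite (linE xi) (linE (fun i => welsch_defect' tau (xi i))) -/score
  -/score_defect.
rewrite dotvDl dotvNl.
have vv : dotv v v = n%:R * dotv h h.
  by rewrite vE dotvZl dotvZr mulrA -expr2 sn2.
have quadE : \sum_(i < n) s i ^+ 2 - dotv v v =
    \sum_j \sum_k gram_error j k * (v j 0 * v k 0).
  transitivity (\sum_j \sum_k
      (\sum_(i < n) (x i j 0 * x i k 0 - (j == k)%:R)) * (h j 0 * h k 0)).
    rewrite vv.
    under [RHS]eq_bigr => j _ do under eq_bigr => k _ do rewrite mulr_suml.
    under [RHS]eq_bigr => j _ do rewrite exchange_big/=.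
    rewrite exchange_big/=.
    have -> : n%:R * dotv h h = \sum_(i < n) dotv h h.
      by rewrite sumr_const card_ord mulr_natl.
    rewrite -sumrB; apply: eq_bigr => i _.
    rewrite expr2 /s /dotv big_distrlr/= -sumrB; apply: eq_bigr => j _.
    under [RHS]eq_bigr do rewrite mulrBl.
    rewrite sumrB; congr (_ - _).
      by apply: eq_bigr => k _; rewrite mulrACA.
    rewrite (bigD1 j)//= eqxx mul1r big1 ?addr0// => k kj.
    by rewrite eq_sym (negbTE kj) mul0r.
  apply: eq_bigr => j _; apply: eq_bigr => k _.
  rewrite /gram_error vE !mxE.
  have -> : sn * h j 0 * (sn * h k 0) = sn ^+ 2 * (h j 0 * h k 0) by ring.
  by rewrite sn2; field.
rewrite [X in `|X|](_ : _ = (\sum_(i < n) s i ^+ 2 - dotv v v) / 2 -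
    \sum_(i < n) rho i); last by field.
rewrite (le_trans (ler_normB _ _))// /kappa [leRHS]mulrDl lerD//.
  rewrite quadE normrM [`|2^-1|]ger0_norm// mulrAC ler_wpM2r//.
  rewrite (le_trans (ler_norm_sum _ _ _))// mulr_suml; apply: ler_sum => j _.
  rewrite (le_trans (ler_norm_sum _ _ _))// mulr_suml; apply: ler_sum => k _.
  rewrite normrM ler_wpM2l//.
  have h1 := coord_le_dotv v j; have h2 := coord_le_dotv v k.
  rewrite ler_norml; have := sqr_ge0 (v j 0 + v k 0);
    have := sqr_ge0 (v j 0 - v k 0).
  by move=> h3 h4; apply/andP; split; nra.
rewrite vv /curvature_error mulrACA mulVf//
  mul1r (le_trans (ler_norm_sum _ _ _))//.
rewrite mulr_suml; apply: ler_sum => i _.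
rewrite (le_trans (welsch_defect_taylor tau0 _ _))//.
have s2 : s i ^+ 2 <= dotv (x i) (x i) * dotv h h by exact: dotv_cauchy_schwarz.
have xx0 := dotv_ge0 (x i).
rewrite -[leRHS]mulrA [leLHS]mulrC; apply: ler_pM => //.
- rewrite le_min ler0n/= !mulr_ge0 ?addr_ge0 ?sqr_ge0//; exact: ltW.
- exact: sqr_ge0.
rewrite le_min !ge_min lexx/=; apply/orP; right.
rewrite ler_wpM2l ?mulr_ge0 ?(ltW tau0)// lerD2l (le_trans s2)// mulrC.
by rewrite ler_wpM2r.
Qed.

Lemma curvature_error_ge0 : 0 <= curvature_error.
Proof.
apply: mulr_ge0; first by rewrite invr_ge0.
apply: sumr_ge0 => i _; apply: mulr_ge0; last exact: dotv_ge0.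
rewrite le_min ler0n/=; apply: mulr_ge0; first by rewrite mulr_ge0// ltW.
by apply: addr_ge0; [exact: sqr_ge0|apply: mulr_ge0;
  [exact: sqr_ge0|exact: dotv_ge0]].
Qed.

(** The bound |g|^2 <= c^2 n puts bstar + g / sqrt n in the basin, where it competes with [bhat]. *)
Lemma welsch_minimizer_close (bhat : 'cV[R]_p) : 0 <= c ->
  minimizes_over (basin bstar c) (welsch_loss n x y tau) bhat ->
  (\sum_j \sum_k `|gram_error j k|) / 2 + curvature_error <= 1 / 8 ->
  let g := score - score_defect in
  dotv g g <= c ^+ 2 * n%:R ->
  dotv (sn *: (bhat - bstar) - g) (sn *: (bhat - bstar) - g) <=
  12 * ((\sum_j \sum_k `|gram_error j k|) / 2 + curvature_error) * dotv g g.
Proof.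
move=> c0 [bhatc bhatmin]; rewrite -/kappa => k1 g gc.
have basinE h : dotv h h <= c ^+ 2 -> basin bstar c (bstar + h).
  move=> hc; rewrite /basin /= addrC addKr /norm2 -(ger0_norm c0) -sqrtr_sqr.
  by rewrite ler_sqrt// sqr_ge0.
have hhat : dotv (bhat - bstar) (bhat - bstar) <= c ^+ 2.
  move: bhatc; rewrite /basin /= /norm2 => h.
  rewrite -(sqr_sqrtr (dotv_ge0 (bhat - bstar))).
  by apply: lerXn2r; rewrite ?nnegrE// sqrtr_ge0.
have hg : dotv (sn^-1 *: g) (sn^-1 *: g) <= c ^+ 2.
  rewrite dotvZl dotvZr mulrA -invfM -expr2 sn2 mulrC ler_pdivrMr// ltr0n//.
have k0 : 0 <= kappa.
  by rewrite addr_ge0 ?curvature_error_ge0 ?divr_ge0// sumr_ge0// => j _;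
    rewrite sumr_ge0.
pose Q v := n%:R * (welsch_loss n x y tau (bstar + sn^-1 *: v) -
  welsch_loss n x y tau bstar).
have snK v : sn *: (sn^-1 *: v) = v by rewrite scalerA divff ?gt_eqF// scale1r.
have snVK v : sn^-1 *: (sn *: v) = v by rewrite scalerA mulVf ?gt_eqF// scale1r.
apply: (@approx_quadratic_argmin Q); first by rewrite k0.
  move=> u [->|->].
    by apply: welsch_expansion => //; rewrite snK.
  by rewrite /Q snVK; exact: welsch_expansion.
rewrite /Q snVK; apply: ler_wpM2l; first exact: ler0n.
apply: lerB => //; have -> : bstar + (bhat - bstar) = bhat
  by rewrite addrC subrK.
by apply: bhatmin; exact: basinE.
Qed.

End quadratic_expansion.

Section second_moments.
Context {d : measure_display} {T : measurableType d} {R : realType}.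
Variable P : probability T R.

Lemma second_moment_normalized (Z : nat -> T -> R) n : iid_sums P Z ->
  intble P (fun w => Z 0%N w ^+ 2) -> mean P (Z 0%N) = 0 -> (0 < n)%N ->
  intble P (fun w => ((Num.sqrt n%:R)^-1 * \sum_(i < n) Z i w) ^+ 2) /\
  mean P (fun w => ((Num.sqrt n%:R)^-1 * \sum_(i < n) Z i w) ^+ 2) =
  mean P (fun w => Z 0%N w ^+ 2).
Proof.
move=> iidZ Z2 EZ n0; have [i2 E2] := second_moment_sum iidZ Z2 EZ n.
under eq_fun do rewrite exprMn.
split; first exact: intbleZ.
rewrite meanZ// E2 exprVn sqr_sqrtr// mulKf//.
by rewrite pnatr_eq0 -lt0n.
Qed.

Lemma mean_average (Z : nat -> T -> R) n : iid_sums P Z -> intble P (Z 0%N) ->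
  (0 < n)%N ->
  intble P (fun w => n%:R^-1 * \sum_(i < n) Z i w) /\
  mean P (fun w => n%:R^-1 * \sum_(i < n) Z i w) = mean P (Z 0%N).
Proof.
move=> iidZ Z1 n0.
have Zi i : intble P (Z i) /\ mean P (Z i) = mean P (Z 0%N).
  exact: (iid_sums_mean (f := id) i iidZ (@measurable_id _ _ _) Z1).
have iS : intble P (fun w => \sum_(i < n) Z i w).
  by apply: intble_sum => i; have [] := Zi i.
split; first exact: intbleZ.
rewrite meanZ// mean_sum; last by move=> i; have [] := Zi i.
under eq_bigr => i _ do rewrite (proj2 (Zi i)).
rewrite sumr_const card_ord -[X in _ * X]mulr_natl mulKf//.
by rewrite pnatr_eq0 -lt0n.
Qed.

End second_moments.

(** * Limits of the score and of the error terms *)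

Section regression_limits.
Context {d : measure_display} {T : measurableType d} {R : realType}.
Variable P : probability T R.
Context {p : nat}.
Variables (X : nat -> {RV P >-> 'cV[R]_p}) (xi : nat -> {RV P >-> R}).
Hypothesis hXxi : independent_sequences X xi.
Hypothesis hX : design_assumption X.
Hypotheses (hxi : iid xi) (Exi : ('E_P[xi 0%N] = 0)%E)
  (Vxi : ('V_P[xi 0%N] = 1)%E).

Let iidX : iid X. Proof. by have [] := hX. Qed.

Let mcoord j : measurable_fun setT (fun v : 'cV[R]_p => v j 0).
Proof. exact: measurable_entry. Qed.

Let mXj i j : measurable_fun setT (fun w => X i w j 0).
Proof. exact: (measurableT_comp (mcoord j)). Qed.

Let xi2 : intble P (fun w => xi 0%N w ^+ 2) /\
  mean P (fun w => xi 0%N w ^+ 2) = 1.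
Proof.
have E2 : ('E_P[fun w => (xi 0%N w ^+ 2)%R] = 1)%E.
  rewrite -Vxi /variance [in RHS]unlock Exi; congr expectation.
  apply/funext => w.
  by rewrite -[RHS]/((xi 0%N w - 0) * (xi 0%N w - 0)) subr0 expr2.
have i2 : intble P (fun w => xi 0%N w ^+ 2).
  apply: expectation_lty_intble; first exact: measurable_funX.
    by move=> w; exact: sqr_ge0.
  by rewrite E2 ltry.
by split => //; apply: EFin_inj; rewrite -expectationE.
Qed.

Let XXE j k : (fun w => (X 0%N w *m (X 0%N w)^T) j k) =
  (fun w => X 0%N w j 0 * X 0%N w k 0).
Proof. by apply/funext => w; rewrite mxE big_ord1 mxE. Qed.

Let X2 j : intble P (fun w => X 0%N w j 0 ^+ 2).
Proof.
have [_ _ /(_ j j) h _] := hX; rewrite XXE in h.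
apply: expectation_lty_intble; first exact: measurable_funX.
  by move=> w; exact: sqr_ge0.
have -> : (fun w => X 0%N w j 0 ^+ 2) = (fun w => X 0%N w j 0 * X 0%N w j 0).
  by apply/funext => w; rewrite expr2.
by rewrite h ltry.
Qed.

Let XX j k : intble P (fun w => X 0%N w j 0 * X 0%N w k 0) /\
  mean P (fun w => X 0%N w j 0 * X 0%N w k 0) = (j == k)%:R.
Proof.
have i2 : intble P (fun w => X 0%N w j 0 * X 0%N w k 0) by exact: intbleM.
split => //; apply: EFin_inj; rewrite -expectationE//.
by have [_ _ /(_ j k) h _] := hX; rewrite XXE mxE in h; rewrite h.
Qed.

Let X1 j : intble P (fun w => X 0%N w j 0) /\ mean P (fun w => X 0%N w j 0) = 0.
Proof.
have i1 : intble P (fun w => X 0%N w j 0) by exact: intble_sqr.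
split => //; apply: EFin_inj; rewrite -expectationE//.
by have [_ h _ _] := hX; exact: h.
Qed.

(** From z <= 4 exp (z / 4). It turns the exponential moments of the design into fourth moments,
    used in the L^2 law of large numbers for products of two entries. *)
Let pow4_le_expR (x : R) : x ^+ 4 <= 4 ^+ 4 * (expR x + expR (- x)).
Proof.
have h (z : R) : 0 <= z -> z ^+ 4 <= 4 ^+ 4 * expR z.
  move=> z0; have -> : expR z = expR (z / 4) ^+ 4.
    by rewrite -expRM_natl; congr expR; field.
  rewrite -exprMn; apply: lerXn2r; rewrite ?nnegrE ?mulr_ge0 ?expR_ge0//.
  by have := expR_ge1Dx (z / 4); lra.
rewrite mulrDr; have [x0|x0] := leP 0 x.
  by rewrite (le_trans (h _ x0))// lerDl mulr_ge0 ?exprn_ge0// expR_ge0.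
have nx0 : 0 <= - x by rewrite oppr_ge0 ltW.
have -> : x ^+ 4 = (- x) ^+ 4 by ring.
by rewrite (le_trans (h _ nx0))// lerDr mulr_ge0 ?exprn_ge0// expR_ge0.
Qed.

Let intble_expR u : intble P (fun w => expR (dotv u (X 0%N w))).
Proof.
have [_ _ _ /(_ u) h] := hX.
apply: expectation_lty_intble.
- apply: measurableT_comp => //.
  exact: (measurableT_comp (measurable_dotv u)).
- by move=> w; exact: expR_ge0.
- by apply: le_lt_trans h _; exact: ltry.
Qed.

Let X4 j : intble P (fun w => X 0%N w j 0 ^+ 4).
Proof.
have dE x : dotv (delta_mx j 0) x = x j 0 :> R.
  rewrite /dotv (bigD1 j)//= big1 ?addr0 ?mxE ?eqxx ?mul1r// => i ij.
  by rewrite mxE (negbTE ij) mul0r.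
have ip := intble_expR (delta_mx j 0); have im := intble_expR (- delta_mx j 0).
apply: (intble_le _ (intbleZ (4 ^+ 4) (intbleD ip im))).
  exact: measurable_funX.
move=> w; rewrite dotvNl dE ger0_norm ?pow4_le_expR//.
by rewrite -[4%N]/(2 * 2)%N exprM sqr_ge0.
Qed.

Let cross2 (f : R -> R) (g : 'cV[R]_p -> R) :
  measurable_fun setT f -> measurable_fun setT g ->
  intble P (fun w => f (xi 0%N w)) -> intble P (fun w => g (X 0%N w)) ->
  intble P (fun w => f (xi 0%N w) * g (X 0%N w)) /\
  mean P (fun w => f (xi 0%N w) * g (X 0%N w)) =
  mean P (fun w => f (xi 0%N w)) * mean P (fun w => g (X 0%N w)).
Proof.
move=> mf mg i1 i2.
have [i12 E12] := mean_indep (indep_funs_cross hXxi 0%N mg mf) i2 i1.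
have -> : (fun w => f (xi 0%N w) * g (X 0%N w)) =
  (fun w => (g \o X 0%N) w * (f \o xi 0%N) w).
  by apply/funext => w; rewrite mulrC.
by split => //; rewrite E12 mulrC.
Qed.

(** The centering comes from g(X) alone, so [f] is free: the identity for the score, and
    [welsch_defect'] for its error, whose mean under the noise need not vanish. *)
Let cross_moments (f : R -> R) (g : 'cV[R]_p -> R) :
  measurable_fun setT f -> measurable_fun setT g ->
  intble P (fun w => f (xi 0%N w) ^+ 2) ->
    intble P (fun w => g (X 0%N w) ^+ 2) ->
  mean P (fun w => g (X 0%N w)) = 0 ->
  [/\ iid_sums P (fun i w => f (xi i w) * g (X i w)),
    mean P (fun w => f (xi 0%N w) * g (X 0%N w)) = 0,
    intble P (fun w => (f (xi 0%N w) * g (X 0%N w)) ^+ 2) &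
    mean P (fun w => (f (xi 0%N w) * g (X 0%N w)) ^+ 2) =
    mean P (fun w => f (xi 0%N w) ^+ 2) * mean P (fun w => g (X 0%N w) ^+ 2)].
Proof.
move=> mf mg f2 g2 g0.
have mfxi : measurable_fun setT (fun w => f (xi 0%N w))
  by exact: (measurableT_comp mf).
have mgX : measurable_fun setT (fun w => g (X 0%N w))
  by exact: (measurableT_comp mg).
have [i2 E2] := cross2 (measurable_funX 2 mf) (measurable_funX 2 mg) f2 g2.
have sqE : (fun w => (f (xi 0%N w) * g (X 0%N w)) ^+ 2) =
    (fun w => f (xi 0%N w) ^+ 2 * g (X 0%N w) ^+ 2).
  by apply/funext => w; rewrite exprMn.
split.
- apply: (iid_sums_pairs iidX hxi hXxi (h := fun x z => f z * g x)).
  apply: measurable_funM.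
    exact: (measurableT_comp mf measurable_snd).
  exact: (measurableT_comp mg measurable_fst).
- have [_ ->] := cross2 mf mg (intble_sqr mfxi f2) (intble_sqr mgX g2).
  by rewrite g0 mulr0.
- by rewrite sqE.
- by rewrite sqE E2.
Qed.

Let score_terms j := cross_moments (f := id) (g := fun v => v j 0)
  (@measurable_id _ _ _) (mcoord j) (proj1 xi2) (X2 j) (proj2 (X1 j)).

Lemma score_second_moment n j :
  intble P (fun w => score n (X ^~ w) (xi ^~ w) j 0 ^+ 2) /\
  mean P (fun w => score n (X ^~ w) (xi ^~ w) j 0 ^+ 2) <= 1.
Proof.
have scE : (fun w => score n (X ^~ w) (xi ^~ w) j 0 ^+ 2) =
    (fun w => ((Num.sqrt n%:R)^-1 * \sum_(i < n) xi i w * X i w j 0) ^+ 2).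
  by apply/funext => w; rewrite mxE.
rewrite scE.
have [iidZ EZ Z2 EZ2] := score_terms j.
have [->|n0] := posnP n.
  have -> : (fun w => ((Num.sqrt 0)^-1 * \sum_(i < 0) xi i w * X i w j 0) ^+ 2)
    =
      fun=> 0.
    by apply/funext => w; rewrite big_ord0 mulr0 expr0n.
  by rewrite mean_cst; split; [exact: intble_cst|exact: ler01].
have [h ->] := second_moment_normalized iidZ Z2 EZ n0.
split => //; rewrite EZ2 (proj2 xi2) mul1r.
have -> : (fun w => X 0%N w j 0 ^+ 2) = (fun w => X 0%N w j 0 * X 0%N w j 0).
  by apply/funext => w; rewrite expr2.
by rewrite (proj2 (XX j j)) eqxx.
Qed.

Lemma measurable_score n :
  measurable_fun setT (fun w => score n (X ^~ w) (xi ^~ w)).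
Proof.
apply: measurable_fun_matrix => j k; rewrite (ord1 k).
under eq_fun do rewrite mxE.
apply: measurable_funM => //; apply: measurable_sum => i.
exact: measurable_funM.
Qed.

(** Cramer-Wold: <t, score> is the normalized sum of xi_i <t, X_i>, which has variance |t|^2 by
    isotropy and unit noise variance. *)
Lemma score_clt (t : 'cV[R]_p) (th : R) :
  mean P (fun w => cos (dotv t (score n (X ^~ w) (xi ^~ w)) + th)) @[n --> \oo]
    -->
  expR (- (dotv t t / 2)) * cos th.
Proof.
have dXX : (fun w => dotv t (X 0%N w) ^+ 2) = (fun w =>
    \sum_j \sum_k t j 0 * t k 0 * (X 0%N w j 0 * X 0%N w k 0)).
  apply/funext => w; rewrite expr2 /dotv big_distrlr/=.
  by apply: eq_bigr => j _; apply: eq_bigr => k _; rewrite mulrACA.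
have iXX j k : intble P (fun w => t j 0 * t k 0 * (X 0%N w j 0 * X 0%N w k 0)).
  by apply: intbleZ; have [] := XX j k.
have d2 : intble P (fun w => dotv t (X 0%N w) ^+ 2).
  by rewrite dXX; apply: intble_sum => j; exact: intble_sum.
have Ed2 : mean P (fun w => dotv t (X 0%N w) ^+ 2) = dotv t t.
  rewrite dXX mean_sum; last by move=> j; exact: intble_sum.
  apply: eq_bigr => j _; rewrite mean_sum//.
  rewrite (bigD1 j)//= big1 ?addr0.
    by rewrite meanZ ?(proj2 (XX j j)) ?eqxx ?mulr1//; have [] := XX j j.
  move=> k kj; rewrite meanZ ?(proj2 (XX j k)) ?[j == k]eq_sym ?(negbTE kj)
    ?mulr0//.
  by have [] := XX j k.
have Ed1 : mean P (fun w => dotv t (X 0%N w)) = 0.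
  rewrite mean_sum; last by move=> j; apply: intbleZ; have [] := X1 j.
  by rewrite big1// => j _; have [h1 h2] := X1 j; rewrite meanZ// h2 mulr0.
have [iidZ EZ Z2 EZ2] := cross_moments (f := id) (g := dotv t)
  (@measurable_id _ _ _) (measurable_dotv t) (proj1 xi2) d2 Ed1.
have := clt_cos iidZ Z2 EZ (th := th).
rewrite EZ2 (proj2 xi2) mul1r Ed2.
have E n : (fun w => cos (dotv t (score n (X ^~ w) (xi ^~ w)) + th)) =
    (fun w => cos ((Num.sqrt n%:R)^-1 * (\sum_(i < n) id (xi i w) * dotv t (X i
      w)) + th)).
  apply/funext => w; congr (cos (_ + _)).
  rewrite /dotv; under eq_bigr do rewrite mxE mulrCA mulr_sumr.
  rewrite -mulr_sumr exchange_big/=; congr (_ * _); apply: eq_bigr => i _.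
  by rewrite mulr_sumr; apply: eq_bigr => j _; rewrite mulrCA.
by under [in X in _ -> X]eq_fun do rewrite E.
Qed.

(** The second moment is the variance of one term divided by n. The summand takes a dummy noise
    argument so that [iid_sums_pairs] applies. *)
Lemma gram_error_second_moment j k :
  (forall n, (0 < n)%N -> intble P (fun w => gram_error n (X ^~ w) j k ^+ 2)) /\
  (mean P (fun w => gram_error n (X ^~ w) j k ^+ 2) @[n --> \oo] --> (0 : R)).
Proof.
pose h (x : 'cV[R]_p) (z : R) : R := x j 0 * x k 0 - (j == k)%:R.
have mh : measurable_fun setT (fun z : 'cV[R]_p * R => h z.1 z.2).
  apply: measurable_funB => //; apply: measurable_funM.
    exact: (measurableT_comp (mcoord j) measurable_fst).
  exact: (measurableT_comp (mcoord k) measurable_fst).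
have iidZ := iid_sums_pairs iidX hxi hXxi mh.
have [iXX EXX] := XX j k.
have EZ : mean P (fun w => h (X 0%N w) (xi 0%N w)) = 0.
  by rewrite /h meanB ?mean_cst ?EXX ?subrr//; exact: intble_cst.
have Z2 : intble P (fun w => h (X 0%N w) (xi 0%N w) ^+ 2).
  have i4 : intble P (fun w => (X 0%N w j 0 * X 0%N w k 0) ^+ 2).
    under eq_fun do rewrite exprMn.
    apply: intbleM; [exact: measurable_funX|exact: measurable_funX| |].
      by under eq_fun do rewrite -exprM; exact: X4.
    by under eq_fun do rewrite -exprM; exact: X4.
  have i5 := intbleD i4 (intbleD (intbleZ (- 2 * (j == k)%:R) iXX)
    (intble_cst P ((j == k)%:R ^+ 2))).
  have -> // : (fun w => h (X 0%N w) (xi 0%N w) ^+ 2) =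
    (fun w => (X 0%N w j 0 * X 0%N w k 0) ^+ 2 +
     (- 2 * (j == k)%:R * (X 0%N w j 0 * X 0%N w k 0) + (j == k)%:R ^+ 2)).
  by apply/funext => w; rewrite /h; ring.
set v := mean P (fun w => h (X 0%N w) (xi 0%N w) ^+ 2).
have gE n : (0 < n)%N -> intble P (fun w => gram_error n (X ^~ w) j k ^+ 2) /\
    mean P (fun w => gram_error n (X ^~ w) j k ^+ 2) = v / n%:R.
  move=> n0; have [i2 E2] := second_moment_sum iidZ Z2 EZ n.
  rewrite /gram_error; under eq_fun do rewrite exprMn.
  split; first exact: intbleZ.
  rewrite meanZ// E2 -/v; field.
  by rewrite pnatr_eq0 -lt0n.
split=> [n n0|]; first by have [] := gE n n0.
have v0 : 0 <= v by apply: mean_ge0 => w; exact: sqr_ge0.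
apply/cvgrPdist_le => e e0; near=> n.
have n0 : (0 < n)%N by near: n; exact: nbhs_infty_gt.
rewrite (proj2 (gE n n0)) sub0r normrN ger0_norm; last by rewrite divr_ge0.
rewrite ler_pdivrMr ?ltr0n// mulrC -ler_pdivrMr//.
by near: n; exact: nbhs_infty_ger.
Unshelve. all: by end_near. Qed.

Section vanishing_scale.
Variable tau : nat -> R.
Hypotheses (tau0 : forall n, 0 < tau n) (tau_cvg : tau n @[n --> \oo] -->
  (0:R)).

Let mdef t : measurable_fun setT (welsch_defect' t : R -> R).
Proof.
apply: measurable_funM => //; apply: measurable_funB => //.
apply: measurableT_comp => //; apply: measurable_funM => //.
Qed.

(** As the entries of X have unit variance, for n > 0 the second moment is that of [welsch_defect']
    at a single noise variable; it tends to 0 by dominated convergence with majorant xi^2. *)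
Lemma score_defect_second_moment j :
  (forall n, (0 < n)%N ->
    intble P (fun w => score_defect n (X ^~ w) (xi ^~ w) (tau n) j 0 ^+ 2)) /\
  (mean P (fun w => score_defect n (X ^~ w) (xi ^~ w) (tau n) j 0 ^+ 2)
    @[n --> \oo] --> (0 : R)).
Proof.
pose F n w := welsch_defect' (tau n) (xi 0%N w) ^+ 2.
have mF n : measurable_fun setT (F n).
  by apply: measurable_funX; exact: (measurableT_comp (mdef (tau n))).
have FB n w : `|F n w| <= xi 0%N w ^+ 2.
  rewrite ger0_norm ?sqr_ge0// /F -(real_normK (num_real (xi 0%N w))).
  rewrite -(real_normK (num_real (welsch_defect' _ _))).
  by apply: lerXn2r; rewrite ?nnegrE//; exact: welsch_defect'_le.
have iF n : intble P (F n) by apply: (intble_le (mF n) (proj1 xi2)).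
have cvF : mean P (F n) @[n --> \oo] --> (0:R).
  rewrite -[X in _ --> X](mean_cst P 0).
  apply: (mean_dominated_cvg (g := fun w => xi 0%N w ^+ 2)) => //.
    move=> w; rewrite -[X in _ --> X](expr0n R 2%N)/=.
    apply: (@cvg_comp _ _ _ _ (fun x : R => x ^+ 2));
      last exact: exprn_continuous.
    apply/cvgrPdist_le => e e0.
    have : `|xi 0%N w| ^+ 3 / 2 * tau n @[n --> \oo] --> (0:R).
      by rewrite -[X in _ --> X](mulr0 (`|xi 0%N w| ^+ 3 / 2)); exact: cvgMr.
    move=> /cvgrPdist_le/(_ _ e0) h; near=> n.
    have : `|0 - `|xi 0%N w| ^+ 3 / 2 * tau n| <= e by near: n.
    rewrite !sub0r !normrN; apply: le_trans.
    by rewrite (le_trans (welsch_defect'_small (tau0 n) _))// ler_norm.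
  by have [] := xi2.
have EXj : mean P (fun w => X 0%N w j 0 ^+ 2) = 1.
  have -> : (fun w => X 0%N w j 0 ^+ 2) = (fun w => X 0%N w j 0 * X 0%N w j 0).
    by apply/funext => w; rewrite expr2.
  by rewrite (proj2 (XX j j)) eqxx.
have E n : (0 < n)%N ->
    intble P (fun w => score_defect n (X ^~ w) (xi ^~ w) (tau n) j 0 ^+ 2) /\
    mean P (fun w => score_defect n (X ^~ w) (xi ^~ w) (tau n) j 0 ^+ 2) =
    mean P (F n).
  move=> n0; have [iidZ EZ Z2 EZ2] := cross_moments (mdef (tau n)) (mcoord j)
    (iF n) (X2 j) (proj2 (X1 j)).
  have -> : (fun w => score_defect n (X ^~ w) (xi ^~ w) (tau n) j 0 ^+ 2) =
      (fun w => ((Num.sqrt n%:R)^-1 *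
        \sum_(i < n) welsch_defect' (tau n) (xi i w) * X i w j 0) ^+ 2).
    by apply/funext => w; rewrite mxE.
  have [h ->] := second_moment_normalized iidZ Z2 EZ n0.
  by split => //; rewrite EZ2 EXj mulr1.
split=> [n n0|]; first by have [] := E n n0.
apply: cvg_trans cvF; apply: near_eq_cvg; near=> n.
have n0 : (0 < n)%N by near: n; exact: nbhs_infty_gt.
by rewrite (proj2 (E n n0)).
Unshelve. all: by end_near. Qed.

(** The mean is that of one term. In the minimum, the 3 gives the majorant 3 |X|^2 and the other
    argument the pointwise limit, so second moments suffice. *)
Lemma curvature_error_mean (c : R) :
  (forall n, (0 < n)%N ->
    intble P (fun w => curvature_error n (X ^~ w) (xi ^~ w) (tau n) c)) /\
  (mean P (fun w => curvature_error n (X ^~ w) (xi ^~ w) (tau n) c)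
    @[n --> \oo] --> (0 : R)).
Proof.
pose h n (x : 'cV[R]_p) (z : R) :=
  Num.min 3 (3 * tau n * (z ^+ 2 + c ^+ 2 * dotv x x)) * dotv x x.
have mdot : measurable_fun setT (fun x : 'cV[R]_p => dotv x x).
  by apply: measurable_sum => j; exact: measurable_funM.
have mh n : measurable_fun setT (fun z : 'cV[R]_p * R => h n z.1 z.2).
  have mdot1 : measurable_fun setT (fun z : 'cV[R]_p * R => dotv z.1 z.1).
    exact: (measurableT_comp mdot measurable_fst).
  apply: measurable_funM => //; apply: measurable_minr => //.
  apply: measurable_funM => //; apply: measurable_funD.
    by apply: measurable_funX; exact: measurable_snd.
  exact: measurable_funM.
pose F n w := h n (X 0%N w) (xi 0%N w).
have mF n : measurable_fun setT (F n).
  exact: (measurableT_comp (mh n) (measurable_fun_pair _ _)).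
have min0 n x z : 0 <= Num.min 3 (3 * tau n * (z ^+ 2 + c ^+ 2 * dotv x x)).
  rewrite le_min ler0n/=; apply: mulr_ge0; first by rewrite mulr_ge0// ltW.
  by apply: addr_ge0; [exact: sqr_ge0|apply: mulr_ge0;
    [exact: sqr_ge0|exact: dotv_ge0]].
have FB n w : `|F n w| <= 3 * dotv (X 0%N w) (X 0%N w).
  rewrite ger0_norm; last by rewrite mulr_ge0 ?dotv_ge0.
  by rewrite ler_wpM2r ?dotv_ge0// ge_min lexx.
have iB : intble P (fun w => 3 * dotv (X 0%N w) (X 0%N w)).
  by apply: intbleZ; apply: intble_sum => j; have [] := XX j j.
have iF n : intble P (F n) by exact: (intble_le (mF n) iB).
have cvF : mean P (F n) @[n --> \oo] --> (0:R).
  rewrite -[X in _ --> X](mean_cst P 0).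
  apply: (mean_dominated_cvg (g :=
    fun w => 3 * dotv (X 0%N w) (X 0%N w))) => //.
  move=> w; apply/cvgrPdist_le => e e0.
  set q := xi 0%N w ^+ 2 + c ^+ 2 * dotv (X 0%N w) (X 0%N w).
  have : 3 * q * dotv (X 0%N w) (X 0%N w) * tau n @[n --> \oo] --> (0:R).
    rewrite -[X in _ --> X](mulr0 (3 * q * dotv (X 0%N w) (X 0%N w))).
    exact: cvgMr.
  move=> /cvgrPdist_le/(_ _ e0) hq; near=> n.
  have : `|0 - 3 * q * dotv (X 0%N w) (X 0%N w) * tau n| <= e by near: n.
  rewrite !sub0r !normrN; apply: le_trans.
  rewrite ger0_norm; last by rewrite mulr_ge0 ?dotv_ge0.
  apply: le_trans (ler_norm _).
  have -> : 3 * q * dotv (X 0%N w) (X 0%N w) * tau n =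
    3 * tau n * q * dotv (X 0%N w) (X 0%N w) by ring.
  by rewrite /F /h -/q ler_wpM2r ?dotv_ge0// ge_min lexx orbT.
have E n : (0 < n)%N ->
    intble P (fun w => curvature_error n (X ^~ w) (xi ^~ w) (tau n) c) /\
    mean P (fun w => curvature_error n (X ^~ w) (xi ^~ w) (tau n) c) =
    mean P (F n).
  move=> n0; exact: (mean_average (iid_sums_pairs iidX hxi hXxi (mh n)) (iF n)
    n0).
split=> [n n0|]; first by have [] := E n n0.
apply: cvg_trans cvF; apply: near_eq_cvg; near=> n.
have n0 : (0 < n)%N by near: n; exact: nbhs_infty_gt.
by rewrite (proj2 (E n n0)).
Unshelve. all: by end_near. Qed.

End vanishing_scale.
End regression_limits.

(** * The normalized estimator is close to the score *)

Section welsch_estimator.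
Context {d : measure_display} {T : measurableType d} {R : realType}.
Variable P : probability T R.
Context {p : nat}.
Variables (X : nat -> {RV P >-> 'cV[R]_p}) (xi : nat -> {RV P >-> R}).
Hypothesis hXxi : independent_sequences X xi.
Hypothesis hX : design_assumption X.
Hypotheses (hxi : iid xi) (Exi : ('E_P[xi 0%N] = 0)%E)
  (Vxi : ('V_P[xi 0%N] = 1)%E).
Variables (bstar : 'cV[R]_p) (c : R) (tau : nat -> R).
Hypotheses (c0 : 0 < c) (tau0 : forall n, 0 < tau n)
  (tau_cvg : tau n @[n --> \oo] --> (0:R)).

Let scoreX n w := score n (X ^~ w) (xi ^~ w).
Let defectX n w := score_defect n (X ^~ w) (xi ^~ w) (tau n).
Let gramX n w := gram_error n (X ^~ w).
Let curvX n w := curvature_error n (X ^~ w) (xi ^~ w) (tau n) c.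

Let curvX_ge0 n w : 0 <= curvX n w.
Proof. exact: curvature_error_ge0. Qed.

(* A single application of Markov's inequality controls all error terms. *)
Let Psi (K eta : R) n w :=
  K^-1 * (\sum_j scoreX n w j 0 ^+ 2) +
  (eta ^- 2 * (\sum_j defectX n w j 0 ^+ 2) +
  (eta ^- 2 * (\sum_j \sum_k gramX n w j k ^+ 2) + eta^-1 * curvX n w)).

Let Psi_terms_ge0 n w : [/\ 0 <= \sum_j scoreX n w j 0 ^+ 2,
  0 <= \sum_j defectX n w j 0 ^+ 2 & 0 <= \sum_j \sum_k gramX n w j k ^+ 2].
Proof.
split.
- by apply: sumr_ge0 => j _; exact: sqr_ge0.
- by apply: sumr_ge0 => j _; exact: sqr_ge0.
- by apply: sumr_ge0 => j _; apply: sumr_ge0 => k _; exact: sqr_ge0.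
Qed.

(** The second moments of the score sum to at most p, uniformly in n; for fixed [eta] the other
    three terms tend to 0. *)
Let Psi_mean (K eta e : R) : 0 < K -> 0 < eta -> 0 < e ->
  \forall n \near \oo, intble P (Psi K eta n) /\
    mean P (Psi K eta n) <= p%:R / K + e.
Proof.
move=> K0 eta0 e0.
have iS n : intble P (fun w => \sum_j scoreX n w j 0 ^+ 2).
  by apply: intble_sum => j;
    have [] := score_second_moment hXxi hX hxi Exi Vxi n j.
have SE n : mean P (fun w => \sum_j scoreX n w j 0 ^+ 2) <= p%:R.
  rewrite mean_sum; last first.
    by move=> j; have [] := score_second_moment hXxi hX hxi Exi Vxi n j.
  apply: (@le_trans _ _ (\sum_(j < p) 1)); last by rewrite sumr_const card_ord.
  by apply: ler_sum => j _;
    have [] := score_second_moment hXxi hX hxi Exi Vxi n j.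
have iD n : (0 < n)%N -> intble P (fun w => \sum_j defectX n w j 0 ^+ 2).
  move=> n0; apply: intble_sum => j.
  by have [h _] := score_defect_second_moment hXxi hX hxi Exi Vxi tau0 tau_cvg
    j; exact: h.
have cD : \sum_j mean P (fun w => defectX n w j 0 ^+ 2) @[n --> \oo] --> (0:R).
  rewrite [X in _ --> X](_ : 0 = \sum_(j < p) (0:R)); last by rewrite big1.
  apply: cvg_sum_seq => j.
  by have [_ h] := score_defect_second_moment hXxi hX hxi Exi Vxi tau0 tau_cvg
    j.
have iG n : (0 < n)%N -> intble P (fun w => \sum_j \sum_k gramX n w j k ^+ 2).
  move=> n0; apply: intble_sum => j; apply: intble_sum => k.
  by have [h _] := gram_error_second_moment hXxi hX hxi j k; exact: h.
have cG : \sum_j \sum_k mean P (fun w => gramX n w j k ^+ 2) @[n --> \oo] -->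
  (0:R).
  rewrite [X in _ --> X](_ : 0 = \sum_(j < p) \sum_(k < p) (0:R)); last first.
    by rewrite big1// => j _; rewrite big1.
  apply: cvg_sum_seq => j; apply: cvg_sum_seq => k.
  by have [_ h] := gram_error_second_moment hXxi hX hxi j k.
have [iC cC] := curvature_error_mean hXxi hX hxi tau0 tau_cvg c.
have cvE : eta ^- 2 * (\sum_j mean P (fun w => defectX n w j 0 ^+ 2)) +
    (eta ^- 2 * (\sum_j \sum_k mean P (fun w => gramX n w j k ^+ 2)) +
     eta^-1 * mean P (curvX n)) @[n --> \oo] --> (0:R).
  rewrite [X in _ --> X](_ : 0 = eta ^- 2 * 0 + (eta ^- 2 * 0 + eta^-1 * 0));
    last first.
    by rewrite !mulr0 !addr0.
  by apply: cvgD; [exact: cvgMr|apply: cvgD; exact: cvgMr].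
move/cvgrPdist_le : cvE => /(_ _ e0) h; near=> n.
have n0 : (0 < n)%N by near: n; exact: nbhs_infty_gt.
have j1 := intbleZ K^-1 (iS n).
have j2 := intbleZ (eta ^- 2) (iD n n0).
have j3 := intbleZ (eta ^- 2) (iG n n0).
have j4 := intbleZ eta^-1 (iC n n0).
split; first exact: (intbleD j1 (intbleD j2 (intbleD j3 j4))).
rewrite (meanD j1 (intbleD j2 (intbleD j3 j4))) (meanD j2 (intbleD j3 j4)).
rewrite (meanD j3 j4).
rewrite (meanZ _ (iS n)) (meanZ _ (iD n n0)) (meanZ _ (iG n n0)) (meanZ _ (iC n
  n0)).
apply: lerD; first by rewrite mulrC ler_wpM2r// invr_ge0 ltW.
have -> : mean P (fun w => \sum_j defectX n w j 0 ^+ 2) =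
    \sum_j mean P (fun w => defectX n w j 0 ^+ 2).
  rewrite mean_sum// => j.
  by have [hh _] := score_defect_second_moment hXxi hX hxi Exi Vxi tau0 tau_cvg
    j; exact: hh.
have -> : mean P (fun w => \sum_j \sum_k gramX n w j k ^+ 2) =
    \sum_j \sum_k mean P (fun w => gramX n w j k ^+ 2).
  have iGjk j k : intble P (fun w => gramX n w j k ^+ 2).
    by have [hh _] := gram_error_second_moment hXxi hX hxi j k; exact: hh.
  rewrite mean_sum; last by move=> j; exact: intble_sum.
  by apply: eq_bigr => j _; rewrite mean_sum.
apply: le_trans (ler_norm _) _; rewrite -normrN -[X in `|X|]sub0r.
by near: n.
Unshelve. all: by end_near. Qed.

Lemma welsch_estimator_linearization (bhat : nat -> T -> 'cV[R]_p)
    (G : nat -> set T) (dl e : R) :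
  (forall n, measurable (G n)) -> P (G n) @[n --> \oo] --> 1%E ->
  (\forall n \near \oo, forall w, G n w -> minimizes_over (basin bstar c)
    (welsch_loss n (X ^~ w) (fun i => dotv (X i w) bstar + xi i w) (tau n))
    (bhat n w)) ->
  0 < dl -> 0 < e -> \forall n \near \oo, exists A,
    [/\ measurable A, (P A <= e%:E)%E & forall w, ~ A w -> forall j,
      `|(Num.sqrt n%:R *: (bhat n w - bstar)) j 0 - scoreX n w j 0| <= dl].
Proof.
move=> mG PG minG dl0 e0.
(* Makes p / K at most e / 4; the + 1 keeps [K] positive when p = 0. *)
pose K := 4 * p%:R / e + 1.
have K0 : 0 < K by rewrite ltr_wpDl// divr_ge0 ?mulr_ge0// ltW.
have pK : p%:R / K <= e / 4.
  rewrite ler_pdivrMr// /K mulrDr mulr1.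
  have -> : e / 4 * (4 * p%:R / e) = p%:R by field; rewrite gt_eqF.
  by rewrite lerDl divr_ge0// ltW.
(* From |g|^2 <= 2 |score|^2 + 2 |score_defect|^2, the squares being at most K and eta^2 <= 1. *)
pose B := 2 * (K + 1).
have B0 : 0 < B by rewrite mulr_gt0// ltr_wpDr.
(* The first bound validates the comparison of minimizers, the second ensures 12 kap B <= (dl /
   2)^2. *)
pose kap := Num.min (1 / 8) (dl ^+ 2 / (48 * B)).
have kap0 : 0 < kap.
  by rewrite lt_min divr_gt0//= divr_gt0 ?exprn_gt0// mulr_gt0.
(* dl / 2 serves the score defect; the last bound makes half the sum of p^2 Gram entries plus the
   curvature, each at most [eta], stay below [kap]. *)
pose eta := Num.min 1 (Num.min (dl / 2) (kap / (p%:R ^+ 2 + 1))).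
have p21 : 0 < p%:R ^+ 2 + 1 :> R by rewrite ltr_wpDl// sqr_ge0.
have eta0 : 0 < eta by rewrite !lt_min ltr01/= !divr_gt0.
have eta1 : eta <= 1 by rewrite ge_min lexx.
have eta2 : eta <= dl / 2 by rewrite !ge_min lexx orbT.
have eta3 : (p%:R ^+ 2 + 1) * eta <= kap.
  by rewrite mulrC -ler_pdivlMr// !ge_min lexx !orbT.
have e40 : 0 < e / 4 by rewrite divr_gt0.
have e20 : 0 < e / 2 by rewrite divr_gt0.
have PGc : \forall n \near \oo, (P (~` G n) <= (e / 2)%:E)%E.
  have fin n : P (G n) \is a fin_num by exact: fin_num_measure.
  have : fine (P (G n)) @[n --> \oo] --> (1:R) by apply: fine_cvg.
  move=> /cvgrPdist_le/(_ _ e20) h; near=> n.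
  rewrite probability_setC// -(fineK (fin n)) -EFinB lee_fin.
  have : `|1 - fine (P (G n))| <= e / 2 by near: n.
  by apply: le_trans; exact: ler_norm.
have PsiN := Psi_mean K0 eta0 e40.
near=> n.
have n0 : (0 < n)%N by near: n; exact: nbhs_infty_gt.
have [iPsi EPsi] : intble P (Psi K eta n) /\
    mean P (Psi K eta n) <= p%:R / K + e / 4 by near: n.
have minn : forall w, G n w -> minimizes_over (basin bstar c)
    (welsch_loss n (X ^~ w) (fun i => dotv (X i w) bstar + xi i w) (tau n))
    (bhat n w) by near: n.
have PGn : (P (~` G n) <= (e / 2)%:E)%E by near: n.
have nB : B <= c ^+ 2 * n%:R.
  rewrite mulrC -ler_pdivrMr ?exprn_gt0//.
  by near: n; exact: nbhs_infty_ger.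
have Psi0 w : 0 <= Psi K eta n w.
  have [h1 h2 h3] := Psi_terms_ge0 n w.
  by rewrite !addr_ge0// mulr_ge0// ?invr_ge0 ?exprn_ge0 ?ltW.
(* Off [L] each of the four nonnegative terms of [Psi] is below 1, which gives [b1] to [b4]. *)
pose L := [set w | 1 <= Psi K eta n w].
have mL : measurable L.
  have mPsi := intble_measurable iPsi.
  rewrite -[X in measurable X]setTI.
  rewrite (_ : L = Psi K eta n @^-1` `[1, +oo[%classic).
    exact: mPsi.
  by apply/seteqP; split=> x /=; rewrite in_itv/= andbT.
have PL : (P L <= (e / 2)%:E)%E.
  apply: (le_trans (markov_mean iPsi Psi0 ltr01)).
  rewrite lee_fin divr1 (le_trans EPsi)//; lra.
exists (~` G n `|` L); split.
- by apply: measurableU => //; exact: measurableC.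
- apply: (le_trans (measureU2 _ _ _)) => //; first exact: measurableC.
  by rewrite [e]splitr EFinD leeD.
move=> w /not_orP[/contrapT Gw /negP]; rewrite -ltNge => Psi1 j.
have [h1 h2 h3] := Psi_terms_ge0 n w.
have h4 := curvX_ge0 n w.
have eta2p : 0 < eta ^- 2 by rewrite invr_gt0 exprn_gt0.
have t1 : 0 <= K^-1 * (\sum_j scoreX n w j 0 ^+ 2).
  by rewrite mulr_ge0// invr_ge0 ltW.
have t2 : 0 <= eta ^- 2 * (\sum_j defectX n w j 0 ^+ 2)
  by rewrite mulr_ge0// ltW.
have t3 : 0 <= eta ^- 2 * (\sum_j \sum_k gramX n w j k ^+ 2).
  by rewrite mulr_ge0// ltW.
have t4 : 0 <= eta^-1 * curvX n w by rewrite mulr_ge0// invr_ge0 ltW.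
rewrite /Psi in Psi1.
have b1 : \sum_j scoreX n w j 0 ^+ 2 <= K.
  rewrite -[leRHS]mulr1 -ler_pdivrMl//; lra.
have b2 : \sum_j defectX n w j 0 ^+ 2 <= eta ^+ 2.
  rewrite -[leRHS]mulr1 -ler_pdivrMl ?exprn_gt0//; lra.
have b3 : \sum_j \sum_k gramX n w j k ^+ 2 <= eta ^+ 2.
  rewrite -[leRHS]mulr1 -ler_pdivrMl ?exprn_gt0//; lra.
have b4 : curvX n w <= eta.
  rewrite -[leRHS]mulr1 -ler_pdivrMl//; lra.
have b3jk i k : `|gramX n w i k| <= eta.
  apply: norm_le_sqr; first exact: ltW.
  rewrite (le_trans _ b3)//.
  rewrite (bigD1 i)//= ler_wpDr//.
    by apply: sumr_ge0 => i' _; apply: sumr_ge0 => k' _; exact: sqr_ge0.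
  rewrite (bigD1 k)//= ler_wpDr//.
  by apply: sumr_ge0 => k' _; exact: sqr_ge0.
set kk := (\sum_i \sum_k `|gramX n w i k|) / 2 + curvX n w.
have kkap : kk <= kap.
  rewrite (le_trans _ eta3)// mulrDl mul1r lerD//.
  have : \sum_i \sum_k `|gramX n w i k| <= \sum_(i < p) \sum_(k < p) eta.
    by apply: ler_sum => i _; apply: ler_sum => k _; exact: b3jk.
  rewrite !sumr_const !card_ord -mulrnA -[leRHS]mulr_natl natrM -expr2.
  have : 0 <= p%:R ^+ 2 * eta by rewrite mulr_ge0 ?sqr_ge0// ltW.
  lra.
have kk0 : 0 <= kk.
  rewrite addr_ge0// divr_ge0// sumr_ge0// => i _; rewrite sumr_ge0//.
pose g := scoreX n w - defectX n w.
have gB : dotv g g <= B.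
  rewrite /dotv (@le_trans _ _ (\sum_i (2 * scoreX n w i 0 ^+ 2 + 2 * defectX n
    w i 0 ^+ 2)))//.
    apply: ler_sum => i _; rewrite [X in X * _]mxE [X in _ * X]mxE.
    rewrite [(- defectX n w) i 0]mxE.
    have := sqr_ge0 (scoreX n w i 0 + defectX n w i 0); nra.
  rewrite big_split/= -!mulr_sumr /B mulrDr lerD// ler_pM2l//.
  by rewrite (le_trans b2)// expr_le1// ltW.
have kap8 : kap <= 1 / 8 by rewrite ge_min lexx.
have kapB : 12 * kap * B <= dl ^+ 2 / 4.
  have : kap <= dl ^+ 2 / (48 * B) by rewrite ge_min lexx orbT.
  rewrite ler_pdivlMr ?mulr_gt0//; lra.
have close := welsch_minimizer_close n0 (tau0 n) (ltW c0) (minn w Gw)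
  (le_trans kkap kap8) (le_trans gB nB).
rewrite -/(scoreX n w) -/(defectX n w) -/g -/(gramX n w) -/(curvX n w) -/kk in
  close.
set v := Num.sqrt n%:R *: (bhat n w - bstar) in close *.
have dist : `|(v - g) j 0| <= dl / 2.
  apply: norm_le_sqr; first by rewrite divr_ge0// ltW.
  rewrite (le_trans (coord_le_dotv _ j))// (le_trans close)//.
  rewrite exprMn [2^-1 ^+ 2](_ : _ = 4^-1); last by field.
  rewrite (le_trans _ kapB)//.
  apply: ler_pM => //; [by rewrite mulr_ge0|exact: dotv_ge0|by rewrite
    ler_pM2l].
have dj : `|defectX n w j 0| <= dl / 2.
  rewrite (le_trans _ eta2)//; apply: norm_le_sqr; first exact: ltW.
  rewrite (le_trans _ b2)// (bigD1 j)//= lerDl.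
  by apply: sumr_ge0 => i _; exact: sqr_ge0.
have -> : v j 0 - scoreX n w j 0 = (v - g) j 0 - defectX n w j 0.
  by rewrite /g !mxE; ring.
by rewrite (le_trans (ler_normB _ _))// [dl]splitr lerD.
Unshelve. all: by end_near. Qed.

End welsch_estimator.

Theorem theorem4 (R : realType) :
  exists2 C0 : R, 0 < C0 &
  forall (C : R) (hC : C0 <= C) (abound : R),
  exists2 c0 : R, 0 < c0 &
  forall (c : R) (hc : 0 < c <= c0)
    (p : nat) (d : measure_display) (T : measurableType d)
    (P : probability T R)
    (bstar : 'cV[R]_p)
    (X : nat -> {RV P >-> 'cV[R]_p}) (xi : nat -> {RV P >-> R})
    (Y : nat -> T -> R)
    (hY : forall i w, Y i w = dotv (X i w) bstar + xi i w)
    (hXxi : independent_sequences X xi)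
    (hX : design_assumption X)
    (l : \bar R) (hl : (2%:E <= l)%E)
    (a : R) (ha : 0 < a <= abound)
    (hxi : noise_assumption xi l a)
    (u : nat -> R) (hu : u n @[n --> \oo] --> +oo)
    (hslow : u n / n%:R @[n --> \oo] --> 0)
    (tau : nat -> R) (htau : forall n, tau n = u n / n%:R)
    (hn : with_high_probability P (fun n => [set w |
      C * (num_large_residuals n (X ^~ w) (Y ^~ w) (tau n) bstar + p)%:R
        <= n%:R]))
    (lad welsch : nat -> T -> opt_procedure R p)
    (b0 : nat -> T -> 'cV[R]_p) (thr : nat -> R)
    (bhat : nat -> {RV P >-> 'cV[R]_p})
    (hbhat : with_high_probability P (fun n => [set w |
      two_stage_welsch (lad n w) (welsch n w) (b0 n w) (thr n) (tau n) c bstar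
        n (X ^~ w) (Y ^~ w) (bhat n w)])),
  cvg_in_distribution P
    (fun n w => Num.sqrt n%:R *: (bhat n w - bstar)) (std_normal R p).
Proof.
exists 1 => [|C _ abound]; first exact: ltr01.
exists 1 => [|c /andP[c0 _] p d T P bstar X xi Y hY hXxi hX l _ a _ hxi u hu
  hslow tau htau _ lad welsch b0 thr bhat [G [mG GE PG]]]; first exact: ltr01.
have [iidxi Exi Vxi _] := hxi.
have tau_pos : \forall n \near \oo, 0 < tau n.
  near=> n; rewrite htau divr_gt0//.
    by near: n; move/cvgryPgt : hu; exact.
  by rewrite ltr0n; near: n; exact: nbhs_infty_gt.
(* [tau n] need not be positive for the first few [n]. *)
pose tau' n := if 0 < tau n then tau n else 1.
have tau'0 n : 0 < tau' n by rewrite /tau'; case: ifP => // _; exact: ltr01.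
have tau'E : \forall n \near \oo, tau' n = tau n.
  by near=> n; rewrite /tau' ifT//; near: n.
have tau'_cvg : tau' n @[n --> \oo] --> (0 : R).
  have tau_cvg : tau n @[n --> \oo] --> (0 : R) by under eq_fun do rewrite htau.
  by apply: cvg_trans tau_cvg; apply: near_eq_cvg; near=> n; apply/esym; near: n.
have mV n : measurable_fun setT (fun w => Num.sqrt n%:R *: (bhat n w - bstar)).
  apply: measurable_fun_matrix => i j; under eq_fun do rewrite !mxE.
  apply: measurable_funM => //; apply: measurable_funB => //.
  exact: (measurableT_comp (measurable_entry i j)).
apply: (cvg_in_distribution_trig (W := fun n w => score n (X ^~ w) (xi ^~ w))
  (K := 1)) => //.
- exact: measurable_score.
- by move=> t th; rewrite mean_std_normal_cos; exact: score_clt.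
- by move=> n j; exact: score_second_moment.
move=> dl e; apply: (welsch_estimator_linearization hXxi hX iidxi Exi Vxi c0
  tau'0 tau'_cvg mG PG).
near=> n; move=> w Gw.
have [_ [_ _ _ hmin]] := GE n w Gw.
have -> : tau' n = tau n by near: n.
by rewrite (_ : (fun i => dotv (X i w) bstar + xi i w) = Y ^~ w)//; apply/funext => i.
Unshelve. all: by end_near. Qed.
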